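(* Let $m\ge2$ and let $(X_t)_{t\in\mathbb{Z}}$ be a real-valued process whose increment process $\Delta_t=X_t-X_{t-1}$ is stationary, such that $\boldsymbol{\Delta}_0=(\Delta_1,\dots,\Delta_{m-1})^\top$ has no ties in the sense that $\mathbb{P}(X_j=X_k)=0$ for $j\ne k$. Suppose $(\Delta_t)$ is a 1-approximating functional, with approximating constants $(a_k)_{k\in\mathbb{N}_0}$, of an absolutely regular process with mixing coefficients $(\beta_k)_{k\in\mathbb{N}_0}$ such that $\sum_{k=0}^\infty k^2(\sqrt{a_k}+\beta_k)<\infty$. Let $\phi$ be a function witnessing the $1$-continuity of the kernel $h$ with respect to the distribution of $\boldsymbol{\Delta}_0$, and assume $$\sum_{k=m-1}^\infty k^2\,\phi\Big(2\sqrt{\textstyle\sum_{i=0}^{m-1}a_{k-i}}\Big)<\infty.$$ Then, as $n\to\infty$, $\sqrt n(\hat{\mathbf p}-\mathbf p)\xrightarrow{d}N(\mathbf 0,\Sigma)$, where $\Sigma=(\sigma_{ij})_{1\le i,j\le m!}$ with $$\sigma_{ij}=p_i(\delta_{ij}-p_j)+\sum_{k=1}^\infty\big(p_{ij}(k)+p_{ji}(k)-2p_ip_j\big),$$ the series converging absolutely.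
   Context: OPs: for $m\ge2$, $S_m$ is the set of permutations of $1,\dots,m$; for $\mathbf{x}\in\mathbb{R}^m$ its OP is the unique $\pi\in S_m$ with $\pi^{(j)}<\pi^{(k)}\iff x_j<x_k$ (or $x_j=x_k$ and $j<k$). The $m!$ OPs are $\pi_1,\dots,\pi_{m!}$ in lexicographic order. $\Pi_{\Delta}(\mathbf{y})$ denotes the OP of $(0,y_1,y_1+y_2,\dots,y_1+\dots+y_{m-1})$ for $\mathbf y\in\mathbb R^{m-1}$, and $h(\mathbf{y})=(\mathbb{1}\{\Pi_{\Delta}(\mathbf{y})=\pi_1\},\dots,\mathbb{1}\{\Pi_{\Delta}(\mathbf{y})=\pi_{m!}\})^\top$. With $\mathbf{X}_t=(X_t,\dots,X_{t+m-1})$ and $\boldsymbol\Delta_t=(\Delta_{t+1},\dots,\Delta_{t+m-1})^\top$, $\Pi_t$ is the OP of $\mathbf X_t$ (equivalently $\Pi_\Delta(\boldsymbol\Delta_t)$); $\mathbf p=(p_1,\dots,p_{m!})$ with $p_i=\mathbb P(\Pi_0=\pi_i)$; $\hat{\mathbf p}=\frac1n\sum_{t=1}^n h(\boldsymbol\Delta_t)$; $p_{ij}(k)=\mathbb P(\Pi_0=\pi_i,\Pi_k=\pi_j)$; $\delta_{ij}$ is the Kronecker delta. Mixing: for a process $(Z_t)$ let $\mathcal A_k^l=\sigma(Z_k,\dots,Z_l)$. It is absolutely regular if $\beta_k=\sup_n\sup\sum_{i=1}^I\sum_{j=1}^J|\mathbb P(A_i\cap B_j)-\mathbb P(A_i)\mathbb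 P(B_j)|\to0$, the inner sup over finite $\mathcal A_1^n$-measurable partitions $(A_i)$ and finite $\mathcal A_{n+k}^\infty$-measurable partitions $(B_j)$. A sequence $(Y_t)$ is a functional of a stationary $(Z_t)$ if $Y_t=f((Z_{t+k})_{k\in\mathbb Z})$ for a measurable $f$; it is a 1-approximating functional with constants $a_k\to0$ if $\mathbb E|Y_0-\mathbb E(Y_0\mid\mathcal A_{-k}^k)|\le a_k$ for all $k\in\mathbb N_0$. A function $h$ is $1$-continuous w.r.t. a distribution $F$ with witness $\phi:(0,\infty)\to(0,\infty)$, $\phi(\varepsilon)\to0$ as $\varepsilon\to0$, if $\mathbb E(\|h(\mathbf Y)-h(\mathbf Y')\|\mathbb 1\{\|\mathbf Y-\mathbf Y'\|\le\varepsilon\})\le\phi(\varepsilon)$ for all $\mathbf Y,\mathbf Y'$ each with distribution $F$ (the value $\phi(0)$ is understood as $\lim$ / the same expression at $\varepsilon=0$). *)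

(* Defs.v *)
From HB Require Import structures.
From mathcomp Require Import all_boot all_order all_algebra all_fingroup.
From mathcomp Require Import all_classical all_reals all_analysis.
Set Implicit Arguments. Unset Strict Implicit. Unset Printing Implicit Defensive.
Import Order.TTheory GRing.Theory Num.Theory.
Import numFieldNormedType.Exports.
Local Open Scope classical_set_scope.
Local Open Scope ring_scope.

Definition is_OP {R : realType} (m : nat) (x : 'I_m -> R) (s : {perm 'I_m}) : bool :=
  [forall j : 'I_m, forall k : 'I_m,
     (s j < s k)%N == ((x j < x k) || ((x j == x k) && (j < k)%N))].

Fixpoint lex_le (a b : seq nat) : bool :=
  match a, b with
  | [::], _ => true
  | _ :: _, [::] => false
  | x :: a', y :: b' => (x < y)%N || ((x == y) && lex_le a' b')
  end.

Definition perm_line (m : nat) (s : {perm 'I_m}) : seq nat :=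
  [seq val (s j) | j <- enum 'I_m].

(* the m! permutations in lexicographic order: piL m i = pi_{i+1} *)
Definition perms_lex (m : nat) : seq {perm 'I_m} :=
  sort (fun s t => lex_le (perm_line s) (perm_line t)) (enum {perm 'I_m}).

Definition piL (m : nat) (i : 'I_(m`!)) : {perm 'I_m} := nth 1%g (perms_lex m) i.

Definition cumsum {R : realType} (m : nat) (y : m.-1.-tuple R) : 'I_m -> R :=
  fun j => \sum_(i < m.-1 | (i < j)%N) tnth y i.

Definition hOP {R : realType} (m : nat) (y : m.-1.-tuple R) : (m`!).-tuple R :=
  [tuple (if is_OP (cumsum y) (piL i) then 1 else 0) | i < m`!].

Definition enorm {R : realType} (n : nat) (v : n.-tuple R) : R :=
  Num.sqrt (\sum_(i < n) (tnth v i) ^+ 2).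

Definition tsub {R : realType} (n : nat) (u v : n.-tuple R) : n.-tuple R :=
  [tuple tnth u i - tnth v i | i < n].

Section Proc.
Context {R : realType} {d : measure_display} {T : measurableType d}.
Variable P : probability T R.

Definition stationary {d' : measure_display} {S : measurableType d'}
    (Z : int -> T -> S) : Prop :=
  forall (n : nat) (ts : n.-tuple int) (s : int) (A : set (n.-tuple S)),
    measurable A ->
    P [set w | A [tuple Z (tnth ts i + s)%R w | i < n]] =
    P [set w | A [tuple Z (tnth ts i) w | i < n]].

Definition sigZ {d' : measure_display} {S : measurableType d'}
    (Z : int -> T -> S) (I : set int) : set (set T) :=
  <<s \bigcup_(i in I) preimage_set_system setT (Z i) measurable >>.

Definition prod_sigma {d' : measure_display} (S : measurableType d') :
  set (set (int -> S)) :=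
  <<s \bigcup_(i in [set: int]) preimage_set_system setT (fun z : int -> S => z i) measurable >>.

Definition fin_partition (F : set (set T)) (I : nat) (A : 'I_I -> set T) : Prop :=
  (forall i, F (A i)) /\ (forall i j, i != j -> A i `&` A j = set0) /\
  \big[setU/set0]_(i < I) A i = setT.

Definition beta_coef {d' : measure_display} {S : measurableType d'}
    (Z : int -> T -> S) (k : nat) : \bar R :=
  ereal_sup [set x | exists (n : nat) (I J : nat) (A : 'I_I -> set T) (B : 'I_J -> set T),
     fin_partition (sigZ Z [set t : int | (1 <= t <= n%:Z)%R]) A /\
     fin_partition (sigZ Z [set t : int | (n%:Z + k%:Z <= t)%R]) B /\
     x = (\sum_(i < I) \sum_(j < J) `|P (A i `&` B j) - P (A i) * P (B j)|)%E].

Definition is_cond_exp (G : set (set T)) (Y g : T -> R) : Prop :=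
  (forall B : set R, measurable B -> G (g @^-1` B)) /\
  P.-integrable setT (EFin \o Y) /\ P.-integrable setT (EFin \o g) /\
  forall A, G A -> (\int[P]_(x in A) (g x)%:E = \int[P]_(x in A) (Y x)%:E)%E.

Definition functional_of {d' : measure_display} {S : measurableType d'}
    (Y : int -> T -> R) (Z : int -> T -> S) : Prop :=
  stationary Z /\ (forall t, measurable_fun setT (Z t)) /\
  exists f : (int -> S) -> R,
    (forall B : set R, measurable B -> prod_sigma (S:=S) (f @^-1` B)) /\
    forall t w, Y t w = f (fun k => Z (t + k)%R w).

Definition one_approx {d' : measure_display} {S : measurableType d'}
    (Y : int -> T -> R) (Z : int -> T -> S) (a : nat -> R) : Prop :=
  functional_of Y Z /\
  forall k : nat, exists g : T -> R,
    is_cond_exp (sigZ Z [set t : int | (- k%:Z <= t <= k%:Z)%R]) (Y 0%R) g /\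
    (\int[P]_w `|Y 0%R w - g w|%:E <= (a k)%:E)%E.

End Proc.

Definition one_continuous_witness {R : realType} {d : measure_display}
    {T : measurableType d} (P : probability T R) (m : nat)
    (V : T -> m.-1.-tuple R) (phi : R -> R) : Prop :=
  (forall e, 0 < e -> 0 < phi e) /\ phi 0 = 0 /\
  (phi e @[e --> 0^'+] --> 0) /\
  forall (d' : measure_display) (T' : measurableType d') (P' : probability T' R)
         (Y Y' : T' -> m.-1.-tuple R),
    measurable_fun setT Y -> measurable_fun setT Y' ->
    (forall A : set (m.-1.-tuple R), measurable A -> P' (Y @^-1` A) = P (V @^-1` A)) ->
    (forall A : set (m.-1.-tuple R), measurable A -> P' (Y' @^-1` A) = P (V @^-1` A)) ->
    forall e, 0 < e ->
      (\int[P']_w ((enorm (tsub (hOP (Y w)) (hOP (Y' w)))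
                    * (if enorm (tsub (Y w) (Y' w)) <= e then 1 else 0))%:E)
        <= (phi e)%:E)%E.

Definition dotv {R : realType} (n : nat) (u v : n.-tuple R) : R :=
  \sum_(i < n) tnth u i * tnth v i.

(* mu is the (possibly degenerate) centered normal law N(0, Sigma) on R^n,
   defined through its characteristic function exp(-t'Sigma t/2) *)
Definition is_normal0 {R : realType} (n : nat)
    (mu : probability (n.-tuple R) R) (Sigma : 'I_n -> 'I_n -> R) : Prop :=
  forall t : n.-tuple R,
    (\int[mu]_x (cos (dotv t x))%:E = (expR (- (\sum_(i < n) \sum_(j < n)
          tnth t i * Sigma i j * tnth t j) / 2))%:E)%E /\
    (\int[mu]_x (sin (dotv t x))%:E = 0)%E.

Definition bounded_continuous {R : realType} (n : nat) (f : n.-tuple R -> R) : Prop :=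
  (exists M, forall x, `|f x| <= M) /\
  forall x (e : R), 0 < e -> exists2 delta : R, 0 < delta &
    forall y, enorm (tsub x y) < delta -> `|f x - f y| < e.

Definition cvg_dist {R : realType} {d : measure_display} {T : measurableType d}
    (P : probability T R) (n : nat) (V : nat -> T -> n.-tuple R)
    (mu : probability (n.-tuple R) R) : Prop :=
  forall f : n.-tuple R -> R, bounded_continuous f ->
    (\int[P]_w (f (V N w))%:E)%E @[N --> \oo] --> (\int[mu]_x (f x)%:E)%E.

(* Main.v *)
Require Import Defs.
From HB Require Import structures.
From mathcomp Require Import all_boot all_order all_algebra all_fingroup.
From mathcomp Require Import all_classical all_reals all_analysis measurable_realfun.
From mathcomp Require Import ring lra zify.
Set Implicit Arguments.
Unset Strict Implicit.
Unset Printing Implicit Defensive.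
Import Order.TTheory GRing.Theory Num.Theory.
Import numFieldNormedType.Exports.
Local Open Scope classical_set_scope.
Local Open Scope ring_scope.

(* By the Cramer-Wold device, the theorem reduces to a central limit theorem for bounded scalar
   combinations Y_t of the centred indicators h_i(Delta_t).  Approximate Delta_t by a countably
   valued function kap of the window Z_{t-k}, ..., Z_{t+k} and draw a copy of the path that is
   conditionally independent given kap; 1-continuity applied to this pair, with Markov's inequality
   for the distance of the increments, shows that h(Delta_t) is within phi(2 sqrt s_k) + 2 sqrt s_k
   in L^1 of a function of the window, where s_k is the sum of the a_{k-i}, i < m.  Functions of
   separated windows are nearly uncorrelated by absolute regularity.  This gives summable
   covariances and, after splitting n times into long blocks separated by short gaps (Bernstein),
   the convergence of characteristic functions: block sums are replaced by window functions,
   factorized, and expanded to second order, third moments being at most C p times the variance for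
   blocks of length p.  Levy's continuity theorem then follows by approximating a continuous function
   on a box by trigonometric polynomials (Bernstein polynomials in sines of the coordinates). *)

(** 1-continuity compares [h] only at two random vectors that both have the law of the increments,
    whereas an approximation of the increments by a window function has another law. The copy
    removes this obstacle: it has the right law and shares with the original the value of [kap]. As
    [kap] takes countably many values, the joint law has an explicit density with respect to the
    product measure, and the approximating window functions are plain conditional means over cells.
    Everything is real-valued: a characteristic function is a pair of a cosine and a sine
    expectation, and factorization over blocks is the addition theorem applied to this pair. The
    weight [k^2] matches the block count: with gaps of order [l] there are of order [l^2] blocks,
    and one mixing error is paid per block. In Levy's theorem the polynomials in sines are convex
    combinations of values of the function at every point of the space, so its sup bound survives
    outside the box, where tightness takes over. *)

Section bounded_measurable.
Context {R : realType} {d : measure_display} {T : measurableType d}.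
Implicit Types f g : T -> R.

(** On a probability space such functions are integrable, so integrability of an expectation reduces
    to the closure rules below. *)
Definition bdm f := measurable_fun setT f /\ exists C : R, forall w, `|f w| <= C.

Lemma bdm_cst (c : R) : bdm (fun=> c).
Proof. by split => //; exists `|c|. Qed.

Lemma bdmD f g : bdm f -> bdm g -> bdm (fun w => f w + g w).
Proof.
move=> [mf [C hC]] [mg [D hD]]; split; first exact: measurable_funD.
by exists (C + D) => w; rewrite (le_trans (ler_normD _ _))// lerD.
Qed.

Lemma bdmN f : bdm f -> bdm (fun w => - f w).
Proof.
move=> [mf [C hC]]; split; first exact: measurable_funN.
by exists C => w; rewrite normrN.
Qed.

Lemma bdmB f g : bdm f -> bdm g -> bdm (fun w => f w - g w).
Proof. by move=> bf bg; apply: bdmD => //; exact: bdmN. Qed.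

Lemma bdmM f g : bdm f -> bdm g -> bdm (fun w => f w * g w).
Proof.
move=> [mf [C hC]] [mg [D hD]]; split; first exact: measurable_funM.
by exists (C * D) => w; rewrite normrM ler_pM.
Qed.

Lemma bdmX f n : bdm f -> bdm (fun w => f w ^+ n).
Proof.
move=> [mf [C hC]]; split; first exact: measurable_funX.
by exists (C ^+ n) => w; rewrite normrX lerXn2r// nnegrE (le_trans _ (hC w)).
Qed.

Lemma bdm_norm f : bdm f -> bdm (fun w => `|f w|).
Proof.
move=> [mf [C hC]]; split; first exact: measurableT_comp.
by exists C => w; rewrite normr_id.
Qed.

Lemma bdm_sum (I : Type) (s : seq I) (Q : pred I) (F : I -> T -> R) :
  (forall i, Q i -> bdm (F i)) -> bdm (fun w => \sum_(i <- s | Q i) F i w).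
Proof.
move=> bF; elim: s => [|i s ih].
  by rewrite (_ : (fun _ => _) = fun=> 0); [exact: bdm_cst|apply/funext => w; rewrite big_nil].
rewrite (_ : (fun _ => _) = fun w => if Q i then F i w + \sum_(i <- s | Q i) F i w
    else \sum_(i <- s | Q i) F i w); last by apply/funext => w; rewrite big_cons.
by have [/bF bFi|//] := boolP (Q i); exact: bdmD.
Qed.

Lemma bdm_cos f : measurable_fun setT f -> bdm (fun w => cos (f w)).
Proof.
move=> mf; split.
  by apply: (measurableT_comp _ mf); apply: continuous_measurable_fun; exact: continuous_cos.
by exists 1 => w; rewrite ler_norml cos_geN1 cos_le1.
Qed.

Lemma bdm_sin f : measurable_fun setT f -> bdm (fun w => sin (f w)).
Proof.
move=> mf; split.
  by apply: (measurableT_comp _ mf); apply: continuous_measurable_fun; exact: continuous_sin.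
by exists 1 => w; rewrite ler_norml sin_geN1 sin_le1.
Qed.

Lemma bdm_if (b : T -> bool) : measurable [set w | b w] ->
  bdm (fun w => if b w then 1 else 0).
Proof.
move=> mb; split; last by exists 1 => w; case: ifP => _; rewrite ?normr1// normr0.
rewrite (_ : (fun _ => _) = \1_[set w | b w]); first exact: measurable_indic.
apply/funext => w; rewrite indicE; case: ifPn => bw; first by rewrite mem_set.
by rewrite memNset//= (negbTE bw).
Qed.

End bounded_measurable.

Section expectation_bounded.
Context {R : realType} {d : measure_display} {T : measurableType d}.
Variable P : probability T R.
Implicit Types f g : T -> R.

Lemma bdm_int f : bdm f -> P.-integrable setT (EFin \o f).
Proof.
move=> [mf [C hC]]; apply: measurable_bounded_integrable => //.
  by rewrite (le_lt_trans (probability_le1 P measurableT))// ltry.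
exists C; split; first by rewrite num_real.
by move=> x Cx w _ /=; apply: le_trans (hC w) (ltW Cx).
Qed.

Lemma Ex_fin f : bdm f -> (\int[P]_w (f w)%:E)%E = (\int[P]_w f w)%:E.
Proof. by move=> bf; rewrite fineK//; exact: integrable_fin_num (bdm_int bf). Qed.

Lemma ExD f g : bdm f -> bdm g ->
  \int[P]_w (f w + g w) = \int[P]_w f w + \int[P]_w g w.
Proof. by move=> bf bg; apply: RintegralD => //; exact: bdm_int. Qed.

Lemma ExB f g : bdm f -> bdm g ->
  \int[P]_w (f w - g w) = \int[P]_w f w - \int[P]_w g w.
Proof. by move=> bf bg; apply: RintegralB => //; exact: bdm_int. Qed.

Lemma ExZ (c : R) f : bdm f -> \int[P]_w (c * f w) = c * \int[P]_w f w.
Proof. by move=> bf; apply: RintegralZl => //; exact: bdm_int. Qed.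

Lemma Ex_cst (c : R) : \int[P]_w c = c.
Proof. by rewrite Rintegral_cst// [fine _](_ : _ = 1) ?mulr1// [X in fine X]probability_setT. Qed.

Lemma Ex_sum (I : eqType) (s : seq I) (F : I -> T -> R) :
  (forall i, i \in s -> bdm (F i)) ->
  \int[P]_w (\sum_(i <- s) F i w) = \sum_(i <- s) \int[P]_w F i w.
Proof.
elim: s => [|i s ih] bF.
  by under eq_Rintegral do rewrite big_nil; rewrite big_nil Ex_cst.
under eq_Rintegral do rewrite big_cons.
rewrite big_cons ExD//; last 2 first.
- by apply: bF; rewrite inE eqxx.
- rewrite (_ : (fun _ => _) = fun w => \sum_(i <- s | i \in s) F i w); last first.
    by apply/funext => w; rewrite big_seq.
  by apply: bdm_sum => j js; apply: bF; rewrite inE js orbT.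
by rewrite ih// => j js; apply: bF; rewrite inE js orbT.
Qed.

Lemma Ex_le f g : bdm f -> bdm g -> (forall w, f w <= g w) ->
  \int[P]_w f w <= \int[P]_w g w.
Proof. by move=> bf bg fg; apply: le_Rintegral => //; exact: bdm_int. Qed.

Lemma Ex_ge0 f : (forall w, 0 <= f w) -> 0 <= \int[P]_w f w.
Proof. by move=> f0; apply: Rintegral_ge0. Qed.

Lemma Ex_le_cst f c : bdm f -> (forall w, f w <= c) -> \int[P]_w f w <= c.
Proof. by move=> bf fc; rewrite -[leRHS]Ex_cst; apply: Ex_le => //; exact: bdm_cst. Qed.

Lemma Ex_norm f : bdm f -> `|\int[P]_w f w| <= \int[P]_w `|f w|.
Proof. by move=> bf; apply: le_normr_Rintegral => //; exact: bdm_int. Qed.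

Lemma Ex_dist f g : bdm f -> bdm g ->
  `|\int[P]_w f w - \int[P]_w g w| <= \int[P]_w `|f w - g w|.
Proof. by move=> bf bg; rewrite -ExB// Ex_norm//; exact: bdmB. Qed.

Lemma Ex_dist_le f g h : bdm f -> bdm g -> bdm h ->
  (forall w, `|f w - g w| <= h w) -> `|\int[P]_w f w - \int[P]_w g w| <= \int[P]_w h w.
Proof.
move=> bf bg bh fgh; rewrite (le_trans (Ex_dist bf bg))//.
by apply: Ex_le => //; apply/bdm_norm/bdmB.
Qed.

(** Nonnegativity of the variance of [|f|]. *)
Lemma Ex_sqr f : bdm f -> (\int[P]_w `|f w|) ^+ 2 <= \int[P]_w (f w ^+ 2).
Proof.
move=> bf; have bn := bdm_norm bf; have bX := bdmX 2 bf.
set a := \int[P]_w `|f w|.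
have : 0 <= \int[P]_w (`|f w| - a) ^+ 2 by apply: Ex_ge0 => w; rewrite sqr_ge0.
under eq_Rintegral => w _.
  rewrite (_ : _ ^+ 2 = f w ^+ 2 + (a ^+ 2 - (2 * a) * `|f w|)); last first.
    by rewrite -[f w ^+ 2]real_normK ?num_real//; ring.
  over.
rewrite ExD//; last by apply: bdmB; [exact: bdm_cst|apply: bdmM => //; exact: bdm_cst].
rewrite ExB ?Ex_cst ?ExZ//; [|exact: bdm_cst|by apply: bdmM => //; exact: bdm_cst].
rewrite -/a => h; nra.
Qed.

Lemma Ex_if (b : T -> bool) : measurable [set w | b w] ->
  \int[P]_w (if b w then 1 else 0) = fine (P [set w | b w]).
Proof.
move=> mb; congr fine.
rewrite (_ : (fun _ => _) = (fun w => (\1_[set w | b w] w : R)%:E)).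
  by rewrite integral_indic// setIT.
apply/funext => w; rewrite indicE; case: ifPn => bw; first by rewrite mem_set.
by rewrite memNset//= (negbTE bw).
Qed.

End expectation_bounded.

(** * Taylor and Lipschitz bounds for trigonometric and exponential functions *)

Section elementary_inequalities.
Context {R : realType}.
Implicit Types x y : R.

(** The order of [x] and [y] is left free and only the distance of [c] to [y] is kept. With [y = 0],
    a bound on the derivative at [c] becomes a bound in [|x|], and iterating gives the Taylor
    remainders below. *)
Lemma MVT_from (f f' : R -> R) (x y : R) :
  (forall z : R, is_derive z (1 : R) f (f' z)) ->
  exists2 c, `|c - y| <= `|x - y| & f x - f y = f' c * (x - y).
Proof.
move=> df.
have cf (a b : R) : {within `[a, b], continuous f}.
  by apply: derivable_within_continuous => z _; case: (df z).
have [xy|yx] := leP x y.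
  have [c] := MVT_segment xy (fun z _ => df z) (cf _ _).
  rewrite in_itv/= => /andP[xc cy] e; exists c.
    by rewrite !ler0_norm ?subr_le0// lerN2 lerB.
  by rewrite -[LHS]opprB e -mulrN opprB.
have [c] := MVT_segment (ltW yx) (fun z _ => df z) (cf _ _).
rewrite in_itv/= => /andP[xc cy] e; exists c => //.
by rewrite !ger0_norm ?subr_ge0 ?lerB// (le_trans xc).
Qed.

Lemma lipschitz_cos x y : `|cos x - cos y| <= `|x - y|.
Proof.
have [c _ ->] := MVT_from x y (@is_derive_cos R).
rewrite normrM ler_piMl// normrN ler_norml sin_geN1 sin_le1//.
Qed.

Lemma lipschitz_sin x y : `|sin x - sin y| <= `|x - y|.
Proof.
have [c _ ->] := MVT_from x y (@is_derive_sin R).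
by rewrite normrM ler_piMl// ler_norml cos_geN1 cos_le1.
Qed.

Lemma sin_sub_le x : `|sin x - x| <= `|x| ^+ 2.
Proof.
have df (z : R) : is_derive z 1 (fun u => sin u - u) (cos z - 1).
  by apply: is_deriveB.
have [c] := MVT_from x 0 df.
rewrite sin0 !subr0 => cx ->; rewrite normrM expr2 ler_wpM2r//.
by rewrite (le_trans _ cx)// -cos0 (le_trans (lipschitz_cos _ _))// subr0.
Qed.

Lemma sin_sub_le3 x : `|sin x - x| <= `|x| ^+ 3.
Proof.
have df (z : R) : is_derive z 1 (fun u => sin u - u) (cos z - 1).
  by apply: is_deriveB.
have [c] := MVT_from x 0 df.
rewrite sin0 !subr0 => cx ->; rewrite normrM exprSr ler_wpM2r//.
have [e] := MVT_from c 0 (@is_derive_cos R).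
rewrite cos0 !subr0 => ec ->; rewrite normrM normrN expr2 ler_pM//.
rewrite (le_trans _ cx)// (le_trans _ ec)//.
by have := lipschitz_sin e 0; rewrite sin0 !subr0.
Qed.

Lemma cos_sub_le3 x : `|cos x - (1 - x ^+ 2 / 2)| <= `|x| ^+ 3.
Proof.
have df (z : R) : is_derive z 1 (fun u => cos u - (1 - u ^+ 2 / 2)) (- sin z + z).
  have -> : (fun u : R => cos u - (1 - u ^+ 2 / 2)) = cos - (cst 1 - 2^-1 *: (@id R) ^+ 2).
    by apply/funext => u; rewrite !fctE mulrC.
  apply: is_derive_eq.
  rewrite sub0r opprK expr1 /GRing.scale/= mulr1; congr (_ + _).
  by rewrite mulrA mulVf ?mul1r.
have [c] := MVT_from x 0 df.
rewrite cos0 expr0n/= mul0r !subr0 subrr subr0 => cx ->.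
rewrite normrM exprSr ler_wpM2r// addrC distrC (le_trans (sin_sub_le _))//.
by rewrite lerXn2r// nnegrE.
Qed.

(** From [1 + x <= expR x] comes [expR (- x) <= (1 + x)^-1 <= 1 - x + x ^+ 2]. *)
Lemma expRN_sub_le x : 0 <= x -> `|expR (- x) - (1 - x)| <= x ^+ 2.
Proof.
move=> x0; rewrite ger0_norm; last by rewrite subr_ge0 -(opprK x) opprK expR_ge1Dx.
have x1 : 0 < 1 + x by rewrite ltr_pwDl.
rewrite lerBlDr expRN (le_trans (y := (1 + x)^-1))//.
  by rewrite lef_pV2 ?posrE ?expR_gt0 ?expR_ge1Dx.
rewrite -(ler_pM2r x1) mulVf ?gt_eqF//; nra.
Qed.

Lemma expRN_lipschitz x y : 0 <= x -> 0 <= y -> `|expR (- x) - expR (- y)| <= `|x - y|.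
Proof.
wlog xy : x y / x <= y => [h x0 y0|x0 y0].
  by have [xy|/ltW yx] := leP x y; [|rewrite distrC [leRHS]distrC]; exact: h.
rewrite ger0_norm ?subr_ge0 ?ler_expR ?lerN2// distrC ger0_norm ?subr_ge0//.
have -> : - y = - x - (y - x) by ring.
rewrite expRD -[X in X - _]mulr1 -mulrBr (le_trans (y := 1 * (1 - expR (- (y - x)))))//.
  rewrite ler_wpM2r ?subr_ge0//.
    by rewrite -expR0 ler_expR oppr_le0 subr_ge0.
  by rewrite -expR0 ler_expR oppr_le0.
by rewrite mul1r lerBlDr -lerBlDl expR_ge1Dx.
Qed.

End elementary_inequalities.

(** * A central limit theorem under approximation by mixing windows *)

Section sums.
Context {R : realType} {d : measure_display} {T : measurableType d}.
Variable P : probability T R.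
Variables (Y : nat -> T -> R) (gam : nat -> R) (K : R).
Hypothesis bY : forall t, bdm (Y t).
Hypothesis cov : forall t j, \int[P]_w (Y t w * Y (t + j)%N w) = gam j.
Hypothesis gamK : forall n, \sum_(j < n) `|gam j| <= K.

(** With truncated subtraction, [(s - t) + (t - s)] is the distance of [s] and [t]. *)
Lemma cov_dist s t : \int[P]_w (Y s w * Y t w) = gam ((s - t) + (t - s))%N.
Proof.
have [st|/ltnW ts] := leqP s t.
  by rewrite (eqP st) add0n -(cov s) subnKC.
rewrite (eqP ts) addn0 -(cov t) subnKC//.
by apply: eq_Rintegral => w _; rewrite mulrC.
Qed.

(** Each lag occurs at most twice, once on either side of [s]. *)
Lemma row_cov_le s N : \sum_(t < N) `|gam ((s - t) + (t - s))%N| <= 2 * K.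
Proof.
have h1 : forall n, (n <= s)%N -> \sum_(t < n) `|gam (s - t)%N| <= \sum_(j < s.+1) `|gam j|.
  move=> n ns; rewrite -(big_mkord xpredT (fun j => `|gam j|)).
  rewrite big_nat_rev/= add0n big_mkord.
  rewrite (big_ord_widen s.+1 (fun t => `|gam (s - t)%N|)) ?leqW// big_mkcond/=.
  apply: ler_sum => i _; rewrite subSS; case: ifP => // _.
have h2 : \sum_(t < N) `|gam ((s - t) + (t - s))%N| <=
    \sum_(j < s.+1) `|gam j| + \sum_(j < N) `|gam j|.
  have [Ns|/ltnW sN] := leqP N s.
    apply: ler_wpDr; first by apply: sumr_ge0.
    apply: le_trans (h1 _ Ns); apply: ler_sum => i _.
    by rewrite (_ : (i - s)%N = 0%N) ?addn0//; apply/eqP; rewrite subn_eq0 (leq_trans _ Ns)// ltnW.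
  rewrite -(big_mkord xpredT (fun t => `|gam ((s - t) + (t - s))%N|)).
  rewrite (big_cat_nat (n := s))//=; apply: lerD.
    rewrite big_mkord; apply: le_trans (h1 _ (leqnn _)); apply: ler_sum => i _.
    by rewrite (_ : (i - s)%N = 0%N) ?addn0//; apply/eqP; rewrite subn_eq0 ltnW.
  rewrite -{1}[s]add0n big_addn big_mkord.
  rewrite (big_ord_widen N (fun t => `|gam ((s - (t + s)) + (t + s - s))%N|)) ?leq_subr// big_mkcond/=.
  apply: ler_sum => i _; case: ifP => // _.
  by rewrite addnK (_ : (s - (i + s))%N = 0%N)//; lia.
by rewrite (le_trans h2)// [leRHS]mulr_natl mulr2n lerD.
Qed.

(** The index set is arbitrary because the bound is also applied to the indices left out of the
    blocks, which do not form an interval. *)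
Lemma second_moment_subset N (Q : pred nat) :
  \int[P]_w (\sum_(t < N | Q t) Y t w) ^+ 2 <= (2 * K) * \sum_(t < N | Q t) 1.
Proof.
under eq_Rintegral => w _.
  rewrite expr2 big_distrl/=; under eq_bigr => i Qi do rewrite big_distrr/=; over.
rewrite (_ : \int[P]_w _ = \sum_(s < N | Q s) \sum_(t < N | Q t) gam ((s - t) + (t - s))%N).
  rewrite mulr_sumr; apply: ler_sum => s Qs; rewrite mulr1.
  apply: le_trans (row_cov_le s N); rewrite big_mkcond/=; apply: ler_sum => t _.
  by case: ifP => // _; exact: ler_norm.
have -> : \int[P]_w (\sum_(i < N | Q i) \sum_(t < N | Q t) Y i w * Y t w) =
  \int[P]_w (\sum_(i <- [seq i : 'I_N <- index_enum 'I_N | Q i])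
    \sum_(t <- [seq i : 'I_N <- index_enum 'I_N | Q i]) Y i w * Y t w).
  apply: eq_Rintegral => w _; rewrite big_filter; apply: eq_bigr => i _.
  by rewrite big_filter.
rewrite Ex_sum; last by move=> i _; apply: bdm_sum => j _; exact: bdmM.
rewrite big_filter; apply: eq_bigr => s _.
rewrite Ex_sum; last by move=> j _; exact: bdmM.
by rewrite big_filter; apply: eq_bigr => t _; rewrite cov_dist.
Qed.

(** Growth of the second moment when a block of length [q] receives one more index. Block variances
    are therefore sums of these terms, and block variances over length are their Cesaro means. *)
Definition lrv_part (q : nat) : R := gam 0 + 2 * \sum_(j < q) gam j.+1.

Lemma second_moment_block a p :
  \int[P]_w (\sum_(t < p) Y (a + t)%N w) ^+ 2 = \sum_(q < p) lrv_part q.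
Proof.
have bS q : bdm (fun w => \sum_(t < q) Y (a + t)%N w) by apply: bdm_sum.
elim: p => [|p ih].
  by under eq_Rintegral do rewrite big_ord0 expr0n/=; rewrite Ex_cst big_ord0.
under eq_Rintegral => w _.
  rewrite big_ord_recr/= sqrrD -mulr_natl -addrA; over.
have bSY := bdmM (bS p) (bY (a + p)%N); have b2SY := bdmM (bdm_cst 2) bSY.
have bYX := bdmX 2 (bY (a + p)%N).
rewrite big_ord_recr/= -ih ExD; [congr (_ + _)|exact: bdmX (bS p)|exact: bdmD].
rewrite ExD//.
rewrite /lrv_part addrC; congr (_ + _).
  by rewrite -(cov (a + p)%N) addn0; apply: eq_Rintegral => w _; rewrite expr2.
rewrite ExZ//; congr (_ * _).
under eq_Rintegral do rewrite mulr_suml.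
rewrite Ex_sum; last by move=> *; exact: bdmM.
(* The lag [p - i] runs backwards in [i], hence the reversal of the sum. *)
rewrite [RHS](reindex_inj rev_ord_inj)/=; apply: eq_bigr => i _.
rewrite -(cov (a + i)%N); apply: eq_Rintegral => w _.
by congr (_ * Y _ w); have := ltn_ord i; lia.
Qed.

End sums.

Section blocks.
Context {V : nmodType}.
Implicit Types F : nat -> V.

Lemma sum_blocks F p m r : (p <= m)%N -> (0 < m)%N ->
  \sum_(i < r) \sum_(j < p) F (i * m + j)%N =
  \sum_(t < r * m | (t %% m < p)%N) F t.
Proof.
move=> pm m0; elim: r => [|r ih]; first by rewrite mul0n !big_ord0.
rewrite big_ord_recr/= ih -(big_mkord (fun t => t %% m < p)%N F).
rewrite -(big_mkord (fun t => t %% m < p)%N F).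
rewrite [RHS](big_cat_nat (n := (r * m)%N))//=; last by rewrite leq_mul2r leqnSn orbT.
congr (_ + _); rewrite -{2}[(r * m)%N]add0n big_addn mulSn addnK big_mkord.
rewrite (big_ord_widen m (fun j => F (r * m + j)%N))//=; apply: eq_big => [i|i _].
  by rewrite addnC modnMDl modn_small.
by rewrite addnC.
Qed.

(** The leftover indices are the gaps within the [r] periods and the tail from [r * m] on. *)
Lemma sum_blocks_leftover F p m r N : (p <= m)%N -> (0 < m)%N -> (r * m <= N)%N ->
  \sum_(t < N) F t = \sum_(i < r) \sum_(j < p) F (i * m + j)%N +
   \sum_(t < N | ~~ ((t < r * m) && (t %% m < p))%N) F t.
Proof.
move=> pm m0 rN; rewrite sum_blocks// [LHS](bigID (fun t : 'I_N => (t < r * m) && (t %% m < p))%N)/=.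
congr (_ + _); rewrite (big_ord_widen_cond N (fun t => t %% m < p)%N F)//.
by apply: eq_bigl => t; rewrite andbC.
Qed.

End blocks.

Section lipschitz_expectation.
Context {R : realType} {d : measure_display} {T : measurableType d}.
Variable P : probability T R.

Lemma Ex_lipschitz (g : R -> R) (th : R) (f h : T -> R) (E : R) : 0 <= th ->
  (forall x y, `|g x - g y| <= `|x - y|) ->
  (forall f : T -> R, measurable_fun setT f -> bdm (fun w => g (f w))) ->
  bdm f -> bdm h -> \int[P]_w `|f w - h w| <= E ->
  `|\int[P]_w g (th * f w) - \int[P]_w g (th * h w)| <= th * E.
Proof.
move=> th0 gl bg bf bh fhE.
have bfh : bdm (fun w => `|f w - h w|) by apply/bdm_norm/bdmB.
have bdZ (k : T -> R) : bdm k -> bdm (fun w => th * k w).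
  by move=> bk; apply: bdmM => //; exact: bdm_cst.
apply: (le_trans (y := \int[P]_w (th * `|f w - h w|))).
  apply: Ex_dist_le => [|||w]; [exact/bg/(bdZ f bf).1|exact/bg/(bdZ h bh).1|exact: bdZ|].
  by rewrite (le_trans (gl _ _))// -mulrBr normrM ger0_norm.
by rewrite ExZ// ler_wpM2l.
Qed.

End lipschitz_expectation.

Section core.
Context {R : realType} {d : measure_display} {T : measurableType d}.
Variable P : probability T R.
Variables (Y : nat -> T -> R) (gam : nat -> R) (C : R).
Hypothesis C0 : 0 <= C.
Hypothesis bY : forall t, bdm (Y t).
Hypothesis YC : forall t w, `|Y t w| <= C.
Hypothesis EY : forall t, \int[P]_w Y t w = 0.
Hypothesis cov : forall t j : nat, \int[P]_w (Y t w * Y (t + j)%N w) = gam j.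

Variables (y : nat -> nat -> T -> R) (al be : nat -> R).
Hypothesis by_ : forall l t, bdm (y l t).
Hypothesis yC : forall l t w, `|y l t w| <= C.
Hypothesis Yy : forall l t, \int[P]_w `|Y t w - y l t w| <= al l.
Hypothesis be0 : forall k, 0 <= be k.

(* [W a b] stands for the functions of the coordinates Z_a, ..., Z_b of the mixing process. *)
Variable W : int -> int -> set (T -> R).
Hypothesis W0 : forall a b, W a b (fun=> 0).
Hypothesis WD : forall a b f g, W a b f -> W a b g -> W a b (fun w => f w + g w).
Hypothesis Wcos : forall a b c f, W a b f -> W a b (fun w => cos (c * f w)).
Hypothesis Wsin : forall a b c f, W a b f -> W a b (fun w => sin (c * f w)).
Hypothesis Wmono : forall (a b a' b' : int) (f : T -> R), a' <= a -> b <= b' -> W a b f -> W a' b' f.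
Hypothesis Wy : forall (l t : nat), W (t%:Z - l%:Z) (t%:Z + l%:Z) (y l t).
Hypothesis Wmix : forall (a b c e : int) (k : nat) (f g : T -> R) (A B : R), W a b f -> W c e g ->
  b + k%:Z <= c -> (forall w, `|f w| <= A) -> (forall w, `|g w| <= B) ->
  `|\int[P]_w (f w * g w) - (\int[P]_w f w) * (\int[P]_w g w)| <= A * B * be k.

Lemma al_ge0 l : 0 <= al l.
Proof. by apply: le_trans (Yy l 0); apply: Ex_ge0 => w. Qed.

(** Windows of radius [l = j / 3] around [0] and [j] are at distance at least [l], so mixing at lag
    [l] applies to the approximants. Replacing both factors costs [2 * C * al l]; the product of the
    means costs another [C * al l], because [Y] is centred. *)
Lemma gam_le j : `|gam j| <= 3 * C * al (j %/ 3)%N + C * C * be (j %/ 3)%N.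
Proof.
set l := (j %/ 3)%N; have lj : (3 * l <= j)%N by rewrite mulnC leq_trunc_div.
rewrite -(cov 0 j) add0n.
have bd l' t : bdm (fun w => `|Y t w - y l' t w|) by apply/bdm_norm/bdmB.
have h1 : `|\int[P]_w (Y 0%N w * Y j w) - \int[P]_w (y l 0%N w * y l j w)| <= 2 * C * al l.
  apply: (le_trans (y := \int[P]_w (C * `|Y 0%N w - y l 0%N w| + C * `|Y j w - y l j w|))).
    apply: Ex_dist_le; [exact: bdmM|exact: bdmM| |] => [|w].
      by apply: bdmD; apply: bdmM => //; exact: bdm_cst.
    have -> : Y 0%N w * Y j w - y l 0%N w * y l j w =
      (Y 0%N w - y l 0%N w) * Y j w + y l 0%N w * (Y j w - y l j w) by ring.
    rewrite (le_trans (ler_normD _ _))// !normrM mulrC.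
    by apply: lerD; apply: ler_wpM2r.
  rewrite ExD; [|by apply: bdmM => //; exact: bdm_cst..].
  rewrite !ExZ//; by rewrite -mulrDr [2 * C]mulrC -mulrA ler_wpM2l// mulr_natl mulr2n lerD.
have h2 : `|\int[P]_w y l 0%N w| <= al l.
  apply: le_trans (Yy l 0); rewrite -[X in `|X|]subr0 -(EY 0) distrC.
  exact: Ex_dist.
have h3 : `|\int[P]_w y l j w| <= C.
  by rewrite (le_trans (Ex_norm _ _))// Ex_le_cst//; exact: bdm_norm.
have h4 : `|\int[P]_w (y l 0%N w * y l j w) - (\int[P]_w y l 0%N w) * (\int[P]_w y l j w)| <= C * C * be l.
  apply: (Wmix (Wy l 0) (Wy l j)) => //; lia.
have h5 : `|(\int[P]_w y l 0%N w) * (\int[P]_w y l j w)| <= C * al l.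
  by rewrite normrM mulrC ler_pM.
move: h1 h4 h5; rewrite !ler_norml => /andP[? ?] /andP[? ?] /andP[? ?].
apply/andP; split; lra.
Qed.

Section block_estimate.
Variables (th : R) (p l r : nat).
Hypothesis th0 : 0 <= th.
Let m := (p + 3 * l)%N.
Hypothesis m0 : (0 < m)%N.
Let v := \sum_(q < p) lrv_part gam q.
Variables (rho e1 : R).
Hypothesis rho01 : 0 <= rho <= 1.
Hypothesis vrho : `|1 - th ^+ 2 * v / 2 - rho| <= e1.

Let U i w := \sum_(j < p) Y (i * m + j)%N w.
Let u i w := \sum_(j < p) y l (i * m + j)%N w.
Let B i w := \sum_(k < i) U k w.
Let b i w := \sum_(k < i) u k w.

Let bU i : bdm (U i). Proof. exact: bdm_sum. Qed.
Let bu i : bdm (u i). Proof. exact: bdm_sum. Qed.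
Let bB i : bdm (B i). Proof. exact: bdm_sum. Qed.
Let bb i : bdm (b i). Proof. exact: bdm_sum. Qed.

Let bdZ (f : T -> R) : bdm f -> bdm (fun w => th * f w).
Proof. by move=> bf; apply: bdmM => //; exact: bdm_cst. Qed.

Let bcos (f : T -> R) : bdm f -> bdm (fun w => cos (th * f w)).
Proof. by move=> bf; apply: bdm_cos; case: (bdZ bf). Qed.

Let bsin (f : T -> R) : bdm f -> bdm (fun w => sin (th * f w)).
Proof. by move=> bf; apply: bdm_sin; case: (bdZ bf). Qed.

(** Error of [rho] as the cosine expectation of a block of [y]: exchange with [Y], Taylor remainder,
    and the error [e1] of the second-order term. *)
Let e := th * (p%:R * al l) + th ^+ 3 * (p%:R * C) * v + e1.

Let Uu i : \int[P]_w `|U i w - u i w| <= p%:R * al l.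
Proof.
apply: (le_trans (y := \int[P]_w (\sum_(j < p) `|Y (i * m + j)%N w - y l (i * m + j)%N w|))).
  apply: Ex_le => [||w]; first exact/bdm_norm/bdmB.
    by apply: bdm_sum => j _; exact/bdm_norm/bdmB.
  by rewrite /U /u -sumrB ler_norm_sum.
rewrite Ex_sum; last by move=> j _; exact/bdm_norm/bdmB.
by rewrite mulr_natl -[X in _ *+ X]card_ord -sumr_const; apply: ler_sum.
Qed.

Let Bb i : \int[P]_w `|B i w - b i w| <= i%:R * (p%:R * al l).
Proof.
apply: (le_trans (y := \int[P]_w (\sum_(j < i) `|U j w - u j w|))).
  apply: Ex_le => [||w]; first exact/bdm_norm/bdmB.
    by apply: bdm_sum => j _; exact/bdm_norm/bdmB.
  by rewrite /B /b -sumrB ler_norm_sum.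
rewrite Ex_sum; last by move=> j _; exact/bdm_norm/bdmB.
by rewrite mulr_natl -[X in _ *+ X]card_ord -sumr_const; apply: ler_sum.
Qed.

Let U3 i : \int[P]_w `|th * U i w| ^+ 3 <= th ^+ 3 * (p%:R * C) * v.
Proof.
rewrite /v -(second_moment_block bY cov (i * m)).
rewrite -ExZ; last exact: bdmX (bU i).
apply: Ex_le => [||w]; first exact/bdmX/bdm_norm/bdZ.
  by apply: bdmM; [exact: bdm_cst|exact: bdmX (bU i)].
rewrite normrM ger0_norm// exprMn -mulrA; apply: ler_wpM2l; first exact: exprn_ge0.
rewrite exprS real_normK ?num_real//; apply: ler_wpM2r; first by rewrite sqr_ge0.
rewrite (le_trans (ler_norm_sum _ _ _))// mulr_natl -[X in _ *+ X]card_ord -sumr_const.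
by apply: ler_sum.
Qed.

Let ucos i : `|\int[P]_w cos (th * u i w) - rho| <= e.
Proof.
have h1 : `|\int[P]_w cos (th * u i w) - \int[P]_w cos (th * U i w)| <= th * (p%:R * al l).
  by rewrite distrC; apply: Ex_lipschitz => //; [exact: lipschitz_cos|exact: bdm_cos].
have h2 : `|\int[P]_w cos (th * U i w) - (1 - th ^+ 2 * v / 2)| <= th ^+ 3 * (p%:R * C) * v.
  apply: le_trans (U3 i).
  have -> : 1 - th ^+ 2 * v / 2 = \int[P]_w (1 - (th * U i w) ^+ 2 / 2).
    under [RHS]eq_Rintegral => w _ do rewrite exprMn mulrAC.
    rewrite ExB ?Ex_cst ?ExZ; [|exact: bdmX (bU i)|exact: bdm_cst|].
      by rewrite (second_moment_block bY cov) -/v mulrAC.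
    by apply: bdmM; [exact: bdm_cst|exact: bdmX (bU i)].
  apply: Ex_dist_le => [|||w]; [exact: bcos| |exact/bdmX/bdm_norm/bdZ|exact: cos_sub_le3].
  by apply: bdmB; [exact: bdm_cst|apply: bdmM; [exact/bdmX/bdZ|exact: bdm_cst]].
rewrite (le_trans (ler_distD (\int[P]_w cos (th * U i w)) _ _))// /e -addrA lerD//.
by rewrite (le_trans (ler_distD (1 - th ^+ 2 * v / 2) _ _))// lerD.
Qed.

(** The linear term has mean zero since [Y] is centred, so the remainder is again of third order. *)
Let usin i : `|\int[P]_w sin (th * u i w)| <= e.
Proof.
have h1 : `|\int[P]_w sin (th * u i w) - \int[P]_w sin (th * U i w)| <= th * (p%:R * al l).
  by rewrite distrC; apply: Ex_lipschitz => //; [exact: lipschitz_sin|exact: bdm_sin].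
have h2 : `|\int[P]_w sin (th * U i w) - 0| <= th ^+ 3 * (p%:R * C) * v.
  apply: le_trans (U3 i).
  have -> : 0 = \int[P]_w (th * U i w).
    rewrite ExZ// /U Ex_sum// big1 ?mulr0// => j _; exact: EY.
  apply: Ex_dist_le => [|||w]; [exact: bsin|exact: bdZ|exact/bdmX/bdm_norm/bdZ|exact: sin_sub_le3].
have e10 : 0 <= e1 by rewrite (le_trans _ vrho).
rewrite -[X in `|X|]subr0 (le_trans (ler_distD (\int[P]_w sin (th * U i w)) _ _))// /e.
by rewrite -addrA lerD// ler_wpDr.
Qed.

Let Wsum a c k (F : nat -> T -> R) : (forall i, (i < k)%N -> W a c (F i)) ->
  W a c (fun w => \sum_(i < k) F i w).
Proof.
elim: k => [|k ih] WF.
  by rewrite (_ : (fun _ => _) = fun=> 0)//; apply/funext => w; rewrite big_ord0.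
rewrite (_ : (fun _ => _) = fun w => \sum_(i < k) F i w + F k w); last first.
  by apply/funext => w; rewrite big_ord_recr.
by apply: WD; [apply: ih => i ik; apply: WF; rewrite ltnW|exact: WF].
Qed.

(** The last of the first [i] blocks ends before [i * m - 3 * l], and windows of radius [l] reach
    [l] further. For [i = 0] the sum is empty. *)
Let Wb i : W (- l%:Z) ((i * m)%:Z - 3 * l%:Z + l%:Z) (b i).
Proof.
apply: (@Wsum _ _ i u) => k ki; apply: (@Wsum _ _ p (fun j => y l (k * m + j)%N)) => j jp; apply: Wmono (Wy _ _); first lia.
have : (k * m + m <= i * m)%N by rewrite -mulSnr leq_mul2r ki orbT.
rewrite /m; lia.
Qed.

Let Wu i : W ((i * m)%:Z - l%:Z) ((i * m)%:Z + p%:Z + l%:Z) (u i).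
Proof.
apply: (@Wsum _ _ p (fun j => y l (i * m + j)%N)) => j jp; apply: Wmono (Wy _ _); lia.
Qed.

(** The first window ends at [i * m - 2 * l] and the second begins at [i * m - l]: the gap [3 * l]
    loses [l] on either side and leaves [l] for mixing. *)
Let mix (f g : R -> R) i :
  W (- l%:Z) ((i * m)%:Z - 3 * l%:Z + l%:Z) (fun w => f (b i w)) ->
  W ((i * m)%:Z - l%:Z) ((i * m)%:Z + p%:Z + l%:Z) (fun w => g (u i w)) ->
  (forall x, `|f x| <= 1) -> (forall x, `|g x| <= 1) ->
  `|\int[P]_w (f (b i w) * g (u i w)) - (\int[P]_w f (b i w)) * (\int[P]_w g (u i w))| <= be l.
Proof.
move=> Wf Wg f1 g1; rewrite -[be l]mul1r -[1 in leRHS]mulr1.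
by apply: (Wmix Wf Wg) => //; lia.
Qed.

Let cos1 x : `|cos (th * x)| <= 1. Proof. by rewrite ler_norml cos_geN1 cos_le1. Qed.
Let sin1 x : `|sin (th * x)| <= 1. Proof. by rewrite ler_norml sin_geN1 sin_le1. Qed.

Let c i := \int[P]_w cos (th * b i w).
Let s i := \int[P]_w sin (th * b i w).

Let c1 i : `|c i| <= 1.
Proof.
rewrite (le_trans (Ex_norm _ (bcos (bb i))))//.
by apply: Ex_le_cst => [|w]; [exact/bdm_norm/bcos|exact: cos1].
Qed.

Let s1 i : `|s i| <= 1.
Proof.
rewrite (le_trans (Ex_norm _ (bsin (bb i))))//.
by apply: Ex_le_cst => [|w]; [exact/bdm_norm/bsin|exact: sin1].
Qed.

(** Addition theorem for the angle of [b i + u i]: mixing factorizes both products, then the cosine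
    factor of [u i] is [rho] and its sine factor 0, each up to [e]. *)
Let cS i : `|c i.+1 - rho * c i| <= 2 * (be l + e).
Proof.
have -> : c i.+1 = \int[P]_w (cos (th * b i w) * cos (th * u i w)) -
    \int[P]_w (sin (th * b i w) * sin (th * u i w)).
  rewrite -ExB; [|by apply: bdmM; [exact: bcos|exact: bcos]|by apply: bdmM; [exact: bsin|exact: bsin]].
  by apply: eq_Rintegral => w _; rewrite /b big_ord_recr/= mulrDr cosD.
have h1 := @mix (fun x => cos (th * x)) (fun x => cos (th * x)) i (Wcos _ (Wb i)) (Wcos _ (Wu i)) cos1 cos1.
have h2 := @mix (fun x => sin (th * x)) (fun x => sin (th * x)) i (Wsin _ (Wb i)) (Wsin _ (Wu i)) sin1 sin1.
have h3 := ucos i; have h4 := usin i; have hc := c1 i; have hs := s1 i.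
move: h1 h2 h3 h4; rewrite -/(c i) -/(s i); set a1 := \int[P]_w _; set a2 := \int[P]_w _.
set a3 := \int[P]_w _; set a4 := \int[P]_w _ => h1 h2 h3 h4.
have -> : a1 - a3 - rho * c i = (a1 - c i * a2) - (a3 - s i * a4) + (c i * (a2 - rho) - s i * a4) by ring.
rewrite mulr_natl mulr2n [leRHS]addrACA (le_trans (ler_normD _ _))// lerD//.
  by rewrite (le_trans (ler_normB _ _))// lerD.
rewrite (le_trans (ler_normB _ _))// lerD// normrM.
  by rewrite (le_trans (ler_wpM2r _ hc))// mul1r.
by rewrite (le_trans (ler_wpM2r _ hs))// mul1r.
Qed.

Let sS i : `|s i.+1 - rho * s i| <= 2 * (be l + e).
Proof.
have -> : s i.+1 = \int[P]_w (sin (th * b i w) * cos (th * u i w)) +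
    \int[P]_w (cos (th * b i w) * sin (th * u i w)).
  rewrite -ExD; [|by apply: bdmM; [exact: bsin|exact: bcos]|by apply: bdmM; [exact: bcos|exact: bsin]].
  by apply: eq_Rintegral => w _; rewrite /b big_ord_recr/= mulrDr sinD.
have h1 := @mix (fun x => sin (th * x)) (fun x => cos (th * x)) i (Wsin _ (Wb i)) (Wcos _ (Wu i)) sin1 cos1.
have h2 := @mix (fun x => cos (th * x)) (fun x => sin (th * x)) i (Wcos _ (Wb i)) (Wsin _ (Wu i)) cos1 sin1.
have h3 := ucos i; have h4 := usin i; have hc := c1 i; have hs := s1 i.
move: h1 h2 h3 h4; rewrite -/(c i) -/(s i); set a1 := \int[P]_w _; set a2 := \int[P]_w _.
set a3 := \int[P]_w _; set a4 := \int[P]_w _ => h1 h2 h3 h4.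
have -> : a1 + a3 - rho * s i = (a1 - s i * a2) + (a3 - c i * a4) + (s i * (a2 - rho) + c i * a4) by ring.
rewrite mulr_natl mulr2n [leRHS]addrACA (le_trans (ler_normD _ _))// lerD//.
  by rewrite (le_trans (ler_normD _ _))// lerD.
rewrite (le_trans (ler_normD _ _))// lerD// normrM.
  by rewrite (le_trans (ler_wpM2r _ hs))// mul1r.
by rewrite (le_trans (ler_wpM2r _ hc))// mul1r.
Qed.

(** As [0 <= rho <= 1], earlier errors are not amplified and add up linearly. *)
Let recur (x : nat -> R) (D : R) : (forall i, `|x i.+1 - rho * x i| <= D) ->
  forall i, `|x i - rho ^+ i * x 0%N| <= i%:R * D.
Proof.
move=> xS; elim=> [|i ih]; first by rewrite expr0 !mul1r subrr normr0 mul0r.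
have /andP[r0 r1] := rho01.
rewrite exprS (_ : _ - _ = (x i.+1 - rho * x i) + rho * (x i - rho ^+ i * x 0%N)); last by ring.
rewrite -natr1 mulrDl mul1r addrC (le_trans (ler_normD _ _))// lerD//.
by rewrite normrM ger0_norm// (le_trans (ler_wpM2r _ r1))// mul1r.
Qed.

Lemma cos_block_sums : `|\int[P]_w cos (th * B r w) - rho ^+ r| <=
  r%:R * (th * (p%:R * al l) + 2 * (be l + e)).
Proof.
have := recur cS r; have -> : c 0 = 1.
  rewrite -[RHS](Ex_cst P); apply: eq_Rintegral => w _.
  by rewrite /b big_ord0 mulr0 cos0.
rewrite mulr1 => h; rewrite (le_trans (ler_distD (c r) _ _))// mulrDr lerD//.
by rewrite mulrCA; apply: Ex_lipschitz => //; [exact: lipschitz_cos|exact: bdm_cos].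
Qed.

Lemma sin_block_sums : `|\int[P]_w sin (th * B r w)| <=
  r%:R * (th * (p%:R * al l) + 2 * (be l + e)).
Proof.
have := recur sS r; have -> : s 0 = 0.
  rewrite -[RHS](Ex_cst P); apply: eq_Rintegral => w _.
  by rewrite /b big_ord0 mulr0 sin0.
rewrite mulr0 => h.
rewrite -[X in `|X|]subr0 (le_trans (ler_distD (s r) _ _))// mulrDr lerD//.
by rewrite mulrCA; apply: Ex_lipschitz => //; [exact: lipschitz_sin|exact: bdm_sin].
Qed.

End block_estimate.
End core.

Section core_limit.
Context {R : realType} {d : measure_display} {T : measurableType d}.
Variable P : probability T R.
Variables (Y : nat -> T -> R) (gam : nat -> R) (C : R).
Hypothesis C0 : 0 <= C.
Hypothesis bY : forall t, bdm (Y t).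
Hypothesis YC : forall t w, `|Y t w| <= C.
Hypothesis EY : forall t, \int[P]_w Y t w = 0.
Hypothesis cov : forall t j : nat, \int[P]_w (Y t w * Y (t + j)%N w) = gam j.

Variables (y : nat -> nat -> T -> R) (al be : nat -> R).
Hypothesis by_ : forall l t, bdm (y l t).
Hypothesis yC : forall l t w, `|y l t w| <= C.
Hypothesis Yy : forall l t, \int[P]_w `|Y t w - y l t w| <= al l.
Hypothesis be0 : forall k, 0 <= be k.

Variable W : int -> int -> set (T -> R).
Hypothesis W0 : forall a b, W a b (fun=> 0).
Hypothesis WD : forall a b f g, W a b f -> W a b g -> W a b (fun w => f w + g w).
Hypothesis Wcos : forall a b c f, W a b f -> W a b (fun w => cos (c * f w)).
Hypothesis Wsin : forall a b c f, W a b f -> W a b (fun w => sin (c * f w)).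
Hypothesis Wmono : forall (a b a' b' : int) (f : T -> R), a' <= a -> b <= b' -> W a b f -> W a' b' f.
Hypothesis Wy : forall (l t : nat), W (t%:Z - l%:Z) (t%:Z + l%:Z) (y l t).
Hypothesis Wmix : forall (a b c e : int) (k : nat) (f g : T -> R) (A B : R), W a b f -> W c e g ->
  b + k%:Z <= c -> (forall w, `|f w| <= A) -> (forall w, `|g w| <= B) ->
  `|\int[P]_w (f w * g w) - (\int[P]_w f w) * (\int[P]_w g w)| <= A * B * be k.

Hypothesis cvg_al : cvgn (series al).
Hypothesis cvg_be : cvgn (series be).
Hypothesis al2 : (fun l => l%:R ^+ 2 * al l) @ \oo --> (0 : R).
Hypothesis be2 : (fun l => l%:R ^+ 2 * be l) @ \oo --> (0 : R).

Let al0 := al_ge0 Yy.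
Let dom l := 3 * C * al l + C * C * be l.
Let dom0 l : 0 <= dom l.
Proof. by rewrite /dom addr_ge0// ?mulr_ge0. Qed.

Let gam_dom j : `|gam j| <= dom (j %/ 3)%N.
Proof. exact: (gam_le C0 bY YC EY cov by_ yC Yy Wy Wmix). Qed.

Let cvg_dom : cvgn (series dom).
Proof.
rewrite (_ : series dom = (fun n => 3 * C * series al n + C * C * series be n)).
  by apply: is_cvgD; apply: is_cvgM => //; exact: is_cvg_cst.
apply/funext => n; rewrite /series/= /dom.
by rewrite !mulr_sumr -big_split.
Qed.

(** The factor 3 arises because [j %/ 3] takes every value three times. *)
Definition absK := 3 * limn (series dom).

Lemma sum_norm_gam_le n : \sum_(j < n) `|gam j| <= absK.
Proof.
have h k : \sum_(j < 3 * k) `|gam j| <= 3 * series dom k.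
  elim: k => [|k ih]; first by rewrite muln0 big_ord0 /series/= big_geq// mulr0.
  rewrite mulnS addnC !addnS addn0 !big_ord_recr/= /series/= big_nat_recr//= mulrDr.
  have e i : (i < 3)%N -> `|gam (3 * k + i)%N| <= dom k.
    by move=> i3; rewrite -[k in dom k](_ : ((3 * k + i) %/ 3)%N = k)//; lia.
  have := e 0 isT; have := e 1 isT; have := e 2 isT.
  rewrite addn0 addn1 addn2; move: ih; rewrite /series/= => ih a1 a2 a3; lra.
apply: (le_trans (y := \sum_(j < 3 * n) `|gam j|)).
  rewrite (big_ord_widen (3 * n) (fun j => `|gam j|)) ?leq_pmull// big_mkcond/=.
  by apply: ler_sum => i _; case: ifP.
apply: le_trans (h n) _; rewrite /absK ler_wpM2l//.
apply: nondecreasing_cvgn_le => //.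
by apply: nondecreasing_series => k _ _; exact: dom0.
Qed.

Let absK0 : 0 <= absK.
Proof. by have := sum_norm_gam_le 0; rewrite big_ord0. Qed.

Lemma cov_abs_summable : cvgn (series (fun j => `|gam j.+1|)).
Proof.
apply: nondecreasing_is_cvgn; first exact: nondecreasing_series.
exists absK => _ [n _ <-]; rewrite /series/= big_mkord.
apply: le_trans (sum_norm_gam_le n.+1); rewrite big_ord_recl/=.
by rewrite ler_wpDl.
Qed.

(* The long-run variance. *)
Definition lrv := gam 0 + 2 * limn (series (fun j => gam j.+1)).

Let lrv_cvg : lrv_part gam @ \oo --> lrv.
Proof.
rewrite /lrv (_ : lrv_part gam = fun q => gam 0 + 2 * series (fun j => gam j.+1) q).
  apply: cvgD; first exact: cvg_cst.
  by apply: cvgMr; exact: (normed_cvg cov_abs_summable).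
by apply/funext => q; rewrite /lrv_part /series/= big_mkord.
Qed.

Let V p := \sum_(q < p) lrv_part gam q.

Let V_cvg : (fun p => V p / p%:R) @ \oo --> lrv.
Proof.
rewrite -(cvg_shiftS (fun p => V p / p%:R)).
rewrite (_ : (fun _ => _) = arithmetic_mean (lrv_part gam)); first exact: cesaro.
by apply/funext => n; rewrite /arithmetic_mean/= /series/= big_mkord mulrC.
Qed.

Let V_le p : 0 <= V p <= 2 * absK * p%:R.
Proof.
rewrite /V -(second_moment_block bY cov 0) Ex_ge0 => [|w]; last by rewrite sqr_ge0.
have := second_moment_subset bY cov sum_norm_gam_le p xpredT.
by rewrite sumr_const card_ord.
Qed.

(** Limit of second moments of block sums divided by the block length. *)
Lemma lrv_ge0 : 0 <= lrv.
Proof.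
rewrite -(cvg_lim _ V_cvg)//; apply: limr_ge; first by apply/cvg_ex; exists lrv.
apply: nearW => p.
by rewrite divr_ge0//; have /andP[] := V_le p.
Qed.

Definition clt_error (L : nat) : R :=
  let ll := L%:R in
  let A := (L ^ 3)%N%:R ^+ 2 * al (L ^ 3)%N in
  let B := (L ^ 3)%N%:R ^+ 2 * be (L ^ 3)%N in
  let D := `|V (L ^ 4)%N / (L ^ 4)%N%:R - lrv| in
  Num.sqrt (14 * absK * ll^-1) + (32 * A + 2 * (1024 * B + (32 * A + 2 * C * absK * ll^-1
    + (D / 2 + lrv ^+ 2 * ll^-1)))) + 7 * lrv * ll^-1.

(* Blocks of length p = L^4 separated by gaps of length 3 l = 3 L^3, with L the integer tenth root
   of n. *)
Section one_n.
Variables (n L : nat).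
Hypothesis L0 : (0 < L)%N.
Hypothesis Ln : (L ^ 10 <= n)%N.
Hypothesis nL : (n < L.+1 ^ 10)%N.
Let p := (L ^ 4)%N.
Let l := (L ^ 3)%N.
Let m := (p + 3 * l)%N.
Let r := (n %/ m)%N.
Let s : R := Num.sqrt n%:R.
Let ll : R := L%:R.
Let th := s^-1.

Let m0 : (0 < m)%N. Proof. by rewrite addn_gt0 expn_gt0 L0. Qed.
Let n0 : (0 < n)%N. Proof. by rewrite (leq_trans _ Ln)// expn_gt0 L0. Qed.
Let s2 : s ^+ 2 = n%:R. Proof. by rewrite sqr_sqrtr. Qed.
Let s0 : 0 < s. Proof. by rewrite sqrtr_gt0 ltr0n. Qed.
Let ll1 : 1 <= ll. Proof. by rewrite ler1n. Qed.
Let ll0 : 0 < ll. Proof. by rewrite ltr0n. Qed.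
Let lls : ll ^+ 5 <= s.
Proof.
rewrite -(@ler_pXn2r _ 2)// ?nnegrE ?exprn_ge0 ?(ltW s0) ?(ltW ll0)//.
by rewrite s2 -exprM /ll -natrX ler_nat.
Qed.
Let sll : s <= 32 * ll ^+ 5.
Proof.
rewrite -(@ler_pXn2r _ 2)// ?nnegrE ?mulr_ge0 ?exprn_ge0 ?(ltW s0) ?(ltW ll0)//.
rewrite s2 exprMn -exprM /ll -!natrX -natrM ler_nat (leq_trans (ltnW nL))//.
rewrite (leq_trans (n := (2 * L) ^ 10))//; first by rewrite leq_exp2r//; lia.
by rewrite expnMn.
Qed.
Let pE : p%:R = ll ^+ 4. Proof. by rewrite natrX. Qed.
Let rp : r%:R * p%:R <= s ^+ 2 :> R.
Proof.
rewrite s2 -natrM ler_nat (leq_trans _ (leq_trunc_div n m))// leq_mul2l leq_addr orbT//.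
Qed.

Let cnt := \sum_(t < n | ~~ ((t < r * m) && (t %% m < p))%N) (1 : R).

Let cntE : cnt = n%:R - r%:R * p%:R.
Proof.
have := sum_blocks_leftover (fun=> 1 : R) (leq_addr (3 * l) p) m0 (leq_trunc_div n m).
rewrite sumr_const card_ord -/cnt => ->.
by rewrite !sumr_const !card_ord -mulrnA mulnC natrM [_ + cnt]addrC addrK.
Qed.

(** A gap has length [3 * l] with [l = p / L], so the gaps make up at most [3 * n / L] indices. The
    tail is shorter than [m <= 4 * L ^ 4], hence at most [4 * n / L] since [L ^ 5 <= n]. *)
Let cnt_le : cnt <= 7 * s ^+ 2 * ll^-1.
Proof.
rewrite ler_pdivlMr// cntE s2 -natrM -[7]/(7%:R) -natrM /ll.
have h : (n * L <= 7 * n + r * p * L)%N.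
  have nE := divn_eq n m; have := ltn_pmod n m0; rewrite -/r in nE *.
  move=> nm.
  have h1 : (r * (3 * l) * L <= 3 * n)%N.
    have -> : (r * (3 * l) * L = 3 * (r * p))%N by rewrite /p (expnSr L 3) -/l; move: r l => r' l'; ring.
    rewrite leq_mul2l/= [X in (_ <= X)%N]nE (leq_trans _ (leq_addr _ _))// leq_mul2l leq_addr orbT//.
  have h2 : (n %% m * L <= 4 * n)%N.
    apply: (@leq_trans (m * L)); first by rewrite leq_mul2r ltnW ?orbT.
    apply: (@leq_trans (4 * L ^ 5)); last first.
      by rewrite leq_mul2l/= (leq_trans _ Ln)// leq_pexp2l.
    have : (L ^ 4 <= L ^ 5)%N by rewrite leq_pexp2l.
    rewrite /m /p /l mulnDl -mulnA -(expnSr L 4) -(expnSr L 3); lia.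
  rewrite {1}nE mulnDl (mulnDr r) mulnDl; lia.
by rewrite mulrBl -!natrM lerBlDr -natrD ler_nat.
Qed.

Let v := V p.
(** Gaussian cosine expectation for one block, whose [p] indices carry the limiting variance
    [th ^+ 2 * lrv * p]. In [e1] the variance error of the block and the second-order error of the
    exponential are collected. *)
Let rho := expR (- (th ^+ 2 * lrv * p%:R / 2)).
Let e1 := th ^+ 2 * `|v - lrv * p%:R| / 2 + (th ^+ 2 * lrv * p%:R / 2) ^+ 2.

Let th0 : 0 <= th. Proof. by rewrite invr_ge0 ltW. Qed.
Let z0 : 0 <= th ^+ 2 * lrv * p%:R / 2.
Proof. by rewrite !mulr_ge0// ?sqr_ge0// lrv_ge0. Qed.

Let rho01 : 0 <= rho <= 1.
Proof. by rewrite expR_ge0/= -expR0 ler_expR oppr_le0. Qed.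

Let vrho : `|1 - th ^+ 2 * v / 2 - rho| <= e1.
Proof.
rewrite (le_trans (ler_distD (1 - th ^+ 2 * lrv * p%:R / 2) _ _))// lerD//.
  rewrite (_ : _ - _ = th ^+ 2 * (lrv * p%:R - v) / 2); last by ring.
  by rewrite !normrM distrC ger0_norm ?sqr_ge0// [`|2^-1|]ger0_norm.
by rewrite distrC expRN_sub_le.
Qed.

Let rho_r : `|rho ^+ r - expR (- (lrv / 2))| <= 7 * lrv * ll^-1.
Proof.
have l0 := lrv_ge0.
rewrite /rho -expRM_natl mulrN (le_trans (expRN_lipschitz _ _))//.
- by rewrite mulr_ge0.
- by rewrite divr_ge0.
rewrite (_ : _ - _ = - (lrv / 2 * (th ^+ 2 * cnt))); last first.
  rewrite cntE -s2 /th mulrBr exprVn mulVf ?gt_eqF ?exprn_gt0//; ring.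
have c0 : 0 <= cnt by rewrite sumr_ge0.
rewrite normrN ger0_norm; last by rewrite !mulr_ge0// ?sqr_ge0.
have h : th ^+ 2 * cnt <= 7 * ll^-1.
  rewrite /th exprVn mulrC ler_pdivrMr ?exprn_gt0//.
  by rewrite mulrAC.
rewrite (le_trans (y := lrv / 2 * (7 * ll^-1)))// ?ler_wpM2l ?divr_ge0//.
have : 0 <= ll^-1 by rewrite invr_ge0 ltW.
move: (ll^-1) => z zz; nra.
Qed.

(** The terms follow from [r * p * th ^+ 2 <= 1], [p * th <= L^-1] and [sqrt n <= 32 * L ^ 5]. The
    constants 32 and [1024 = 32 ^ 2] stem from [n < (2 * L) ^ 10]. *)
Let block_err : r%:R * (th * (p%:R * al l) + 2 * (be l + (th * (p%:R * al l) + th ^+ 3 * (p%:R * C) * v + e1)))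
 <= 32 * (l%:R ^+ 2 * al l) + 2 * (1024 * (l%:R ^+ 2 * be l) + (32 * (l%:R ^+ 2 * al l) + 2 * C * absK * ll^-1
    + (`|v / p%:R - lrv| / 2 + lrv ^+ 2 * ll^-1))).
Proof.
have l2 : l%:R ^+ 2 = ll ^+ 6 by rewrite natrX -exprM.
have p0 : 0 < p%:R :> R by rewrite pE exprn_gt0.
have r0 : 0 <= r%:R :> R by [].
have thE : th * s = 1 by rewrite /th mulVf ?gt_eqF.
have rpth : r%:R * p%:R * th ^+ 2 <= 1.
  by rewrite /th exprVn ler_pdivrMr ?exprn_gt0// mul1r.
have h1 : r%:R * (th * (p%:R * al l)) <= 32 * (l%:R ^+ 2 * al l).
  rewrite mulrA mulrA mulrA; apply: ler_wpM2r => //.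
  rewrite (_ : _ * _ * _ = (r%:R * p%:R * th ^+ 2) * s); last first.
    by rewrite expr2 [RHS](_ : _ = r%:R * th * p%:R * (th * s)); [rewrite thE mulr1|ring].
  rewrite (le_trans (ler_wpM2r (ltW s0) rpth))// mul1r (le_trans sll)// l2 ler_wpM2l//.
  by rewrite ler_weXn2l.
have h2 : r%:R * be l <= 1024 * (l%:R ^+ 2 * be l).
  rewrite mulrA; apply: ler_wpM2r => //.
  rewrite -(ler_pM2r p0) (le_trans rp)// l2 pE -mulrA -exprD.
  rewrite (le_trans (y := (32 * ll ^+ 5) ^+ 2))// ?ler_pXn2r ?nnegrE ?mulr_ge0 ?exprn_ge0 ?(ltW s0) ?(ltW ll0)//.
  by rewrite exprMn -exprM ler_wpM2r ?exprn_ge0 ?(ltW s0) ?(ltW ll0)// -natrX ler_nat.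
have /andP[v0 v1] := V_le p; rewrite -/v in v0 v1.
have pth : p%:R * th <= ll^-1.
  rewrite /th ler_pdivrMr// pE mulrC ler_pdivlMr// -exprSr//.
have h3 : r%:R * (th ^+ 3 * (p%:R * C) * v) <= 2 * C * absK * ll^-1.
  rewrite (_ : _ * _ = r%:R * p%:R * th ^+ 2 * (C * (th * v))); last by ring.
  rewrite (le_trans (ler_wpM2r _ rpth))// ?mulr_ge0// mul1r.
  rewrite [leRHS](_ : _ = C * (2 * absK * ll^-1)); last by ring.
  rewrite ler_wpM2l// (le_trans (ler_wpM2l th0 v1))//.
  rewrite [leLHS](_ : _ = 2 * absK * (p%:R * th)); last by ring.
  by rewrite ler_wpM2l// mulr_ge0.
have h4 : r%:R * (th ^+ 2 * `|v - lrv * p%:R| / 2) <= `|v / p%:R - lrv| / 2.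
  rewrite [leLHS]mulrA ler_wpM2r//.
  rewrite (_ : v - lrv * p%:R = p%:R * (v / p%:R - lrv)); last first.
    by rewrite mulrBr mulrCA mulfV ?gt_eqF// mulr1 [lrv * _]mulrC.
  rewrite normrM [`|p%:R|]ger0_norm; last exact: ltW.
  by rewrite (_ : _ * _ = r%:R * p%:R * th ^+ 2 * `|v / p%:R - lrv|) ?ler_piMl//; ring.
have h5 : r%:R * (th ^+ 2 * lrv * p%:R / 2) ^+ 2 <= lrv ^+ 2 * ll^-1.
  rewrite (_ : _ * _ = (r%:R * p%:R * th ^+ 2) * ((p%:R * th) * (th * (lrv ^+ 2 / 4)))); last by field.
  have q0 : 0 <= th * (lrv ^+ 2 / 4) by rewrite mulr_ge0// divr_ge0// sqr_ge0.
  have pth0 : 0 <= p%:R * th by rewrite mulr_ge0.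
  rewrite (le_trans (ler_wpM2r _ rpth)) ?mul1r//; first by rewrite mulr_ge0.
  rewrite (le_trans (ler_wpM2r q0 pth))// mulrC ler_wpM2r ?invr_ge0 ?(ltW s0) ?(ltW ll0)//.
  have th1 : th <= 1 by rewrite invf_le1// (le_trans _ lls)// exprn_ege1.
  have : 0 <= lrv ^+ 2 by rewrite sqr_ge0.
  move: (lrv ^+ 2) => q qq; nra.
rewrite /e1; move: h1 h2 h3 h4 h5; rewrite !mulrDr.
set a1 := r%:R * _; set a2 := r%:R * be l; set a3 := r%:R * _; set a4 := r%:R * _; set a5 := r%:R * _.
move=> h1 h2 h3 h4 h5.
rewrite [r%:R * (2 * _)]mulrCA -/a1 -/a2.
rewrite ![r%:R * (2 * _)]mulrCA -/a3 -/a4 -/a5 -/a1 -/a2.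
lra.
Qed.

Let S w := \sum_(t < n) Y t w.
Let B w := \sum_(i < r) \sum_(j < p) Y (i * m + j)%N w.

Let bB : bdm B. Proof. by apply: bdm_sum => i _; apply: bdm_sum. Qed.
Let bS : bdm S. Proof. exact: bdm_sum. Qed.

Let SB : th * \int[P]_w `|S w - B w| <= Num.sqrt (14 * absK * ll^-1).
Proof.
have bSB : bdm (fun w => S w - B w) by exact: bdmB.
have E0 : 0 <= \int[P]_w `|S w - B w| by exact: Ex_ge0.
rewrite -[leLHS](ger0_norm (mulr_ge0 th0 E0)) -sqrtr_sqr ler_wsqrtr// exprMn.
have h : (\int[P]_w `|S w - B w|) ^+ 2 <= 2 * absK * cnt.
  rewrite (le_trans (Ex_sqr P bSB))// /cnt.
  apply: le_trans (second_moment_subset bY cov sum_norm_gam_le n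
    (fun t => ~~ ((t < r * m) && (t %% m < p))%N)).
  rewrite le_eqVlt; apply/orP; left; apply/eqP; apply: eq_Rintegral => w _.
  rewrite /S (sum_blocks_leftover (Y ^~ w) (leq_addr (3 * l) p) m0 (leq_trunc_div n m)).
  by rewrite addrC addKr.
rewrite (le_trans (ler_wpM2l (sqr_ge0 _) h))// /th exprVn mulrC ler_pdivrMr ?exprn_gt0//.
have K2 : 0 <= 2 * absK by apply: mulr_ge0.
rewrite (le_trans (ler_wpM2l K2 cnt_le))//.
by rewrite le_eqVlt; apply/orP; left; apply/eqP; ring.
Qed.

Lemma cos_clt_error :
  `|\int[P]_w cos (th * S w) - expR (- (lrv / 2))| <= clt_error L.
Proof.
rewrite (le_trans (ler_distD (\int[P]_w cos (th * B w)) _ _))// /clt_error -addrA lerD//.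
  apply: le_trans SB; apply: Ex_lipschitz => //; [exact: lipschitz_cos|exact: bdm_cos].
rewrite (le_trans (ler_distD (rho ^+ r) _ _))// lerD//.
apply: le_trans block_err.
exact: (cos_block_sums C0 bY YC EY cov by_ Yy W0 WD Wcos Wsin Wmono Wy Wmix r th0 m0 rho01 vrho).
Qed.

Lemma sin_clt_error : `|\int[P]_w sin (th * S w)| <= clt_error L.
Proof.
rewrite -[X in `|X|]subr0.
rewrite (le_trans (ler_distD (\int[P]_w sin (th * B w)) _ _))// subr0 /clt_error -addrA lerD//.
  apply: le_trans SB; apply: Ex_lipschitz => //; [exact: lipschitz_sin|exact: bdm_sin].
rewrite ler_wpDr//; first by rewrite (le_trans _ rho_r).
apply: le_trans block_err.
exact: (sin_block_sums C0 bY YC EY cov by_ Yy W0 WD Wcos Wsin Wmono Wy Wmix r th0 m0 rho01 vrho).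
Qed.

End one_n.

Let cvg_expn k : (fun L => L ^ k.+1)%N @ \oo --> \oo.
Proof.
move=> A [N _ NA]; exists N => // n /= Nn; apply: NA => /=.
by rewrite (leq_trans Nn)//; case: n {Nn} => // n; rewrite expnS leq_pmulr// expn_gt0.
Qed.

Let clt_error_cvg0 : clt_error @ \oo --> (0 : R).
Proof.
have inv0 : (fun L : nat => (L%:R : R)^-1) @ \oo --> (0 : R).
  rewrite -(cvg_shiftS (fun L : nat => (L%:R : R)^-1)); exact: cvg_harmonic.
have cZ (c : R) (f : nat -> R) : f @ \oo --> (0 : R) -> (fun L => c * f L) @ \oo --> (0 : R).
  by move=> f0; rewrite -[X in _ --> X](mulr0 c); exact: cvgMr.
have cD (f g : nat -> R) : f @ \oo --> (0 : R) -> g @ \oo --> (0 : R) ->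
    (fun L => f L + g L) @ \oo --> (0 : R).
  by move=> f0 g0; rewrite -[X in _ --> X](addr0 0); exact: cvgD.
have cA := cvg_comp _ _ (cvg_expn 2) al2.
have cB := cvg_comp _ _ (cvg_expn 2) be2.
have cV : (fun L => `|V (L ^ 4)%N / (L ^ 4)%N%:R - lrv|) @ \oo --> (0 : R).
  rewrite -[X in _ --> X](normr0 R); apply: cvg_norm; rewrite -[X in _ --> X](subrr lrv).
  by apply: cvgB; [exact: cvg_comp _ _ (cvg_expn 3) V_cvg|exact: cvg_cst].
rewrite /clt_error; apply: (cD); last exact: cZ.
apply: (cD).
  rewrite -[X in _ --> X](sqrtr0 R).
  by apply: (continuous_cvg _ (@sqrt_continuous R 0)); exact: cZ.
apply: (cD); first exact: cZ.
apply: (cZ); apply: (cD); first exact: cZ.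
apply: (cD); first by apply: (cD); exact: cZ.
apply: (cD); last exact: cZ.
rewrite (_ : (fun _ => _) = fun L => 2^-1 * `|V (L ^ 4)%N / (L ^ 4)%N%:R - lrv|); first exact: cZ.
by apply/funext => L; rewrite mulrC.
Qed.

Lemma clt_error_small (e : R) : 0 < e -> \forall n \near \oo, exists L : nat,
  [/\ (0 < L)%N, (L ^ 10 <= n)%N, (n < L.+1 ^ 10)%N & clt_error L < e].
Proof.
move=> e0; have /cvgr_lt/(_ _ e0)[M _ hM] := clt_error_cvg0.
(* Beyond this threshold the largest [L] with [L ^ 10 <= n] exceeds [M], where the error is already
   below [e]. *)
exists (M.+1 ^ 10)%N => // n /= Mn.
have ex : exists L, (L ^ 10 <= n)%N by exists M.+1.
have ub L : (L ^ 10 <= n)%N -> (L <= n)%N.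
  by move=> /(leq_trans _); apply; case: L => // L; rewrite expnS leq_pmulr// expn_gt0.
case: (ex_maxnP ex ub) => L Ln maxL; have ML := maxL _ Mn.
exists L; split => //; first by rewrite (leq_trans _ ML).
  by rewrite ltnNge; apply/negP => /maxL; rewrite ltnn.
by apply: hM => /=; rewrite (leq_trans _ ML).
Qed.

Lemma cos_clt : (fun n => \int[P]_w cos ((Num.sqrt n%:R)^-1 * \sum_(t < n) Y t w)) @ \oo -->
  expR (- (lrv / 2)).
Proof.
apply/cvgrPdist_lt => e e0; apply: filterS (clt_error_small e0) => n [L [L0 Ln nL eL]].
by rewrite distrC; apply: le_lt_trans eL; exact: cos_clt_error.
Qed.

Lemma sin_clt : (fun n => \int[P]_w sin ((Num.sqrt n%:R)^-1 * \sum_(t < n) Y t w)) @ \oo -->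
  (0 : R).
Proof.
apply/cvgr0Pnorm_lt => e e0; apply: filterS (clt_error_small e0) => n [L [L0 Ln nL eL]].
by apply: le_lt_trans eL; exact: sin_clt_error.
Qed.

End core_limit.

(** * Conditionally independent copies and 1-continuity *)

Section density.
Context {R : realType} {d : measure_display} {T : measurableType d}.
Variables (mu nu : {measure set T -> \bar R}) (u : T -> R).
Hypothesis mu_ : measurable_fun setT u.
Hypothesis u0 : forall x, 0 <= u x.
Hypothesis nuE : forall A, measurable A -> nu A = (\int[mu]_(x in A) (u x)%:E)%E.
Local Open Scope ereal_scope.
Import HBNNSimple.

(** Given for indicators by [nuE], extended to simple functions by linearity and to nonnegative
    functions by monotone convergence. It serves both the law of the copy and the normal law. *)
Lemma ge0_integral_density (f : T -> \bar R) : measurable_fun setT f ->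
  (forall x, 0 <= f x) -> \int[nu]_x f x = \int[mu]_x (f x * (u x)%:E).
Proof.
move=> mf f0; pose f_ := nnsfun_approx measurableT mf.
have lim_f x : (EFin \o f_ ^~ x) n @[n --> \oo] --> f x by exact: cvg_nnsfun_approx.
have nd_f x m n : (m <= n)%N -> (f_ m x)%:E <= (f_ n x)%:E.
  by move=> mn; rewrite lee_fin; exact/lefP/nd_nnsfun_approx.
transitivity (limn (fun n => \int[nu]_x (f_ n x)%:E)).
  rewrite -monotone_convergence//.
  - by apply: eq_integral => y _; apply/esym/cvg_lim => //; exact: lim_f.
  - by move=> n; exact/measurable_EFinP/measurable_funP.
  - by move=> n y _; rewrite lee_fin.
  - by move=> y _ m n mn; exact: nd_f.
rewrite [X in limn X](_ : _ = (fun n => \int[mu]_x ((f_ n x)%:E * (u x)%:E))).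
  rewrite -monotone_convergence//.
  - apply: eq_integral => x _; apply/cvg_lim => //.
    by apply: cvgeZr => //; exact: lim_f.
  - move=> n; apply: emeasurable_funM; apply/measurable_EFinP => //.
  - by move=> n x _; rewrite -EFinM lee_fin mulr_ge0.
  - by move=> x _ m k mk; apply: lee_wpmul2r; [rewrite lee_fin|exact: nd_f].
apply/funext => n.
have mfn r : measurable (f_ n @^-1` [set r]) by [].
transitivity (\sum_(k \in range (f_ n)) k%:E * nu (f_ n @^-1` [set k])).
  rewrite integralT_nnsfun sintegralE; apply: eq_fsbigr => r _.
  by [].
transitivity (\sum_(k \in range (f_ n)) \int[mu]_x (k * \1_(f_ n @^-1` [set k]) x * u x)%:E).
  apply: eq_fsbigr => r rf.
  have r0 : (0 <= r)%R by move: rf; rewrite inE => -[t _ <-].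
  under eq_integral => x _ do rewrite -mulrA EFinM.
  rewrite ge0_integralZl//.
  - rewrite nuE// [in LHS]integral_mkcond; congr (_ * _); apply: eq_integral => x _.
    rewrite patchE indicE; case: ifPn => _; by rewrite ?mul1r// mul0r.
  - by apply/measurable_EFinP/measurable_funM.
  - by move=> x _; rewrite lee_fin mulr_ge0.
rewrite -ge0_integral_fsum//.
- apply: eq_integral => x _; rewrite [in RHS]fimfunE -EFinM mulr_fsuml.
  by rewrite fsumEFin.
- by move=> r; apply/measurable_EFinP/measurable_funM => //; exact/measurable_funM.
- move=> r x _; rewrite lee_fin mulr_ge0//.
  by have := nnfun_muleindic_ge0 (f_ n) r x; rewrite lee_fin.
Qed.

End density.

Section conditional_copy.
Context {R : realType} {d : measure_display} {T : measurableType d}.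
Variables (P : probability T R) (kap : {mfun T >-> nat}).
Let mkap : measurable_fun setT kap := measurable_funP kap.

Let G j := kap @^-1` [set j].
Let q j := fine (P (G j)).

Let mG j : measurable (G j).
Proof. by rewrite /G -[_ @^-1` _]setTI; exact: mkap. Qed.

Let PG j : P (G j) = (q j)%:E.
Proof. by rewrite fineK// fin_num_measure. Qed.

Let q0 j : 0 <= q j. Proof. exact: fine_ge0. Qed.

(* Density of the conditionally independent copy given [kap]: the null cells,
   where 1/0 = 0, carry no mass. *)
Definition copy_density (z : T * T) : R :=
  if kap z.1 == kap z.2 then (q (kap z.1))^-1 else 0.
Let u := copy_density.

Let mk1 : measurable_fun setT (fun z : T * T => kap z.1).
Proof. by apply: (measurableT_comp mkap). Qed.
Let mk2 : measurable_fun setT (fun z : T * T => kap z.2).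
Proof. by apply: (measurableT_comp mkap). Qed.

Let u0 z : 0 <= u z.
Proof. by rewrite /u /copy_density; case: ifP => // _; rewrite invr_ge0. Qed.

Lemma measurable_copy_density : measurable_fun setT copy_density.
Proof.
apply: measurable_fun_ifT => //; first exact: measurable_fun_eqn.
by apply: (@measurableT_comp _ _ _ _ _ _ (fun j : nat => (q j)^-1)).
Qed.

Let mu_ : measurable_fun setT u := measurable_copy_density.

Let eu : measurable_fun setT (EFin \o u). Proof. exact/measurable_EFinP. Qed.

(** Law of a pair in which the first point has law [P] and the second, given the first, has law [P]
    conditioned on the cell of the first. *)
Definition copy_measure (A : set (T * T)) : \bar R :=
  (\int[P \x P]_(z in A) (u z)%:E)%E.
Let Q := copy_measure.

Let Q0' : Q set0 = 0%E. Proof. by rewrite /Q /copy_measure integral_set0. Qed.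

Let Q_ge0 A : (0 <= Q A)%E.
Proof. by apply: integral_ge0 => z _; rewrite lee_fin. Qed.

Let Q_sigma_additive : semi_sigma_additive Q.
Proof.
move=> /= A mA tA mUA; rewrite /Q /copy_measure ge0_integral_bigcup//.
- apply: is_cvg_ereal_nneg_natsum_cond => n _ _.
  by apply: integral_ge0 => z _; rewrite lee_fin.
- exact: measurable_funTS.
- by move=> z _; rewrite lee_fin.
Qed.

HB.instance Definition _ := isMeasure.Build _ _ _ Q Q0' Q_ge0 Q_sigma_additive.

(** The value stays in the form [q * q^-1]: it is 1 on cells of positive mass and 0 on the null
    cells. *)
Let sec (x : T) : (\int[P]_y (u (x, y))%:E = (q (kap x) * (q (kap x))^-1)%:E)%E.
Proof.
rewrite (_ : (fun y => _) = (fun y => (q (kap x))^-1%:E * (\1_(G (kap x)) y)%:E)%E).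
  rewrite ge0_integralZl//.
  - by rewrite integral_indic// setIT [X in (_ * X)%E](PG (kap x)) -EFinM mulrC.
  - by apply/measurable_EFinP; exact: measurable_indic.
  - by rewrite lee_fin invr_ge0.
apply/funext => y; rewrite /u /copy_density/= indicE; case: ifPn => [/eqP e|e].
  by rewrite mem_set ?mule1//= /G/= e.
rewrite memNset ?mule0//= /G/= => /esym; exact/eqP.
Qed.

(** Countability of the cells enters here: the union of the null ones is still negligible. *)
Let null_cells : P.-negligible (kap @^-1` [set j | q j = 0]).
Proof.
rewrite (_ : _ @^-1` _ = \bigcup_j (if q j == 0 then G j else set0)).
  apply: negligible_bigcup => j; case: ifPn => [/eqP qj|_]; last exact: negligible_set0.
  by apply/negligibleP => //; rewrite [LHS](PG j) qj.
apply/seteqP; split=> [x/= qx|x [j _]]; first by exists (kap x) => //; rewrite qx eqxx.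
by case: ifPn => // /eqP qj; rewrite /G/= => ->.
Qed.

Lemma copy_fst (F : T -> R) : measurable_fun setT F -> (forall x, 0 <= F x) ->
  (\int[P \x P]_z ((F z.1)%:E * (u z)%:E) = \int[P]_x (F x)%:E)%E.
Proof.
move=> mF F0.
have m1 : measurable_fun setT (fun z : T * T => (F z.1)%:E * (u z)%:E)%E.
  apply: emeasurable_funM => //; apply/measurable_EFinP.
  exact: (measurableT_comp mF).
rewrite fubini_tonelli1//; last by move=> z; rewrite mule_ge0// lee_fin.
rewrite /fubini_F/=.
have -> : (\int[P]_x \int[P]_y ((F x)%:E * (u (x, y))%:E) =
   \int[P]_x ((F x) * (q (kap x) * (q (kap x))^-1))%:E)%E.
  apply: eq_integral => x _; rewrite ge0_integralZl//.
  - by rewrite sec.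
  - by apply: (measurableT_comp eu); exact: pair1_measurable.
  - by move=> y _; rewrite lee_fin.
  - by rewrite lee_fin.
have mq (f : nat -> R) : measurable_fun setT (fun x => f (kap x)).
  exact: (measurableT_comp _ mkap).
apply: ae_eq_integral => //.
- by apply/measurable_EFinP; apply: measurable_funM => //; exact: (mq (fun j => q j * (q j)^-1)).
- exact/measurable_EFinP.
- apply: negligibleS null_cells => x /= h; apply: contrapT => /eqP qx; apply: h => _.
  by rewrite mulfV ?mulr1.
Qed.

Let u_sym z : u (z.2, z.1) = u z.
Proof. by rewrite /u /copy_density/= eq_sym; case: ifPn => // /eqP ->. Qed.

(** The density is symmetric, so exchanging the order of integration turns this marginal into the
    first one. *)
Lemma copy_snd (F : T -> R) : measurable_fun setT F -> (forall x, 0 <= F x) ->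
  (\int[P \x P]_z ((F z.2)%:E * (u z)%:E) = \int[P]_x (F x)%:E)%E.
Proof.
move=> mF F0; rewrite -(copy_fst mF F0).
have mF1 : measurable_fun setT (fun z : T * T => (F z.1)%:E * (u z)%:E)%E.
  apply: emeasurable_funM => //; apply/measurable_EFinP.
  exact: (measurableT_comp mF).
have mF2 : measurable_fun setT (fun z : T * T => (F z.2)%:E * (u z)%:E)%E.
  apply: emeasurable_funM => //; apply/measurable_EFinP.
  exact: (measurableT_comp mF).
have p1 z : (0 <= (F z.1)%:E * (u z)%:E)%E by rewrite mule_ge0// lee_fin.
have p2 z : (0 <= (F z.2)%:E * (u z)%:E)%E by rewrite mule_ge0// lee_fin.
have e1 := @fubini_tonelli1 _ _ _ _ _ P P _ mF1 p1.
have e2 := @fubini_tonelli2 _ _ _ _ _ P P _ mF2 p2.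
transitivity (\int[P]_y \int[P]_x ((F y)%:E * (u (x, y))%:E))%E; first exact: e2.
transitivity (\int[P]_x \int[P]_y ((F x)%:E * (u (x, y))%:E))%E; last exact: esym e1.
apply: eq_integral => x _; apply: eq_integral => y _ /=.
by rewrite -u_sym.
Qed.

Lemma copy_integral (f : T * T -> \bar R) : measurable_fun setT f -> (forall z, 0 <= f z)%E ->
  (\int[Q]_z f z = \int[P \x P]_z (f z * (u z)%:E))%E.
Proof. by move=> mf f0; apply: (@ge0_integral_density _ _ _ (P \x P)%E Q u). Qed.

Let Q1 : Q setT = 1%E.
Proof.
transitivity (\int[P \x P]_z (((fun=> 1) z.1)%:E * (u z)%:E))%E.
  by apply: eq_integral => z _; rewrite mul1e.
rewrite (copy_fst (F := fun=> 1))//; transitivity (1%:E * P setT)%E; first exact: integral_cst.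
by rewrite [P _]probability_setT mule1.
Qed.

HB.instance Definition _ := @Measure_isProbability.Build _ _ R Q Q1.

Let copyE A : measurable A -> Q A = (\int[P \x P]_z ((\1_A z)%:E * (u z)%:E))%E.
Proof.
move=> mA; rewrite /Q /copy_measure integral_mkcond; apply: eq_integral => z _.
by rewrite patchE indicE; case: ifPn => _; rewrite ?mul1e ?mul0e.
Qed.

Lemma copy_law_fst A : measurable A -> Q (fst @^-1` A) = P A.
Proof.
move=> mA; rewrite copyE; last by rewrite -[_ @^-1` _]setTI; exact: measurable_fst.
transitivity (\int[P]_x (\1_A x)%:E)%E; last by rewrite integral_indic// setIT.
by rewrite -copy_fst//; apply: measurable_indic.
Qed.

Lemma copy_law_snd A : measurable A -> Q (snd @^-1` A) = P A.
Proof.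
move=> mA; rewrite copyE; last by rewrite -[_ @^-1` _]setTI; exact: measurable_snd.
transitivity (\int[P]_x (\1_A x)%:E)%E; last by rewrite integral_indic// setIT.
by rewrite -copy_snd//; apply: measurable_indic.
Qed.

(** Elementary conditional expectation given [kap = j]; on a null cell the convention [1 / 0 = 0]
    makes it 0. *)
Definition cond_mean (h : T -> R) (j : nat) : R :=
  (q j)^-1 * \int[P]_y (if kap y == j then h y else 0).

Let bdm_u x : bdm (fun y => u (x, y)).
Proof.
split; first by apply: (measurableT_comp mu_); exact: pair1_measurable.
by exists (q (kap x))^-1 => y; rewrite ger0_norm// /u /copy_density; case: ifP => // _; rewrite invr_ge0.
Qed.

(** For [x] in a cell of positive mass, [h x - cond_mean h (kap x)] is the mean of [h x - h y] over
    the copy [y], and the absolute value may be taken inside. The null cells are discarded. *)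
Lemma dist_cond_mean (h : T -> R) : bdm h ->
  (\int[P]_x `|h x - cond_mean h (kap x)|%:E <=
   \int[P \x P]_z (`|h z.1 - h z.2|%:E * (u z)%:E))%E.
Proof.
move=> bh; have mh := bh.1.
have mf : measurable_fun setT (fun z : T * T => `|h z.1 - h z.2|%:E * (u z)%:E)%E.
  apply: emeasurable_funM => //; apply/measurable_EFinP.
  apply: measurableT_comp => //; apply: measurable_funB.
    exact: (measurableT_comp mh).
  exact: (measurableT_comp mh).
rewrite fubini_tonelli1//; last by move=> z; rewrite mule_ge0// lee_fin.
have mv : measurable_fun setT (fun x => cond_mean h (kap x)) by exact: (measurableT_comp _ mkap).
apply: ae_ge0_le_integral => //.
- apply/measurable_EFinP; apply: measurableT_comp => //.
  exact: measurable_funB.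
- by move=> x _; apply: integral_ge0 => y _; rewrite mule_ge0// lee_fin.
- by apply: measurable_fun_fubini_tonelli_F => // z; rewrite mule_ge0// lee_fin.
apply: negligibleS null_cells => x /= hx; apply: contrapT => /eqP qx; apply: hx => _.
rewrite /fubini_F/=.
have bd : bdm (fun y => `|h x - h y| * u (x, y)).
  by apply: bdmM => //; apply: bdm_norm; apply: bdmB => //; exact: bdm_cst.
under eq_integral do rewrite -EFinM.
rewrite Ex_fin// lee_fin.
have b1 : bdm (fun y => h y * u (x, y)) by exact: bdmM.
have b2 : bdm (fun y => (h x - h y) * u (x, y)).
  by apply: bdmM => //; apply: bdmB => //; exact: bdm_cst.
have -> : h x - cond_mean h (kap x) = \int[P]_y ((h x - h y) * u (x, y)).
  have -> : \int[P]_y ((h x - h y) * u (x, y)) = \int[P]_y (h x * u (x, y) - h y * u (x, y)).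
    by apply: eq_Rintegral => y _; rewrite mulrBl.
  rewrite ExB//; last by apply: bdmM => //; exact: bdm_cst.
  rewrite ExZ//; congr (_ - _).
    by rewrite [X in _ * X](_ : _ = 1) ?mulr1// /Rintegral sec mulfV.
  rewrite /cond_mean -ExZ; last first.
    split; last by have [C hC] := bh.2; exists C => y; case: ifP => // _; rewrite normr0 (le_trans _ (hC y)).
    by apply: measurable_fun_ifT => //; exact: measurable_fun_eqn.
  apply: eq_Rintegral => y _; rewrite /u /copy_density/= eq_sym.
  by case: ifPn; rewrite ?mulr0// mulrC.
apply: le_trans (Ex_norm P b2) _; apply: Ex_le => //; first exact: bdm_norm.
by move=> y; rewrite normrM [`|u _|]ger0_norm.
Qed.

Lemma cond_mean_le (h : T -> R) (C : R) : bdm h -> (forall x, `|h x| <= C) ->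
  forall j, `|cond_mean h j| <= C.
Proof.
move=> bh hC j.
have C0 : 0 <= C.
  rewrite -(Ex_cst P C); apply: Ex_ge0 => w; exact: le_trans (hC w).
have mj : measurable [set y | kap y == j].
  rewrite (_ : [set _ | _] = G j)//; apply/seteqP; rewrite /G.
  by split => y/= => [/eqP|->].
have bj : bdm (fun y => if kap y == j then h y else 0).
  rewrite (_ : (fun _ => _) = fun y => (if kap y == j then 1 else 0) * h y).
    by apply: bdmM => //; exact: bdm_if.
  by apply/funext => y; case: ifP => _; rewrite ?mul1r ?mul0r.
have qj : q j = \int[P]_y (if kap y == j then 1 else 0).
  rewrite Ex_if//; congr (fine (P _)); apply/seteqP; rewrite /G.
  by split => y/= => [->|/eqP].
rewrite normrM ger0_norm ?invr_ge0//.
have [q00|qn0] := eqVneq (q j) 0; first by rewrite q00 invr0 mul0r.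
rewrite mulrC ler_pdivrMr ?lt_def ?qn0//= qj.
rewrite (le_trans (Ex_norm P bj))// -ExZ; last exact: bdm_if.
apply: Ex_le; [exact: bdm_norm|by apply: bdmM; [exact: bdm_cst|exact: bdm_if]|].
by move=> y; case: ifP => _; rewrite ?mulr1// normr0 mulr0.
Qed.

End conditional_copy.

(** * The ordinal pattern kernel and its approximation by cell functions *)

Section finite_boolean_combinations.
Context {d : measure_display} {T : measurableType d}.

Lemma measurable_forall (I : finType) (b : I -> T -> bool) :
  (forall i, measurable_fun setT (b i)) -> measurable_fun setT (fun w => [forall i, b i w]).
Proof.
move=> mb; rewrite (_ : (fun _ => _) = fun w => \big[andb/true]_(i <- enum I) b i w).
  elim: (enum I) => [|i s ih].
    by rewrite (_ : (fun _ => _) = cst true)//; apply/funext => w; rewrite big_nil.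
  rewrite (_ : (fun _ => _) = fun w => b i w && \big[andb/true]_(i <- s) b i w).
    exact: measurable_and.
  by apply/funext => w; rewrite big_cons.
by apply/funext => w; rewrite big_all; apply/forallP/allP => h i => [_|]; [exact: h|apply: h; rewrite mem_enum].
Qed.

Lemma measurable_bool_set (b : T -> bool) : measurable_fun setT b -> measurable [set w | b w].
Proof.
by move=> mb; rewrite (_ : [set _ | _] = b @^-1` [set true])// -[_ @^-1` _]setTI; exact: mb.
Qed.

End finite_boolean_combinations.

Section ordinal_pattern_kernel.
Context {R : realType} {d : measure_display} {T : measurableType d}.
Variable m : nat.

Lemma measurable_is_OP (x : T -> 'I_m -> R) (s : {perm 'I_m}) :
  (forall j, measurable_fun setT (x ^~ j)) -> measurable_fun setT (fun w => is_OP (x w) s).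
Proof.
move=> mx; apply: measurable_forall => j; apply: measurable_forall => k.
have mb : measurable_fun setT (fun w => (x w j < x w k) || ((x w j == x w k) && (j < k)%N)).
  apply: measurable_or; first exact: measurable_fun_ltr.
  by apply: measurable_and => //; exact: measurable_fun_eqr.
case: (s j < s k)%N.
  rewrite (_ : (fun _ => _) = fun w => ((x w j < x w k) || ((x w j == x w k) && (j < k)%N))); first exact: mb.
  by apply/funext => w; case: (_ || _).
rewrite (_ : (fun _ => _) = fun w => ~~ ((x w j < x w k) || ((x w j == x w k) && (j < k)%N))).
  exact: measurable_neg.
by apply/funext => w; case: (_ || _).
Qed.

Lemma bdm_hOP (D : T -> m.-1.-tuple R) (c : 'I_(m`!)) : measurable_fun setT D ->
  bdm (fun w => tnth (hOP (D w)) c).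
Proof.
move=> mD; under eq_fun do rewrite tnth_mktuple.
apply: bdm_if; apply: measurable_bool_set; apply: measurable_is_OP => j.
rewrite /cumsum (_ : (fun _ => _) = fun w => \sum_(i <- [seq i : 'I_m.-1 <- index_enum 'I_m.-1 | (i < j)%N]) tnth (D w) i).
  by apply: measurable_sum => i; exact/(measurable_fun_tnthP D).1.
by apply/funext => w; rewrite big_filter.
Qed.

End ordinal_pattern_kernel.

Section euclidean_norm.
Context {R : realType} (n : nat).

Lemma enorm_ge (v : n.-tuple R) i : `|tnth v i| <= enorm v.
Proof.
rewrite -sqrtr_sqr ler_wsqrtr// (bigD1 i)//= lerDl.
by apply: sumr_ge0 => j _; rewrite sqr_ge0.
Qed.

Lemma enorm_le_sum (v : n.-tuple R) : enorm v <= \sum_i `|tnth v i|.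
Proof.
have s0 : 0 <= \sum_i `|tnth v i| by exact: sumr_ge0.
rewrite -[leRHS]ger0_norm// -sqrtr_sqr ler_wsqrtr//.
rewrite expr2 mulr_suml; apply: ler_sum => i _.
rewrite -real_normK ?num_real// expr2 ler_wpM2l// (bigD1 i)//= lerDl.
exact: sumr_ge0.
Qed.

Lemma measurable_enorm {d : measure_display} {T : measurableType d} (f : T -> n.-tuple R) :
  (forall i, measurable_fun setT (fun w => tnth (f w) i)) ->
  measurable_fun setT (fun w => enorm (f w)).
Proof.
move=> mf; rewrite /enorm; apply: (@measurableT_comp _ _ _ _ _ _ (@Num.sqrt R)).
  by apply: continuous_measurable_fun; exact: sqrt_continuous.
by apply: measurable_sum => i; exact: measurable_funX.
Qed.

End euclidean_norm.

Section kernel_approximation.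
Context {R : realType} {d : measure_display} {T : measurableType d}.
Variables (P : probability T R) (m : nat) (V : T -> m.-1.-tuple R) (phi : R -> R).
Hypothesis mV : measurable_fun setT V.
Hypothesis hphi : one_continuous_witness P V phi.
Variables (kap : {mfun T >-> nat}) (psi : 'I_m.-1 -> nat -> R) (er : 'I_m.-1 -> R).
Hypothesis Vpsi : forall i,
  (\int[P]_w `|tnth (V w) i - psi i (kap w)|%:E <= (er i)%:E)%E.

Let Q := copy_measure P kap.
Let u := copy_density P kap.

Let A i w := `|tnth (V w) i - psi i (kap w)|.
Let near_cost (e : R) (z : T * T) : R :=
  enorm (tsub (hOP (V z.1)) (hOP (V z.2))) * (if enorm (tsub (V z.1) (V z.2)) <= e then 1 else 0).

Let A0 i w : 0 <= A i w. Proof. exact: normr_ge0. Qed.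

Let mA i : measurable_fun setT (A i).
Proof.
apply: measurableT_comp => //; apply: measurable_funB.
  exact/(measurable_fun_tnthP V).1.
by apply: (@measurableT_comp _ _ _ _ _ _ (psi i)).
Qed.

Let mV1 : measurable_fun setT (fun z : T * T => V z.1).
Proof. exact: (measurableT_comp mV). Qed.
Let mV2 : measurable_fun setT (fun z : T * T => V z.2).
Proof. exact: (measurableT_comp mV). Qed.

Let m_near e : measurable_fun setT (near_cost e).
Proof.
apply: measurable_funM.
  apply: measurable_enorm => i; under eq_fun do rewrite tnth_mktuple.
  by apply: measurable_funB; [exact: (bdm_hOP i mV1).1|exact: (bdm_hOP i mV2).1].
apply: measurable_fun_ifT => //; apply: measurable_fun_ler => //.
apply: measurable_enorm => i; under eq_fun do rewrite tnth_mktuple.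
apply: measurable_funB.
  exact: ((measurable_fun_tnthP (fun z : T * T => V z.1)).1 mV1 i).
exact: ((measurable_fun_tnthP (fun z : T * T => V z.2)).1 mV2 i).
Qed.

Let near0 e z : 0 <= near_cost e z.
Proof. by rewrite mulr_ge0 ?sqrtr_ge0//; case: ifP. Qed.

Let u0 z : 0 <= u z.
Proof. by rewrite /u /copy_density; case: ifP => // _; rewrite invr_ge0 fine_ge0. Qed.

(** Markov's inequality before integration: when the two vectors are farther apart than [e], the
    difference, at most 1, is below their distance over [e]. Nonzero density forces equal [kap], so
    one point [psi i (kap _)] is an intermediate point for both vectors. *)
Let split_cost (e : R) c z : 0 < e -> u z != 0 ->
  `|tnth (hOP (V z.1)) c - tnth (hOP (V z.2)) c| <=
  near_cost e z + e^-1 * \sum_i (A i z.1 + A i z.2).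
Proof.
move=> e0 uz.
have k12 : kap z.1 = kap z.2.
  by move: uz; rewrite /u /copy_density; case: ifPn => [/eqP//|]; rewrite eqxx.
have S0 : 0 <= \sum_i (A i z.1 + A i z.2) by apply: sumr_ge0 => i _; rewrite addr_ge0.
rewrite /near_cost; case: ifPn => [_|].
  rewrite mulr1 ler_wpDr//; first by rewrite mulr_ge0// invr_ge0 ltW.
  apply: le_trans (enorm_ge (tsub (hOP (V z.1)) (hOP (V z.2))) c).
  by rewrite [tnth (tsub _ _) c]tnth_mktuple.
rewrite -ltNge mulr0 add0r => far; apply: (@le_trans _ _ 1).
  rewrite !tnth_mktuple; case: (is_OP (cumsum (V z.1)) _); case: (is_OP (cumsum (V z.2)) _);
  by rewrite ?subrr ?subr0 ?sub0r ?normrN ?normr1 ?normr0.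
rewrite mulrC ler_pdivlMr// mul1r (le_trans (ltW far))// (le_trans (enorm_le_sum _))//.
apply: ler_sum => i _; rewrite [tnth (tsub _ _) i]tnth_mktuple /A [in leRHS]k12.
rewrite [`|tnth (V z.2) i - psi _ _|]distrC.
by apply: le_trans (ler_normD _ _); rewrite addrA subrK.
Qed.

Lemma kernel_approx (e : R) (c : 'I_(m`!)) : 0 < e ->
  exists v : nat -> R, (forall j, `|v j| <= 1) /\
    \int[P]_w `|tnth (hOP (V w)) c - v (kap w)| <= phi e + 2 * (\sum_i er i) / e.
Proof.
move=> e0; pose h w := tnth (hOP (V w)) c.
have bh : bdm h by exact: bdm_hOP.
have h1 w : `|h w| <= 1 by rewrite /h tnth_mktuple; case: ifP => _; rewrite ?normr1 ?normr0.
have v1 := cond_mean_le P kap bh h1.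
exists (cond_mean P kap h); split => //.
have bv : bdm (fun w => cond_mean P kap h (kap w)).
  split; last by exists 1.
  by apply: (@measurableT_comp _ _ _ _ _ _ (cond_mean P kap h)).
rewrite -lee_fin -Ex_fin; last by apply: bdm_norm; exact: bdmB.
apply: le_trans (dist_cond_mean P kap bh) _.
have mu1 : measurable_fun setT (fun z : T * T => (u z)%:E).
  by apply/measurable_EFinP; exact: (measurable_copy_density P kap).
have mA1 i : measurable_fun setT (fun z : T * T => (A i z.1)%:E).
  by apply/measurable_EFinP; exact: (measurableT_comp (mA i)).
have mA2 i : measurable_fun setT (fun z : T * T => (A i z.2)%:E).
  by apply/measurable_EFinP; exact: (measurableT_comp (mA i)).
have mS : measurable_fun setT (fun z : T * T => \sum_i ((A i z.1)%:E * (u z)%:E + (A i z.2)%:E * (u z)%:E))%E.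
  by apply: emeasurable_sum => i; apply: emeasurable_funD; exact: emeasurable_funM.
have S0 z : (0 <= \sum_i ((A i z.1)%:E * (u z)%:E + (A i z.2)%:E * (u z)%:E))%E.
  by apply: sume_ge0 => i _; rewrite adde_ge0// mule_ge0// lee_fin.
have mN : measurable_fun setT (fun z : T * T => (near_cost e z)%:E) by exact/measurable_EFinP.
apply: (@le_trans _ _ (\int[P \x P]_z ((near_cost e z)%:E * (u z)%:E +
   e^-1%:E * \sum_i ((A i z.1)%:E * (u z)%:E + (A i z.2)%:E * (u z)%:E)))%E).
  apply: ge0_le_integral => //.
  - by move=> z _; rewrite mule_ge0// lee_fin.
  - apply: emeasurable_funM => //; apply/measurable_EFinP; apply: measurableT_comp => //.
    by apply: measurable_funB; [exact: (bdm_hOP c mV1).1|exact: (bdm_hOP c mV2).1].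
  - by apply: emeasurable_funD; exact: emeasurable_funM.
  - move=> z _; have [uz|uz] := eqVneq (u z) 0.
      apply: (@le_trans _ _ 0%E); first by rewrite -/u uz mule0.
      rewrite adde_ge0//; first by rewrite mule_ge0// lee_fin.
      by rewrite mule_ge0// lee_fin invr_ge0 ltW.
    under eq_bigr => i _ do rewrite -!EFinM -EFinD.
    rewrite sumEFin -!EFinM -EFinD lee_fin.
    under eq_bigr => i _ do rewrite -mulrDl.
    by rewrite -mulr_suml mulrA -mulrDl ler_wpM2r// split_cost.
rewrite ge0_integralD//=; last 4 first.
- by move=> z _; rewrite mule_ge0// lee_fin.
- exact: emeasurable_funM.
- by move=> z _; rewrite mule_ge0// lee_fin invr_ge0 ltW.
- exact: emeasurable_funM.
rewrite EFinD; apply: leeD.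
  rewrite -copy_integral//; last by move=> z; rewrite lee_fin.
  have [_ [_ [_ H]]] := hphi.
  (* 1-continuity is assumed for pairs on every probability space; here the space is [T * T] under
     the law of the copy, both of whose marginals are [P]. *)
  apply: (H _ _ (copy_measure P kap) (fun z => V z.1) (fun z => V z.2)) => //.
  - move=> B mB; apply: (copy_law_fst P kap (A := V @^-1` B)).
    by rewrite -[_ @^-1` _]setTI; exact: mV.
  - move=> B mB; apply: (copy_law_snd P kap (A := V @^-1` B)).
    by rewrite -[_ @^-1` _]setTI; exact: mV.
rewrite ge0_integralZl//; last by rewrite lee_fin invr_ge0 ltW.
rewrite mulrC EFinM; apply: lee_wpmul2l; first by rewrite lee_fin invr_ge0 ltW.
rewrite ge0_integral_sum//; last 2 first.
- by move=> i; apply: emeasurable_funD; exact: emeasurable_funM.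
- by move=> i z _; rewrite adde_ge0// mule_ge0// lee_fin.
rewrite mulr_sumr -sumEFin; apply: lee_sum => i _.
rewrite ge0_integralD//=; last 4 first.
- by move=> z _; rewrite mule_ge0// lee_fin.
- exact: emeasurable_funM.
- by move=> z _; rewrite mule_ge0// lee_fin.
- exact: emeasurable_funM.
rewrite (copy_fst P kap (F := A i))// (copy_snd P kap (F := A i))//.
by rewrite mulr_natl mulr2n EFinD; apply: leeD; exact: Vpsi.
Qed.

End kernel_approximation.

(** * Path space *)

Section path_space.
Context {dS : measure_display} {S : measurableType dS}.

Definition cylinders (I : set int) : set (set (int -> S)) :=
  \bigcup_(i in I) preimage_set_system setT (fun z : int -> S => z i) measurable.

Definition shift (t : int) (z : int -> S) : int -> S := fun k => z (t + k).

Lemma smallest_preimage {aT rT : Type} (f : aT -> rT) (F : set (set aT)) (G : set (set rT)) :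
  (forall A, G A -> <<s F >> (f @^-1` A)) -> forall A, <<s G >> A -> <<s F >> (f @^-1` A).
Proof.
move=> GF A; apply: (smallest_sub (C := sigma_algebra setT) (X := [set A | <<s F >> (f @^-1` A)])).
  have := sigma_algebra_image (D := setT) f (smallest_sigma_algebra setT F).
  rewrite /image_set_system; by under eq_fun do rewrite setTI.
exact: GF.
Qed.

Lemma shift_cylinders (I J : set int) t : (forall i, I i -> J (t + i)) ->
  forall A, <<s cylinders I >> A -> <<s cylinders J >> (shift t @^-1` A).
Proof.
move=> IJ; apply: smallest_preimage => A [i Ii [B mB <-]].
apply: sub_sigma_algebra; exists (t + i); first exact: IJ.
by exists B.
Qed.

Lemma cylindersS (I J : set int) : I `<=` J -> <<s cylinders I >> `<=` <<s cylinders J >>.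
Proof.
move=> IJ; apply: smallest_sub; first exact: smallest_sigma_algebra.
by move=> A [i Ii Ai]; apply: sub_sigma_algebra; exists i => //; exact: IJ.
Qed.

Lemma cylinders_prod I A : <<s cylinders I >> A -> <<s cylinders setT >> A.
Proof. exact: cylindersS. Qed.

Context {d : measure_display} {T : measurableType d}.
Variable Z : int -> T -> S.

Definition path (t : int) (w : T) : int -> S := fun k => Z (t + k) w.

Lemma shift_path s t w : shift s (path t w) = path (t + s) w.
Proof. by apply/funext => k; rewrite /shift /path addrA. Qed.

Lemma path_sigZ (I J : set int) t : (forall i, I i -> J (t + i)) ->
  forall A, <<s cylinders I >> A -> sigZ Z J (path t @^-1` A).
Proof.
move=> IJ; apply: smallest_preimage => A [i Ii [B mB <-]].
apply: sub_sigma_algebra; exists (t + i); first exact: IJ.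
by exists B.
Qed.

(** Time shifts act on paths, not on [T]. Writing events of the process as preimages of path events
    makes them movable in time. *)
Lemma sigZ_lift (I : set int) B : sigZ Z I B ->
  exists2 A, <<s cylinders I >> A & B = path 0 @^-1` A.
Proof.
rewrite /sigZ => sB.
suff : preimage_set_system setT (path 0) <<s cylinders I >> B.
  by move=> [A cA <-]; exists A => //; rewrite setTI.
move: B sB; apply: smallest_sub.
  exact/sigma_algebra_preimage/smallest_sigma_algebra.
move=> _ [i Ii [C mC <-]]; exists ((fun z : int -> S => z i) @^-1` C).
  by apply: sub_sigma_algebra; exists i => //; exists C => //; rewrite setTI.
by rewrite /path/= !setTI; apply/seteqP; split => w /=; rewrite add0r.
Qed.

Lemma sigZ_measurable (I : set int) : (forall t, measurable_fun setT (Z t)) ->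
  sigZ Z I `<=` measurable.
Proof.
move=> mZ; apply: smallest_sub; first exact: sigma_algebra_measurable.
by move=> _ [i Ii [C mC <-]]; exact: mZ.
Qed.

Lemma sigZS (I J : set int) : I `<=` J -> sigZ Z I `<=` sigZ Z J.
Proof.
move=> IJ; apply: smallest_sub; first exact: smallest_sigma_algebra.
by move=> A [i Ii Ai]; apply: sub_sigma_algebra; exists i => //; exact: IJ.
Qed.

End path_space.

Section path_law.
Context {R : realType} {dS : measure_display} {S : measurableType dS}.
Context {d : measure_display} {T : measurableType d}.
Variables (P : probability T R) (Z : int -> T -> S).
Hypothesis mZ : forall t, measurable_fun setT (Z t).
Hypothesis stZ : stationary P Z.

Definition fdd_sets : set (set (int -> S)) :=
  [set A | exists (n : nat) (ts : n.-tuple int) (B : set (n.-tuple S)),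
     measurable B /\ A = [set z | B [tuple z (tnth ts i) | i < n]]].

Lemma fdd_setI : setI_closed fdd_sets.
Proof.
move=> _ _ [n1 [t1 [B1 [mB1 ->]]]] [n2 [t2 [B2 [mB2 ->]]]].
pose f1 (x : (n1 + n2).-tuple S) := [tuple tnth x (lshift n2 i) | i < n1].
pose f2 (x : (n1 + n2).-tuple S) := [tuple tnth x (rshift n1 i) | i < n2].
exists (n1 + n2)%N, (cat_tuple t1 t2), (f1 @^-1` B1 `&` f2 @^-1` B2); split.
  have m1 : measurable_fun setT f1.
    apply/measurable_fun_tnthP => i; rewrite (_ : _ \o _ = fun x => tnth x (lshift n2 i)).
      exact: measurable_tnth.
    by apply/funext => x /=; rewrite tnth_mktuple.
  have m2 : measurable_fun setT f2.
    apply/measurable_fun_tnthP => i; rewrite (_ : _ \o _ = fun x => tnth x (rshift n1 i)).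
      exact: measurable_tnth.
    by apply/funext => x /=; rewrite tnth_mktuple.
  by apply: measurableI; rewrite -[X in measurable X]setTI; [exact: m1|exact: m2].
apply/seteqP; split => z /=.
  have -> : f1 [tuple z (tnth (cat_tuple t1 t2) i) | i < n1 + n2] = [tuple z (tnth t1 i) | i < n1].
    by apply: eq_from_tnth => i; rewrite !tnth_mktuple tnth_lshift.
  suff -> : f2 [tuple z (tnth (cat_tuple t1 t2) i) | i < n1 + n2] = [tuple z (tnth t2 i) | i < n2] by [].
  by apply: eq_from_tnth => i; rewrite !tnth_mktuple tnth_rshift.
have -> : f1 [tuple z (tnth (cat_tuple t1 t2) i) | i < n1 + n2] = [tuple z (tnth t1 i) | i < n1].
  by apply: eq_from_tnth => i; rewrite !tnth_mktuple tnth_lshift.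
suff -> : f2 [tuple z (tnth (cat_tuple t1 t2) i) | i < n1 + n2] = [tuple z (tnth t2 i) | i < n2] by [].
by apply: eq_from_tnth => i; rewrite !tnth_mktuple tnth_rshift.
Qed.

Lemma measurable_path t A : <<s cylinders (S := S) setT >> A -> measurable (path Z t @^-1` A).
Proof.
move=> cA; apply: (sigZ_measurable (I := setT) mZ).
by apply: path_sigZ cA => //.
Qed.

Lemma fdd_cylinders : <<s cylinders (S := S) setT >> = <<s fdd_sets >>.
Proof.
apply/seteqP; split; apply: smallest_sub; try exact: smallest_sigma_algebra.
  move=> _ [i _ [B mB <-]]; apply: sub_sigma_algebra.
  exists 1%N, [tuple i], (fun x : 1.-tuple S => B (tnth x ord0)); split.
    by have := @measurable_tnth _ S 1 ord0 measurableT B mB; rewrite setTI.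
  by rewrite setTI; apply/seteqP; split => z /=; rewrite tnth_mktuple.
move=> _ [n [ts [B [mB ->]]]].
pose PT := g_sigma_algebraType (cylinders (S := S) setT).
have mf : measurable_fun [set: PT] (fun z : PT => [tuple z (tnth ts i) | i < n] : n.-tuple S).
  apply/measurable_fun_tnthP => i.
  rewrite (_ : _ \o _ = fun z : PT => z (tnth ts i)); last first.
    by apply/funext => z /=; rewrite tnth_mktuple.
  move=> _ C mC; apply: sub_sigma_algebra; exists (tnth ts i) => //.
  by exists C.
by have := mf measurableT B mB; rewrite setTI.
Qed.

(** Stationarity is given for finitely many coordinates. Such events are stable under intersection
    and generate the path sigma-algebra, so Dynkin's argument extends it to whole paths. *)
Lemma path_law t A : <<s cylinders (S := S) setT >> A ->
  P (path Z t @^-1` A) = P (path Z 0 @^-1` A).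
Proof.
rewrite fdd_cylinders.
move: A; apply: (@dynkin_induction _ (g_sigma_algebraType (cylinders (S := S) setT)) fdd_sets
  (fun A => P (path Z t @^-1` A) = P (path Z 0 @^-1` A))) => //.
- exact: fdd_cylinders.
- exact: fdd_setI.
- move=> _ [n [ts [B [mB ->]]]].
  have := stZ ts t mB.
  rewrite (_ : [set w | _] = path Z t @^-1` [set z | B [tuple z (tnth ts i) | i < n]]); last first.
    apply/seteqP; split => w /=; rewrite (_ : [tuple Z (tnth ts i + t) w | i < n] = [tuple path Z t w (tnth ts i) | i < n])//;
    by apply: eq_from_tnth => i; rewrite !tnth_mktuple /path addrC.
  move=> ->; congr (P _); apply/seteqP; split => w /=.
    rewrite (_ : [tuple path Z 0 w (tnth ts i) | i < n] = [tuple Z (tnth ts i) w | i < n])//.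
    by apply: eq_from_tnth => i; rewrite !tnth_mktuple /path add0r.
  rewrite (_ : [tuple path Z 0 w (tnth ts i) | i < n] = [tuple Z (tnth ts i) w | i < n])//.
  by apply: eq_from_tnth => i; rewrite !tnth_mktuple /path add0r.
- move=> B mB IH.
  have e s : P (path Z s @^-1` (~` B)) = (1 - P (path Z s @^-1` B))%E.
    by rewrite preimage_setC; apply: probability_setC; exact: measurable_path.
  by rewrite (e t) (e 0) IH.
- move=> F mF tF IH.
  have e s : P (path Z s @^-1` (\bigcup_k F k)) = (\sum_(k <oo) P (path Z s @^-1` (F k)))%E.
    rewrite preimage_bigcup; apply: measure_semi_bigcup.
    + by move=> n; apply: measurable_path => //; exact: mF.
    + by apply/trivIsetP => i j _ _ ij; move/trivIsetP : tF => /(_ i j Logic.I Logic.I ij) tF; rewrite -preimage_setI tF preimage_set0.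
    + by apply: bigcupT_measurable => n; apply: measurable_path => //; exact: mF.
  by rewrite (e t) (e 0); apply: eq_eseriesr => n _; exact: IH.
Qed.

End path_law.

Section countably_valued.
Context {d : measure_display} {T : measurableType d}.

Lemma measurable_fun_fibers (k : T -> nat) :
  (forall j, measurable (k @^-1` [set j])) -> measurable_fun setT k.
Proof.
move=> mk _ B _; rewrite setTI.
rewrite (_ : _ @^-1` _ = \bigcup_(j in B) (k @^-1` [set j])).
  by apply: bigcup_measurable => j _.
by apply/seteqP; split => [w Bw|w [j Bj /= ->]//]; exists (k w).
Qed.

End countably_valued.

Section path_functions.
Context {R : realType} {dS : measure_display} {S : measurableType dS}.
Context {d : measure_display} {T : measurableType d}.
Variables (P : probability T R) (Z : int -> T -> S).
Hypothesis mZ : forall t, measurable_fun setT (Z t).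
Hypothesis stZ : stationary P Z.

Let PT := g_sigma_algebraType (cylinders (S := S) setT).

Lemma measurable_fun_path t : measurable_fun setT (path Z t : T -> PT).
Proof. by move=> _ A cA; rewrite setTI; exact: measurable_path. Qed.

Lemma path_integral (F : PT -> R) t : measurable_fun setT F -> (forall z, 0 <= F z) ->
  (\int[P]_w (F (path Z t w))%:E = \int[P]_w (F (path Z 0 w))%:E)%E.
Proof.
move=> mF F0.
have mU s : measurable_fun setT (fun w => F (path Z s w)).
  by apply: (measurableT_comp mF); exact: measurable_fun_path.
(* Writing [|x|] makes the integrand nonnegative on the whole line, as the transport formula
   requires; as [F >= 0], nothing changes. *)
have pf s : (\int[P]_w (F (path Z s w))%:E = \int[pushforward P (fun w => F (path Z s w))]_x `|x|%:E)%E.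
  rewrite (ge0_integral_pushforward (mU s) P measurableT (f := fun x : R => `|x|%:E))//.
  - by apply: eq_integral => w _ /=; rewrite ger0_norm.
  - by apply/measurable_EFinP; exact: normr_measurable.
rewrite (pf t) (pf 0); apply: eq_measure_integral => A mA _.
rewrite /pushforward.
have cA : <<s cylinders setT >> (F @^-1` A) by have := mF measurableT A mA; rewrite setTI.
exact: (path_law mZ stZ t cA).
Qed.

Lemma path_Rintegral (F : PT -> R) t : measurable_fun setT F -> (forall z, 0 <= F z) ->
  \int[P]_w F (path Z t w) = \int[P]_w F (path Z 0 w).
Proof. by move=> mF F0; rewrite /Rintegral path_integral. Qed.

(** The path events given by [sigZ_lift] are pinned down only on the image of [path Z 0]; elsewhere
    they may overlap or leave paths uncovered. Uncovered paths go to cell 0, and overlaps are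
    resolved by the least index. *)
Lemma nat_lift (I : set int) (k : T -> nat) : (forall j, sigZ Z I (k @^-1` [set j])) ->
  exists2 k' : (int -> S) -> nat, (forall j, <<s cylinders I >> (k' @^-1` [set j])) &
    forall w, k w = k' (path Z 0 w).
Proof.
move=> sk.
have /choice[A hA] : forall j, exists A, <<s cylinders I >> A /\ k @^-1` [set j] = path Z 0 @^-1` A.
  by move=> j; have [A cA eA] := sigZ_lift (sk j); exists A.
pose PI := g_sigma_algebraType (cylinders (S := S) I).
pose B (j : nat) : set PI := if j is 0 then A 0%N `|` ~` \bigcup_i A i else A j.
have mA j : measurable (A j : set PI) by case: (hA j).
have mB j : measurable (B j).
  case: j => [|j] //=; apply: measurableU => //; apply: measurableC.
  exact: bigcupT_measurable.
have exB z : exists j, `[< B j z >].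
  have [[i _ Ai]|nA] := pselect ((\bigcup_i A i) z).
    by exists i; apply/asboolP; case: i Ai => [|i] Ai //; left.
  by exists 0%N; apply/asboolP; right.
have BA j w : B j (path Z 0 w) <-> k w = j.
  have Ak i : A i (path Z 0 w) <-> k w = i.
    by have [_ /seteqP[h1 h2]] := hA i; split => [/h2|/h1].
  case: j => [|j] /=; last exact: Ak.
  split=> [[/Ak//|[]]|/Ak]; last by left.
  by exists (k w) => //; exact/Ak.
exists (fun z => ex_minn (exB z)).
  move=> j; suff -> : (fun z => ex_minn (exB z)) @^-1` [set j] = B j `\` \bigcup_(i in [set i | (i < j)%N]) B i.
    apply: (@measurableD _ PI); first exact: mB.
    by apply: (@bigcup_measurable _ PI) => i _; exact: mB.
  apply/seteqP; split => z /=.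
    case: ex_minnP => i /asboolP Bi mini <-; split => // -[l /= li Bl].
    by have := mini l (asboolT Bl); rewrite leqNgt li.
  move=> [Bj nB]; case: ex_minnP => i /asboolP Bi mini.
  apply/eqP; rewrite eqn_leq mini ?andTb//=; last exact/asboolP.
  by rewrite leqNgt; apply/negP => ij; apply: nB; exists i.
move=> w; case: ex_minnP => i /asboolP/BA -> _ //.
Qed.

(** Rounding [g] down to the mesh [e] costs [e] and makes it countably valued. It can then be lifted
    to the path space and evaluated at any time with the same error, and its cells are those on
    which the copy is built. *)
Lemma cond_exp_lift (I : set int) (f : PT -> R) (g : T -> R) (a e : R) :
  measurable_fun setT f -> 0 < e ->
  (forall B : set R, measurable B -> sigZ Z I (g @^-1` B)) ->
  (\int[P]_w `|f (path Z 0 w) - g w|%:E <= a%:E)%E ->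
  exists (k : (int -> S) -> nat) (psi : nat -> R),
   (forall j, <<s cylinders I >> (k @^-1` [set j])) /\
   forall t, (\int[P]_w `|f (path Z t w) - psi (k (path Z t w))|%:E <= (a + e)%:E)%E.
Proof.
move=> mf e0 mg fga.
pose q (x : R) : int := Num.floor (x / e).
pose psi (j : nat) : R := (odflt 0 (unpickle j : option int))%:~R * e.
have qe x : `|x - psi (pickle (q x))| <= e.
  rewrite /psi pickleK/= /q.
  have := floor_le (x / e); have := floorD1_gt (x / e).
  rewrite intrD ltr_pdivrMr// mulrDl mul1r ler_pdivlMr// => h1 h2.
  by rewrite ger0_norm ?subr_ge0// lerBlDl ltW.
have mq (j : nat) : measurable [set x : R | pickle (q x) = j].
  have [i|nj] := pselect (exists i : int, pickle i = j); last first.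
    rewrite (_ : [set _ | _] = set0)//; apply/seteqP; split => x //= xj.
    by apply: nj; exists (q x).
  move: i => [i <-].
  rewrite (_ : [set _ | _] = `[i%:~R * e, (i + 1)%:~R * e[%classic)//.
  apply/seteqP; split => x /=; rewrite in_itv/= -ler_pdivlMr// -ltr_pdivrMr//.
    move=> /(pcan_inj pickleK) <-.
    by rewrite /q floor_le floorD1_gt.
  by move=> h; congr pickle; exact: floor_def.
have [k' mk' kk'] : exists2 k' : (int -> S) -> nat, (forall j, <<s cylinders I >> (k' @^-1` [set j])) &
    forall w, pickle (q (g w)) = k' (path Z 0 w).
  by apply: nat_lift => j; exact: (mg _ (mq j)).
exists k', psi; split => // t.
have mk : measurable_fun setT (k' : PT -> nat).
  by apply: measurable_fun_fibers => j; exact: cylinders_prod (mk' j).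
have mF : measurable_fun setT (fun z : PT => `|f z - psi (k' z)|).
  apply: measurableT_comp => //; apply: measurable_funB => //.
  by apply: (@measurableT_comp _ _ _ _ _ _ psi).
rewrite (path_integral (F := fun z => `|f z - psi (k' z)|) t mF)//.
have mg' : measurable_fun setT g.
  by move=> _ B mB; rewrite setTI; exact: sigZ_measurable (mg B mB).
have mf0 : measurable_fun setT (fun w => f (path Z 0 w)).
  by apply: (measurableT_comp mf); exact: measurable_fun_path.
have m1 : measurable_fun setT (fun w => `|f (path Z 0 w) - g w|%:E).
  apply/measurable_EFinP; apply: measurableT_comp => //; exact: measurable_funB.
apply: (@le_trans _ _ (\int[P]_w (`|f (path Z 0 w) - g w|%:E + e%:E))%E).
  apply: ge0_le_integral => //.
  - apply/measurable_EFinP; apply: (measurableT_comp mF); exact: measurable_fun_path.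
  - by apply: emeasurable_funD.
  - move=> w _; rewrite -EFinD lee_fin -kk'.
    by rewrite (le_trans (ler_distD (g w) _ _))// lerD2l.
rewrite ge0_integralD//; last by move=> w _; rewrite lee_fin ltW.
rewrite EFinD; apply: leeD => //.
by rewrite integral_cst// [X in (_ * X)%E]probability_setT mule1.
Qed.

End path_functions.

(** * Absolute regularity *)

Section window_functions.
Context {R : realType} {dS : measure_display} {S : measurableType dS}.
Context {d : measure_display} {T : measurableType d}.
Variable Z : int -> T -> S.
Hypothesis mZ : forall t, measurable_fun setT (Z t).

Definition window (a b : int) : set int := [set t | a <= t <= b].

Definition window_fun (a b : int) (f : T -> R) : Prop :=
  forall B : set R, measurable B -> sigZ Z (window a b) (f @^-1` B).

Let WT a b := g_sigma_algebraType
  (\bigcup_(i in window a b) preimage_set_system setT (Z i) measurable).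

Lemma window_funP a b f : window_fun a b f <-> measurable_fun setT (f : WT a b -> R).
Proof. by split=> [Wf _ B mB|mf B mB]; [rewrite setTI; exact: Wf|rewrite -[_ @^-1` _]setTI; exact: mf]. Qed.

Lemma window_fun_measurable a b f : window_fun a b f -> measurable_fun setT f.
Proof. by move=> Wf _ B mB; rewrite setTI; exact: sigZ_measurable (Wf B mB). Qed.

Lemma window_fun_cst a b c : window_fun a b (fun=> c).
Proof. exact/window_funP. Qed.

Lemma window_funD a b f g : window_fun a b f -> window_fun a b g ->
  window_fun a b (fun w => f w + g w).
Proof. by move=> /window_funP mf /window_funP mg; apply/window_funP; exact: measurable_funD. Qed.

Lemma window_fun_comp a b (h : R -> R) f : measurable_fun setT h -> window_fun a b f ->
  window_fun a b (fun w => h (f w)).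
Proof. by move=> mh /window_funP mf; apply/window_funP; exact: (measurableT_comp mh). Qed.

Lemma window_fun_mono (a b a' b' : int) f : a' <= a -> b <= b' ->
  window_fun a b f -> window_fun a' b' f.
Proof.
move=> aa bb Wf B mB; apply: sigZS (Wf B mB) => t /andP[at_ tb].
by apply/andP; split; [exact: le_trans at_|exact: le_trans bb].
Qed.

End window_functions.

Section mixing.
Context {R : realType} {dS : measure_display} {S : measurableType dS}.
Context {d : measure_display} {T : measurableType d}.
Variables (P : probability T R) (Z : int -> T -> S) (beta : nat -> R).
Hypothesis mZ : forall t, measurable_fun setT (Z t).
Hypothesis stZ : stationary P Z.
Hypothesis betaE : forall k, beta_coef P Z k = (beta k)%:E.

Lemma beta_partition_le (n k I J : nat) (A : 'I_I -> set T) (B : 'I_J -> set T) :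
  fin_partition (sigZ Z [set t : int | (1 <= t <= n%:Z)%R]) A ->
  fin_partition (sigZ Z [set t : int | (n%:Z + k%:Z <= t)%R]) B ->
  \sum_i \sum_j `|fine (P (A i `&` B j)) - fine (P (A i)) * fine (P (B j))| <= beta k.
Proof.
move=> pA pB; rewrite -lee_fin -betaE.
have mA i : measurable (A i) by exact: sigZ_measurable (pA.1 i).
have mB i : measurable (B i) by exact: sigZ_measurable (pB.1 i).
rewrite (_ : _%:E = (\sum_(i < I) \sum_(j < J) `|P (A i `&` B j) - P (A i) * P (B j)|)%E).
  by apply: ereal_sup_ubound; exists n, I, J, A, B.
rewrite -sumEFin; apply: eq_bigr => i _; rewrite -sumEFin; apply: eq_bigr => j _.
have pf C : measurable C -> P C = (fine (P C))%:E.
  by move=> mC; rewrite fineK// fin_num_measure.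
by rewrite [in RHS](pf _ (mA i)) [in RHS](pf _ (mB j)) [in RHS](pf _ (measurableI _ _ (mA i) (mB j))).
Qed.

Lemma beta_ge0 k : 0 <= beta k.
Proof.
have : \sum_(i < 1) \sum_(j < 1) `|fine (P (setT `&` setT)) - fine (P setT) * fine (P setT)| <= beta k.
  have part (F : set (set T)) : F setT -> fin_partition F ((fun=> setT) : 'I_1 -> set T).
    move=> FT; split=> //; split; last by rewrite big_ord_recl big_ord0 setU0.
    by move=> i j; rewrite !ord1 eqxx.
  apply: (@beta_partition_le 0 k 1 1 (fun=> setT) (fun=> setT)); apply: part;
    exact: (@measurableT _ (g_sigma_algebraType _)).
by apply: le_trans; apply: sumr_ge0 => i _; apply: sumr_ge0.
Qed.

Lemma fibers_partition (F : set (set T)) (k : T -> nat) (I : nat) :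
  (forall w, (k w < I)%N) -> (forall i, F (k @^-1` [set i])) ->
  fin_partition F (fun i : 'I_I => k @^-1` [set (i : nat)]).
Proof.
move=> kI Fk; split; first by [].
split=> [i j ij|].
  apply/seteqP; split => w //= [-> /val_inj e]; by rewrite e eqxx in ij.
apply/seteqP; split => w //= _.
by rewrite (bigD1 (Ordinal (kI w)))//=; left.
Qed.

Lemma joint_expectation (k1 k2 : T -> nat) (I J : nat) (f g : nat -> R) :
  measurable_fun setT k1 -> measurable_fun setT k2 ->
  (forall w, (k1 w < I)%N) -> (forall w, (k2 w < J)%N) ->
  \int[P]_w (f (k1 w) * g (k2 w)) = \sum_(i < I) \sum_(j < J) f i * g j *
     fine (P (k1 @^-1` [set (i : nat)] `&` k2 @^-1` [set (j : nat)])).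
Proof.
move=> m1 m2 k1I k2J.
have mb i j : measurable [set w | (k1 w == i) && (k2 w == j)].
  apply: (@measurable_bool_set _ T (fun w => (k1 w == i) && (k2 w == j))).
  by apply: measurable_and; exact: measurable_fun_eqn.
transitivity (\int[P]_w (\sum_(i < I) \sum_(j < J) f i * g j * (if (k1 w == i) && (k2 w == j) then 1 else 0))).
  apply: eq_Rintegral => w _.
  rewrite (bigD1 (Ordinal (k1I w)))//= (bigD1 (Ordinal (k2J w)))//= !eqxx mulr1.
  rewrite big1 ?addr0 => [|j jk]; last first.
    by rewrite eq_sym [_ == _ :> nat](_ : _ = false) ?mulr0//; apply: contraNF jk => /eqP e; exact/eqP/val_inj.
  rewrite big1 ?addr0// => i ik; rewrite big1// => j _.
  rewrite [k1 w == i](_ : _ = false) ?mulr0//; apply: contraNF ik => /eqP e; exact/eqP/val_inj.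
have bij (i j : nat) : bdm (fun w => f i * g j * (if (k1 w == i) && (k2 w == j) then 1 else 0) : R).
  by apply: bdmM; [exact: bdm_cst|exact: bdm_if].
rewrite Ex_sum => [|i _]; last by apply: bdm_sum => j _; exact: bij.
apply: eq_bigr => i _; rewrite Ex_sum => [|j _]; last exact: bij.
apply: eq_bigr => j _; rewrite ExZ; last exact: bdm_if.
congr (_ * _); rewrite Ex_if//; congr (fine (P _)).
by apply/seteqP; split => w /=; [move=> /andP[/eqP -> /eqP ->]|move=> [-> ->]; rewrite !eqxx].
Qed.

Lemma single_expectation (k1 : T -> nat) (I : nat) (f : nat -> R) :
  measurable_fun setT k1 -> (forall w, (k1 w < I)%N) ->
  \int[P]_w (f (k1 w)) = \sum_(i < I) f i * fine (P (k1 @^-1` [set (i : nat)])).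
Proof.
move=> m1 k1I.
have := @joint_expectation k1 (fun=> 0%N) I 1 f (fun=> 1) m1 (measurable_cst _) k1I (fun=> isT).
under eq_Rintegral do rewrite mulr1.
move=> ->; apply: eq_bigr => i _; rewrite big_ord_recl big_ord0 addr0 mulr1.
by congr (_ * fine (P _)); apply/seteqP; split => w //= [].
Qed.

(** For functions of finite partitions the covariance is a combination of the differences between
    the probabilities of intersections and the products of probabilities, with coefficients at most
    [A * B]. The sum of the absolute differences is bounded by [beta k]. *)
Lemma mixing_countable (a b c e : int) (k : nat) (k1 k2 : T -> nat) (I J : nat)
    (f g : nat -> R) (A B : R) :
  (forall w, (k1 w < I.+1)%N) -> (forall w, (k2 w < J.+1)%N) ->
  (forall i, sigZ Z (window a b) (k1 @^-1` [set i])) ->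
  (forall i, sigZ Z (window c e) (k2 @^-1` [set i])) ->
  b + k%:Z <= c -> 0 <= A -> 0 <= B ->
  (forall i, (i < I.+1)%N -> `|f i| <= A) -> (forall i, (i < J.+1)%N -> `|g i| <= B) ->
  `|\int[P]_w (f (k1 w) * g (k2 w)) - (\int[P]_w f (k1 w)) * (\int[P]_w g (k2 w))| <= A * B * beta k.
Proof.
move=> k1I k2J s1 s2 bc A0 B0 fA gB.
have [h1 ch1 kh1] := nat_lift s1; have [h2 ch2 kh2] := nat_lift s2.
(* [beta_coef] only compares the past [[1, n]] with the future from [n + k] on. The shift by
   [s >= 1 - a] moves the first window to the right of 0, and [s >= - b] makes [n = b + s] a natural
   number even for an empty window. *)
pose s : int := Num.max (1 - a) (- b).
have [n bsn] : exists n : nat, b + s = n%:Z.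
  have b0 : 0 <= b + s by rewrite /s; lia.
  by exists (absz (b + s)); rewrite gez0_abs.
pose x1 w := minn (h1 (path Z s w)) I; pose x2 w := minn (h2 (path Z s w)) J.
(* Off the image of [path Z 0] the lifts need not be bounded. The truncation keeps the partitions at
   time [s] finite and changes nothing at time 0. *)
pose H1 z := minn (h1 z) I; pose H2 z := minn (h2 z) J.
have minn_fib (h : (int -> S) -> nat) (L : nat) (N : set int) :
   (forall j, <<s cylinders N >> (h @^-1` [set j])) ->
   forall j, <<s cylinders N >> ((fun z => minn (h z) L) @^-1` [set j]).
  move=> ch j; pose PN := g_sigma_algebraType (cylinders (S := S) N).
  have mh : measurable_fun setT (h : PN -> nat) by apply: measurable_fun_fibers.
  have mm : measurable_fun setT (fun z : PN => minn (h z) L).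
    by apply: (@measurableT_comp _ _ _ _ _ _ (fun i => minn i L)).
  by have := mm measurableT [set j] Logic.I; rewrite setTI.
have cH1 := minn_fib h1 I _ ch1; have cH2 := minn_fib h2 J _ ch2.
have k1E w : k1 w = H1 (path Z 0 w).
  by rewrite /H1 -kh1; apply/esym/minn_idPl; rewrite -ltnS.
have k2E w : k2 w = H2 (path Z 0 w).
  by rewrite /H2 -kh2; apply/esym/minn_idPl; rewrite -ltnS.
have mfib (H : (int -> S) -> nat) (N : set int) t :
    (forall j, <<s cylinders N >> (H @^-1` [set j])) -> measurable_fun setT (fun w => H (path Z t w)).
  move=> cH; apply: measurable_fun_fibers => j.
  exact: (measurable_path mZ t (cylinders_prod (cH j))).
have m1 t := mfib _ _ t cH1; have m2 t := mfib _ _ t cH2.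
have H1I t w : (H1 (path Z t w) < I.+1)%N by rewrite ltnS geq_minr.
have H2J t w : (H2 (path Z t w) < J.+1)%N by rewrite ltnS geq_minr.
have law1 i t : P ((fun w => H1 (path Z t w)) @^-1` [set i]) = P ((fun w => H1 (path Z 0 w)) @^-1` [set i]).
  exact: (path_law mZ stZ t (cylinders_prod (cH1 i))).
have law2 i t : P ((fun w => H2 (path Z t w)) @^-1` [set i]) = P ((fun w => H2 (path Z 0 w)) @^-1` [set i]).
  exact: (path_law mZ stZ t (cylinders_prod (cH2 i))).
have law12 i j t : P ((fun w => H1 (path Z t w)) @^-1` [set i] `&` (fun w => H2 (path Z t w)) @^-1` [set j]) =
    P ((fun w => H1 (path Z 0 w)) @^-1` [set i] `&` (fun w => H2 (path Z 0 w)) @^-1` [set j]).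
  apply: (path_law mZ stZ t (A := H1 @^-1` [set i] `&` H2 @^-1` [set j])).
  apply: (@measurableI _ (g_sigma_algebraType (cylinders (S := S) setT))); exact: cylinders_prod (_ : <<s cylinders _ >> _).
have -> : \int[P]_w (f (k1 w) * g (k2 w)) =
    \int[P]_w (f (H1 (path Z s w)) * g (H2 (path Z s w))).
  under eq_Rintegral do rewrite k1E k2E.
  rewrite (joint_expectation f g (m1 0) (m2 0) (H1I 0) (H2J 0)).
  rewrite (joint_expectation f g (m1 s) (m2 s) (H1I s) (H2J s)).
  by apply: eq_bigr => i _; apply: eq_bigr => j _; rewrite (law12 i j s).
have -> : \int[P]_w f (k1 w) = \int[P]_w f (H1 (path Z s w)).
  under eq_Rintegral do rewrite k1E.
  rewrite (single_expectation f (m1 0) (H1I 0)) (single_expectation f (m1 s) (H1I s)).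
  by apply: eq_bigr => i _; rewrite (law1 i s).
have -> : \int[P]_w g (k2 w) = \int[P]_w g (H2 (path Z s w)).
  under eq_Rintegral do rewrite k2E.
  rewrite (single_expectation g (m2 0) (H2J 0)) (single_expectation g (m2 s) (H2J s)).
  by apply: eq_bigr => i _; rewrite (law2 i s).
rewrite (joint_expectation f g (m1 s) (m2 s) (H1I s) (H2J s)).
rewrite (single_expectation f (m1 s) (H1I s)) (single_expectation g (m2 s) (H2J s)).
rewrite mulr_suml -sumrB.
have := @beta_partition_le n k I.+1 J.+1
  (fun i => (fun w => H1 (path Z s w)) @^-1` [set (i : nat)])
  (fun i => (fun w => H2 (path Z s w)) @^-1` [set (i : nat)]).
move=> bp; apply: (@le_trans _ _ (A * B * \sum_(i < I.+1) \sum_(j < J.+1)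
  `|fine (P ((fun w => H1 (path Z s w)) @^-1` [set (i : nat)] `&` (fun w => H2 (path Z s w)) @^-1` [set (j : nat)]))
   - fine (P ((fun w => H1 (path Z s w)) @^-1` [set (i : nat)])) * fine (P ((fun w => H2 (path Z s w)) @^-1` [set (j : nat)]))|)); last first.
  apply: ler_wpM2l; first exact: mulr_ge0.
  apply: bp; apply: fibers_partition => //.
    move=> i; apply: path_sigZ (cH1 i) => t /andP[at_ tb]; apply/andP; split; rewrite /s in bsn *; lia.
  move=> i; apply: path_sigZ (cH2 i) => t /andP[ct te]; rewrite /=; lia.
rewrite (le_trans (ler_norm_sum _ _ _))// mulr_sumr; apply: ler_sum => i _.
rewrite mulr_sumr -sumrB (le_trans (ler_norm_sum _ _ _))// mulr_sumr; apply: ler_sum => j _.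
rewrite (_ : _ - _ = f i * g j * (fine (P ((fun w => H1 (path Z s w)) @^-1` [set (i : nat)] `&` (fun w => H2 (path Z s w)) @^-1` [set (j : nat)]))
   - fine (P ((fun w => H1 (path Z s w)) @^-1` [set (i : nat)])) * fine (P ((fun w => H2 (path Z s w)) @^-1` [set (j : nat)])))); last by ring.
rewrite normrM ler_wpM2r// normrM ler_pM//; [exact: fA|exact: gB].
Qed.

(** The mesh starts at [- A] and [f] is rounded down to left endpoints, so the new values stay in
    [[- A, A]] and the same bound serves after quantization. *)
Lemma quantize (a b : int) (f : T -> R) (A e : R) : 0 < e -> 
  window_fun Z a b f -> (forall w, `|f w| <= A) ->
  exists (k : T -> nat) (I : nat) (phi : nat -> R),
    [/\ (forall w, (k w < I.+1)%N), (forall i, sigZ Z (window a b) (k @^-1` [set i])),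
      (forall i, (i < I.+1)%N -> `|phi i| <= A) & forall w, `|f w - phi (k w)| <= e].
Proof.
move=> e0 Wf fA.
pose k w := Num.trunc ((f w + A) / e).
have x0 w : 0 <= (f w + A) / e.
  rewrite divr_ge0 ?(ltW e0)//; have := fA w; rewrite ler_norml => /andP[]; lra.
exists k, (Num.trunc (2 * A / e)), (fun i => i%:R * e - A); split.
- move=> w; rewrite ltnS le_truncn// ler_wpM2r ?invr_ge0 ?(ltW e0)//.
  have := fA w; rewrite ler_norml => /andP[]; lra.
- move=> i.
  rewrite (_ : _ @^-1` _ = f @^-1` `[i%:R * e - A, i.+1%:R * e - A[%classic).
    exact: Wf.
  have h w : (k w == i) = (i%:R * e - A <= f w < i.+1%:R * e - A).
    by rewrite truncn_eq// lerBlDr ltrBrDr ler_pdivlMr// ltr_pdivrMr.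
  apply/seteqP; split => w /=; rewrite in_itv/= -h; first by move=> ->.
  by move/eqP.
- move=> i; rewrite ltnS => iA.
  have A0 : 0 <= 2 * A / e.
    have := x0; have [w] : exists w : T, True by exists point.
    move=> _ _; rewrite divr_ge0 ?(ltW e0)// mulr_ge0//.
    by rewrite (le_trans _ (fA point)).
  have : i%:R <= 2 * A / e by rewrite -truncn_ge_nat.
  rewrite ler_pdivlMr// => h; rewrite ler_norml.
  have : 0 <= i%:R * e by rewrite mulr_ge0// ltW.
  move=> h0; apply/andP; split; lra.
- move=> w; have /andP[h1 h2] := truncn_itv (x0 w).
  move: h1 h2; rewrite ler_pdivlMr// ltr_pdivrMr// -/(k w).
  move: (k w) => kw; rewrite -natr1 mulrDl mul1r => h1 h2.
  rewrite ler_norml; apply/andP; split; lra.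
Qed.

Lemma mixing_bounded (a b c e : int) (k : nat) (f g : T -> R) (A B : R) :
  window_fun Z a b f -> window_fun Z c e g -> b + k%:Z <= c ->
  (forall w, `|f w| <= A) -> (forall w, `|g w| <= B) ->
  `|\int[P]_w (f w * g w) - (\int[P]_w f w) * (\int[P]_w g w)| <= A * B * beta k.
Proof.
move=> Wf Wg bc fA gB.
have A0 : 0 <= A by rewrite (le_trans _ (fA point)).
have B0 : 0 <= B by rewrite (le_trans _ (gB point)).
apply/ler_addgt0Pr => eps eps0.
(* Replacing both functions costs [q * (A + B)] in the mean of the product and as much again in the
   product of the means; the summand 1 keeps the denominator positive. *)
pose q := eps / (2 * (A + B + 1)).
have AB : 0 < 2 * (A + B + 1) by rewrite mulr_gt0// ltr_wpDl// addr_ge0.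
have q0 : 0 < q by rewrite divr_gt0.
have [k1 [I [f1 [k1I s1 f1A ff1]]]] := quantize q0 Wf fA.
have [k2 [J [g1 [k2J s2 g1B gg1]]]] := quantize q0 Wg gB.
have mix := mixing_countable k1I k2J s1 s2 bc A0 B0 f1A g1B.
have mk1 : measurable_fun setT k1.
  by apply: measurable_fun_fibers => i; exact: sigZ_measurable (s1 i).
have mk2 : measurable_fun setT k2.
  by apply: measurable_fun_fibers => i; exact: sigZ_measurable (s2 i).
have bf : bdm f by split; [exact: window_fun_measurable Wf|exists A].
have bg : bdm g by split; [exact: window_fun_measurable Wg|exists B].
have bf1 : bdm (fun w => f1 (k1 w)).
  by split; [apply: (@measurableT_comp _ _ _ _ _ _ f1)|exists A => w; exact: f1A].
have bg1 : bdm (fun w => g1 (k2 w)).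
  by split; [apply: (@measurableT_comp _ _ _ _ _ _ g1)|exists B => w; exact: g1B].
have d1 : `|\int[P]_w f w - \int[P]_w f1 (k1 w)| <= q.
  rewrite -[q](Ex_cst P); apply: Ex_dist_le => //; exact: bdm_cst.
have d2 : `|\int[P]_w g w - \int[P]_w g1 (k2 w)| <= q.
  rewrite -[q](Ex_cst P); apply: Ex_dist_le => //; exact: bdm_cst.
have prodd (x y x' y' : R) : `|x| <= A -> `|y'| <= B -> `|x - x'| <= q -> `|y - y'| <= q ->
    `|x * y - x' * y'| <= q * (A + B).
  move=> xA yB xx yy; have -> : x * y - x' * y' = x * (y - y') + (x - x') * y' by ring.
  rewrite (le_trans (ler_normD _ _))// !normrM mulrDr lerD//.
    by rewrite mulrC ler_pM.
  by rewrite ler_pM.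
have d3 : `|\int[P]_w (f w * g w) - \int[P]_w (f1 (k1 w) * g1 (k2 w))| <= q * (A + B).
  rewrite -[leRHS](Ex_cst P); apply: Ex_dist_le; [exact: bdmM|exact: bdmM|exact: bdm_cst|].
  by move=> w; apply: prodd => //; exact: g1B.
have Ele (h : T -> R) (D : R) : bdm h -> (forall w, `|h w| <= D) -> `|\int[P]_w h w| <= D.
  by move=> bh hD; rewrite (le_trans (Ex_norm P bh))// Ex_le_cst//; exact: bdm_norm.
have d4 : `|(\int[P]_w f w) * (\int[P]_w g w) - (\int[P]_w f1 (k1 w)) * (\int[P]_w g1 (k2 w))| <= q * (A + B).
  by apply: prodd => //; apply: Ele => // w; exact: g1B.
have qe : 2 * (q * (A + B)) <= eps.
  rewrite mulrCA [leRHS](_ : _ = q * (2 * (A + B + 1))); last by rewrite /q mulfVK// gt_eqF.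
  by rewrite ler_pM2l// ler_pM2l// lerDl.
move: mix d3 d4 qe; rewrite !ler_norml => /andP[? ?] /andP[? ?] /andP[? ?] ?.
apply/andP; split; lra.
Qed.

End mixing.

Section kernel_windows.
Context {R : realType} {dS : measure_display} {S : measurableType dS}.
Context {d : measure_display} {T : measurableType d}.
Variables (P : probability T R) (Z : int -> T -> S).
Hypothesis mZ : forall t, measurable_fun setT (Z t).
Hypothesis stZ : stationary P Z.
Let PT := g_sigma_algebraType (cylinders (S := S) setT).
Variables (f : PT -> R) (a : nat -> R) (m : nat) (phi : R -> R).
Hypothesis mf : measurable_fun setT f.
Hypothesis approx : forall k : nat, exists g : T -> R,
  (forall B : set R, measurable B -> sigZ Z (window (- k%:Z) k%:Z) (g @^-1` B)) /\
  (\int[P]_w `|f (path Z 0 w) - g w|%:E <= (a k)%:E)%E.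

Definition increments (z : int -> S) : m.-1.-tuple R :=
  [tuple f (shift (i%:Z + 1) z) | i < m.-1].

Hypothesis hphi : one_continuous_witness P (fun w => increments (path Z 0 w)) phi.

Let measurable_shift t : measurable_fun setT (shift t : PT -> PT).
Proof. by move=> _ A cA; rewrite setTI; exact: (shift_cylinders (I := setT)) cA. Qed.

Lemma measurable_increments : measurable_fun setT (increments : PT -> _).
Proof.
apply/measurable_fun_tnthP => i.
rewrite (_ : _ \o _ = fun z : PT => f (shift (i%:Z + 1) z)).
  exact: (measurableT_comp mf).
by apply/funext => z /=; rewrite tnth_mktuple.
Qed.

(** The [i]-th increment sits at time [i + 1], so a window of radius [k - (i + 1)] around it stays
    inside [[- k, k]]: this is the origin of the shifted constants [a (k - i.+1)]. By [pickle] the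
    cells of all increments merge into a single number. *)
Lemma window_lift (k : nat) (e : R) : (m.-1 <= k)%N -> 0 < e ->
  exists (kap : (int -> S) -> nat) (psi : 'I_m.-1 -> nat -> R),
    (forall j, <<s cylinders (window (- k%:Z) k%:Z) >> (kap @^-1` [set j])) /\
    forall i, (\int[P]_w `|tnth (increments (path Z 0 w)) i - psi i (kap (path Z 0 w))|%:E <=
       (a (k - i.+1)%N + e)%:E)%E.
Proof.
move=> mk e0.
have /choice[kp hkp] : forall i : 'I_m.-1, exists kp : ((int -> S) -> nat) * (nat -> R),
   (forall j, <<s cylinders (window (- (k - i.+1)%N%:Z) (k - i.+1)%N%:Z) >> (kp.1 @^-1` [set j])) /\
   forall t, (\int[P]_w `|f (path Z t w) - kp.2 (kp.1 (path Z t w))|%:E <= (a (k - i.+1)%N + e)%:E)%E.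
  move=> i; have [g [mg fg]] := approx (k - i.+1)%N.
  by have [kk [ps h]] := cond_exp_lift mZ stZ mf e0 mg fg; exists (kk, ps).
pose tup (z : int -> S) := [tuple (kp i).1 (shift (i%:Z + 1) z) | i < m.-1].
pose kap z := pickle (tup z).
pose psi (i : 'I_m.-1) (j : nat) := (kp i).2 (if unpickle j is Some x then tnth (x : m.-1.-tuple nat) i else 0%N).
exists kap, psi; split => [j|i].
  have [[x xj]|nx] := pselect (exists x : m.-1.-tuple nat, pickle x = j); last first.
    rewrite (_ : _ @^-1` _ = set0); first exact: sigma_algebra0.
    by apply/seteqP; split => z //= zj; apply: nx; exists (tup z).
  rewrite (_ : _ @^-1` _ = \bigcap_(i in [set: 'I_m.-1])
     (shift (i%:Z + 1) @^-1` ((kp i).1 @^-1` [set tnth x i]))).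
    apply: (@fin_bigcap_measurable _ (g_sigma_algebraType (cylinders (window (- k%:Z) k%:Z)))) => //.
    move=> i _; apply: shift_cylinders ((hkp i).1 _) => t /andP[t1 t2].
    have := ltn_ord i => im; apply/andP; split; lia.
  apply/seteqP; split => z /=.
    move=> zj i _ /=; have <- : tup z = x by apply: (pcan_inj pickleK); rewrite xj.
    by rewrite tnth_mktuple.
  move=> h; rewrite /kap -xj; congr pickle; apply: eq_from_tnth => i.
  by rewrite tnth_mktuple; exact: h.
apply: le_trans ((hkp i).2 (i%:Z + 1)).
rewrite le_eqVlt; apply/orP; left; apply/eqP; apply: eq_integral => w _.
by rewrite /psi /kap pickleK !tnth_mktuple shift_path add0r.
Qed.

(** One [v] and one [kap] serve at all times: they are evaluated at the shifted path, and
    stationarity carries the estimate over from time 0. *)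
Lemma kernel_window_approx (k : nat) (e er : R) (c : 'I_(m`!)) : (m.-1 <= k)%N -> 0 < e -> 0 < er ->
  exists y : int -> T -> R, [/\ forall t, window_fun Z (t - k%:Z) (t + k%:Z) (y t),
    forall t w, `|y t w| <= 1 &
    forall t, \int[P]_w `|tnth (hOP (increments (path Z t w))) c - y t w| <=
      phi e + 2 * (\sum_(i < m.-1) (a (k - i.+1)%N + er)) / e].
Proof.
move=> mk e0 er0; have [kap [psi [ckap hpsi]]] := window_lift mk er0.
have mkap : measurable_fun setT (kap : PT -> nat).
  by apply: measurable_fun_fibers => j; exact: cylinders_prod (ckap j).
have mkapp t : measurable_fun setT (fun w => kap (path Z t w)).
  by apply: (measurableT_comp mkap); exact: measurable_fun_path.
pose K : {mfun T >-> nat} := HB.pack (fun w => kap (path Z 0 w))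
  (isMeasurableFun.Build _ _ _ _ _ (mkapp 0)).
have mV t : measurable_fun setT (fun w => increments (path Z t w)).
  apply: (measurableT_comp measurable_increments); exact: measurable_fun_path.
have [v [v1 hv]] := kernel_approx (mV 0) hphi (kap := K) hpsi c e0.
exists (fun t w => v (kap (path Z t w))); split => [t B mB|t w|t].
- pose PW := g_sigma_algebraType (cylinders (S := S) (window (- k%:Z) k%:Z)).
  have mvk : measurable_fun setT (fun z : PW => v (kap z)).
    apply: (@measurableT_comp _ _ _ _ _ _ v) => //.
    exact: (measurable_fun_fibers (T := PW)).
  have := mvk measurableT B mB; rewrite setTI.
  by apply: path_sigZ => i /andP[i1 i2]; apply/andP; split; lia.
- exact: v1.
apply: le_trans hv.
have bh t' : bdm (fun w => tnth (hOP (increments (path Z t' w))) c) by exact: bdm_hOP.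
have bv t' : bdm (fun w => v (kap (path Z t' w))).
  by split; [apply: (@measurableT_comp _ _ _ _ _ _ v)|exists 1].
have mF : measurable_fun setT (fun z : PT => `|tnth (hOP (increments z)) c - v (kap z)|).
  apply: measurableT_comp => //; apply: measurable_funB.
    exact: (bdm_hOP c measurable_increments).1.
  by apply: (@measurableT_comp _ _ _ _ _ _ v).
rewrite -lee_fin -!Ex_fin; last 2 first.
- by apply: bdm_norm; apply: bdmB; [exact: bh|exact: bv].
- by apply: bdm_norm; apply: bdmB; [exact: bh|exact: bv].
by rewrite (path_integral mZ stZ t mF).
Qed.

End kernel_windows.

(** * Gaussian vectors *)

Section gaussian_characteristic_function.
Context {R : realType}.
Local Notation mu := (@lebesgue_measure R).
Local Notation gam := (@normal_pdf R 0 1).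

Let gamE (y : R) : gam y = normal_peak 1 * expR (- (y ^+ 2 / 2)).
Proof.
rewrite normal_pdfE ?oner_neq0//= /normal_fun subr0 expr1n -mulr_natr mul1r.
by rewrite mulNr.
Qed.

Let gam0 (y : R) : 0 <= gam y. Proof. exact: normal_pdf_ge0. Qed.
Let mgam : measurable_fun setT gam. Proof. exact: measurable_normal_pdf. Qed.
Let igam : mu.-integrable setT (EFin \o gam).
Proof. exact: (integrable_normal_pdf 0 1). Qed.

Let dgam (y : R) : is_derive y 1 gam (- y * gam y).
Proof.
have -> : gam = (fun y => normal_peak 1 * expR (- (y ^+ 2 / 2))) by apply/funext => z; exact: gamE.
have de : is_derive y 1 (fun z : R => - (z ^+ 2 / 2)) (- y).
  rewrite (_ : (fun _ => _) = - (2^-1 *: (@id R) ^+ 2)); last first.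
    by apply/funext => z; rewrite !fctE/= [in RHS]/GRing.scale/= mulrC.
  apply: is_derive_eq; rewrite expr1 /GRing.scale/= mulr1 mulrA mulVf ?mul1r//.
have dc : is_derive y 1 (expR \o (fun z : R => - (z ^+ 2 / 2))) (expR (- (y ^+ 2 / 2)) * - y).
  exact: is_derive1_comp.
rewrite (_ : (fun _ => _) = normal_peak 1 *: (expR \o (fun z : R => - (z ^+ 2 / 2))))//.
by apply: is_derive_eq; rewrite /GRing.scale/= mulrA mulrC.
Qed.

Let mtrig (s b : R) (h : R -> R) : continuous h -> measurable_fun setT (fun y => h (s * y + b)).
Proof.
move=> ch; apply: (@measurableT_comp _ _ _ _ _ _ h); first exact: continuous_measurable_fun.
by apply: measurable_funD => //; apply: measurable_funM.
Qed.

Let iZ (C : R) (f : R -> R) : mu.-integrable setT (EFin \o f) ->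
  mu.-integrable setT (EFin \o (fun y => C * f y)).
Proof. by move=> fi; exact: (integrableZl measurableT C fi). Qed.

Let igam_le (f : R -> R) (C : R) : measurable_fun setT f -> (forall y, `|f y| <= C) ->
  mu.-integrable setT (EFin \o (fun y => f y * gam y)).
Proof.
move=> mf fC; have iC : mu.-integrable setT (EFin \o (fun y => C * gam y)).
  exact: iZ.
apply: (le_integrable measurableT _ _ iC).
  by apply/measurable_EFinP; exact: measurable_funM.
move=> y _; rewrite /= lee_fin !normrM ler_wpM2r//.
by rewrite (le_trans (fC y))// ler_norm.
Qed.

(** Since [|y| <= 1 + y ^+ 2 / 4 <= expR (y ^+ 2 / 4)], the normal density of variance 2 dominates
    up to a constant. *)
Let i1gam : mu.-integrable setT (EFin \o (fun y => `|y| * gam y)).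
Proof.
set t : R := Num.sqrt 2.
have t0 : t != 0 by rewrite gt_eqF// sqrtr_gt0.
have iC : mu.-integrable setT (EFin \o (fun y => normal_peak 1 / normal_peak t * normal_pdf 0 t y)).
  by apply: iZ; exact: (integrable_normal_pdf 0 t).
apply: (le_integrable measurableT _ _ iC).
  by apply/measurable_EFinP; apply: measurable_funM => //; exact: normr_measurable.
move=> y _; rewrite /= lee_fin [leRHS]ger0_norm; last first.
  by rewrite mulr_ge0 ?normal_pdf_ge0// divr_ge0// normal_peak_ge0.
rewrite ger0_norm; last by rewrite mulr_ge0.
rewrite gamE (normal_pdfE _ t0)/= mulrA divfK ?gt_eqF ?normal_peak_gt0//.
rewrite mulrCA ler_wpM2l ?normal_peak_ge0// /normal_fun subr0 sqr_sqrtr//.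
have -> : - (y ^+ 2 / 2) = (- y ^+ 2 / (2 *+ 2)) - y ^+ 2 / 4 by field.
rewrite expRD mulrCA ler_piMr ?expR_ge0// expRN ler_pdivrMr ?expR_gt0// mul1r.
apply: le_trans (expR_ge1Dx _).
rewrite -[y ^+ 2]real_normK ?num_real//; have : 0 <= (`|y| - 2) ^+ 2 by rewrite sqr_ge0.
rewrite sqrrB; lra.
Qed.

Let imul (f : R -> R) : measurable_fun setT f -> (forall y, `|f y| <= 1) ->
  mu.-integrable setT (EFin \o (fun y => y * f y * gam y)).
Proof.
move=> mf f1; apply: (le_integrable measurableT _ _ i1gam).
  by apply/measurable_EFinP; apply: measurable_funM => //; exact: measurable_funM.
move=> y _; rewrite /= lee_fin !normrM normr_id ler_wpM2r// ler_piMr//.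
Qed.

Let cos1 (x : R) : `|cos x| <= 1. Proof. by rewrite ler_norml cos_geN1 cos_le1. Qed.
Let sin1 (x : R) : `|sin x| <= 1. Proof. by rewrite ler_norml sin_geN1 sin_le1. Qed.

Variable b : R.
(** The phase [b] handles both transforms at once: [b = 0] gives the cosine and [b = - (pi / 2)] the
    sine. *)
Let F (s : R) := \int[mu]_y (cos (s * y + b) * gam y).

Let dlin (s y : R) : is_derive y 1 (fun z => s * z + b) s.
Proof.
rewrite (_ : (fun _ => _) = s *: (@id R) + cst b)//.
by apply: is_derive_eq; rewrite addr0 /GRing.scale/= mulr1.
Qed.

Let d1 (s y : R) : is_derive s 1 (fun s => cos (s * y + b) * gam y) (- (y * sin (s * y + b) * gam y)).
Proof.
have dl : is_derive s 1 (fun z => z * y + b) y.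
  rewrite (_ : (fun z => z * y + b) = (fun z => y * z + b)); first exact: dlin.
  by apply/funext => z; rewrite mulrC.
have dc : is_derive s 1 (cos \o (fun z : R => z * y + b)) (- sin (s * y + b) * y).
  exact: is_derive1_comp.
rewrite (_ : (fun _ => _) = gam y *: (cos \o (fun z : R => z * y + b))); last first.
  by apply/funext => z; rewrite /GRing.scale/= mulrC.
by apply: is_derive_eq; rewrite /GRing.scale/=; ring.
Qed.

Let dprim (s y : R) : is_derive y 1 (fun y => sin (s * y + b) * gam y)
  (s * (cos (s * y + b) * gam y) - y * sin (s * y + b) * gam y).
Proof.
have dc : is_derive y 1 (sin \o (fun z : R => s * z + b)) (cos (s * y + b) * s).
  exact: is_derive1_comp.
have dg := dgam y.
rewrite (_ : (fun _ => _) = (sin \o (fun z : R => s * z + b)) * gam)//.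
by apply: is_derive_eq; rewrite /GRing.scale/=; ring.
Qed.

Let prim (s y : R) := sin (s * y + b) * gam y.
Let dens (s y : R) := s * (cos (s * y + b) * gam y) - y * sin (s * y + b) * gam y.

Let ms (s : R) : measurable_fun setT (fun y => sin (s * y + b)).
Proof. by apply: mtrig; exact: continuous_sin. Qed.
Let mc (s : R) : measurable_fun setT (fun y => cos (s * y + b)).
Proof. by apply: mtrig; exact: continuous_cos. Qed.

Let icos (s : R) : mu.-integrable setT (EFin \o (fun y => cos (s * y + b) * gam y)).
Proof. exact: (igam_le (C := 1)). Qed.

Let iscos (s : R) : mu.-integrable setT (EFin \o (fun y => s * (cos (s * y + b) * gam y))).
Proof. exact: iZ (icos s). Qed.

Let isin (s : R) : mu.-integrable setT (EFin \o (fun y => y * sin (s * y + b) * gam y)).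
Proof. exact: imul. Qed.

Let idens (s : R) : mu.-integrable setT (EFin \o dens s).
Proof. by apply: (integrableB measurableT (iscos s) (isin s)). Qed.

Let cgam : continuous gam.
Proof. by apply: continuous_normal_pdf; exact: oner_neq0. Qed.

Let cprim (s : R) : continuous (prim s).
Proof.
move=> y; apply: differentiable_continuous; apply/derivable1_diffP.
by case: (dprim s y).
Qed.

Let clin (s : R) : continuous (fun y => s * y + b).
Proof.
move=> y; apply: differentiable_continuous; apply/derivable1_diffP.
by case: (dlin s y).
Qed.

Let cdens (s : R) : continuous (dens s).
Proof.
move=> y; apply: cvgB; first apply: cvgMr.
  apply: cvgM; last exact: cgam.
  by apply: continuous_cvg; [exact: continuous_cos|exact: clin].
apply: cvgM; last exact: cgam.
apply: cvgM; first exact: cvg_id.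
by apply: continuous_cvg; [exact: continuous_sin|exact: clin].
Qed.

Let segment_dens (s : R) (n : nat) : (\int[mu]_(y in `[(- n.+1%:R)%R, n.+1%:R%R]) (dens s y)%:E)%E =
  (prim s n.+1%:R - prim s (- n.+1%:R))%:E.
Proof.
rewrite (@continuous_FTC2 R (dens s) (prim s))// ?EFinB//.
- by rewrite (@lt_trans _ _ 0)// oppr_lt0.
- exact/continuous_subspaceT/cdens.
- split; [by move=> y _; case: (dprim s y)|exact/cvg_at_right_filter/cprim|exact/cvg_at_left_filter/cprim].
- by move=> y _; rewrite derive1E; case: (dprim s y) => _ h; exact: h.
Qed.

Let gam_vanish : (fun n : nat => gam n.+1%:R) @ \oo --> (0 : R).
Proof.
apply: (@squeeze_cvgr _ _ _ _ (cst 0) (fun n => normal_peak 1 * n.+1%:R^-1)).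
- apply: nearW => n; rewrite gam0/= gamE ler_wpM2l ?normal_peak_ge0// expRN.
  rewrite lef_pV2 ?posrE ?expR_gt0//; apply: le_trans (expR_ge1Dx _).
  have : 0 <= (n.+1%:R - 1 : R) ^+ 2 by rewrite sqr_ge0.
  rewrite sqrrB; move: (n.+1%:R : R) => x; lra.
- exact: cvg_cst.
- rewrite -[X in _ --> X](mulr0 (normal_peak (1 : R))); apply: cvgMr.
  exact: cvg_harmonic.
Qed.

(** [dens s] is the derivative of [prim s], which vanishes at infinity; by dominated convergence
    over growing segments its integral over the line is zero. *)
Let by_parts (s : R) : \int[mu]_y (y * sin (s * y + b) * gam y) = s * F s.
Proof.
apply/esym/eqP; rewrite -subr_eq0 /F -(RintegralZl s measurableT (icos s)).
rewrite -(RintegralB measurableT (iscos s) (isin s)).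
apply/eqP; rewrite -/(dens s).
pose f_ (n : nat) y := ((dens s \_ `[- n.+1%:R, n.+1%:R]) y)%:E.
have mdens : measurable_fun setT (dens s) by have /integrableP[/measurable_EFinP] := idens s.
have mf_ n : measurable_fun setT (f_ n).
  apply/measurable_EFinP; apply/(measurable_restrictT (dens s)) => //.
  exact: measurable_funTS.
have [] := @dominated_convergence _ _ _ mu setT measurableT f_ (EFin \o dens s) (abse \o (EFin \o dens s)).
- exact: mf_.
- exact/measurable_EFinP.
- apply: aeW => x _; apply: cvg_near_cst.
  exists (Num.trunc `|x|) => // n /= xn; rewrite /f_ patchE mem_set//= in_itv/= -ler_norml.
  by rewrite ltW// (lt_le_trans (truncnS_gt _))// ler_nat.
- exact: integrable_abse (idens s).
- apply: aeW => x n _; rewrite /f_ patchE; case: ifPn => // _.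
  by rewrite /= normr0 lee_fin.
move=> _ _ lim1.
have lim0 : (fun n => \int[mu]_x f_ n x)%E @ \oo --> 0%E.
  rewrite (_ : (fun _ => _) = fun n => (prim s n.+1%:R - prim s (- n.+1%:R))%:E).
    apply: cvg_EFin; first exact: nearW.
    apply/cvgr0Pnorm_lt => e e0.
    have e2 : 0 < e / 2 by rewrite divr_gt0.
    have /cvgr0Pnorm_lt/(_ _ e2)[N _ HN] := gam_vanish; exists N => // n /HN /=.
    rewrite ger0_norm// => ge.
    rewrite (le_lt_trans (ler_normB _ _))// /prim !normrM [`|gam _|]ger0_norm// [`|gam (- _)|]ger0_norm//.
    have -> : gam (- n.+1%:R) = gam n.+1%:R by rewrite !gamE sqrrN.
    rewrite -mulrDl (@le_lt_trans _ _ (2 * gam n.+1%:R))//.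
      by rewrite ler_wpM2r// (_ : 2 = 1 + 1)// lerD.
    by rewrite mulrC -ltr_pdivlMr.
  apply/funext => n; rewrite -segment_dens /f_ [RHS]integral_mkcond.
  by apply: eq_integral => x _; rewrite restrict_EFin.
rewrite /Rintegral.
have -> : (\int[mu]_x (dens s x)%:E = 0)%E by apply: cvg_unique lim1 lim0.
by [].
Qed.

Let dF (s : R) : is_derive s 1 F (- s * F s).
Proof.
have p1 (x y : R) : partial1of2 (fun s y : R => cos (s * y + b) * gam y) x y = - (y * sin (x * y + b) * gam y).
  by rewrite partial1of2E; case: (d1 x y) => _ h; exact: h.
have sI : `]s - 1, s + 1[%classic s by rewrite /= in_itv/= ltrBlDr ltrDl ltr01.
have i1 (x : R) : `]s - 1, s + 1[%classic x -> mu.-integrable setT (EFin \o (fun y => cos (x * y + b) * gam y)).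
  by move=> _; exact: icos.
have i2 (x y : R) : `]s - 1, s + 1[%classic x -> setT y -> derivable (fun x : R => cos (x * y + b) * gam y) x 1.
  by move=> _ _; have [] := d1 x y.
have i3 y : 0 <= `|y| * gam y by rewrite mulr_ge0.
have i4 (x y : R) : `]s - 1, s + 1[%classic x -> setT y ->
    `|partial1of2 (fun s y : R => cos (s * y + b) * gam y) x y| <= `|y| * gam y.
  move=> _ _; rewrite p1 normrN !normrM [`|gam y|]ger0_norm// ler_wpM2r// ler_piMr//.
have D := differentiation_under_integral measurableT sI i1 i2 i3 i1gam i4.
have dD := derivable_under_integral measurableT sI i1 i2 i3 i1gam i4.
apply: DeriveDef; first exact: dD.
rewrite -derive1E D; under eq_Rintegral do rewrite p1.
rewrite mulNr -by_parts -[RHS]mulN1r -(RintegralZl _ measurableT (isin s)).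
by apply: eq_Rintegral => y _; rewrite mulN1r.
Qed.

(** Differentiation under the integral and [by_parts] give [F' = - s * F], so
    [F s * expR (s ^+ 2 / 2)] is constant. *)
Lemma normal_cos s : \int[mu]_y (cos (s * y + b) * gam y) = cos b * expR (- (s ^+ 2 / 2)).
Proof.
have F0 : F 0 = cos b.
  rewrite /F; under eq_Rintegral do rewrite mul0r add0r.
  by rewrite RintegralZl// /Rintegral integral_normal_pdf mulr1.
have dE (z : R) : is_derive z 1 (fun u => F u * expR (u ^+ 2 / 2)) 0.
  have de : is_derive z 1 (expR \o (fun u : R => u ^+ 2 / 2)) (expR (z ^+ 2 / 2) * z).
    have dz : is_derive z 1 (fun u : R => u ^+ 2 / 2) z.
      rewrite (_ : (fun _ => _) = 2^-1 *: (@id R) ^+ 2); last first.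
        by apply/funext => u; rewrite !fctE/= [in RHS]/GRing.scale/= mulrC.
      by apply: is_derive_eq; rewrite expr1 /GRing.scale/= mulr1 mulrA mulVf ?mul1r.
    exact: is_derive1_comp.
  have df := dF z.
  rewrite (_ : (fun _ => _) = F * (expR \o (fun u : R => u ^+ 2 / 2)))//.
  by apply: is_derive_eq; rewrite /GRing.scale/=; ring.
have [c _] := MVT_from s 0 dE.
rewrite mul0r F0 expr0n/= mul0r expR0 mulr1 => /eqP; rewrite subr_eq0 => /eqP h.
by rewrite -h -mulrA -expRD subrr expR0 mulr1.
Qed.

End gaussian_characteristic_function.

Section standard_normal.
Context {R : realType}.
Local Notation N01 := (@normal_prob R 0 1).

(** The density formula is available for nonnegative functions; it is applied to [f + C], and the
    constant is then subtracted. *)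
Lemma normal_prob_Ex (f : R -> R) : bdm f ->
  \int[N01]_x f x = \int[@lebesgue_measure R]_x (f x * normal_pdf 0 1 x).
Proof.
move=> bf; have [mf [C fC]] := bf.
have bfC : bdm (fun x => f x + C) by apply: bdmD => //; exact: bdm_cst.
have ig : (@lebesgue_measure R).-integrable setT (EFin \o normal_pdf 0 1).
  exact: (integrable_normal_pdf 0 1).
have iC : (@lebesgue_measure R).-integrable setT (EFin \o (fun x => C * normal_pdf 0 1 x)).
  exact: (integrableZl measurableT C ig).
have ifg : (@lebesgue_measure R).-integrable setT (EFin \o (fun x => f x * normal_pdf 0 1 x)).
  apply: (le_integrable measurableT _ _ iC).
    by apply/measurable_EFinP; apply: measurable_funM => //; exact: measurable_normal_pdf.
  move=> y _; rewrite /= lee_fin !normrM ler_wpM2r//.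
  by rewrite (le_trans (fC y))// ler_norm.
have : \int[N01]_x (f x + C) = \int[@lebesgue_measure R]_x ((f x + C) * normal_pdf 0 1 x).
  congr fine; rewrite (@ge0_integral_density _ _ _ (@lebesgue_measure R) N01 (normal_pdf 0 1))//.
  - exact: measurable_normal_pdf.
  - exact: normal_pdf_ge0.
  - by apply/measurable_EFinP; exact: bfC.1.
  - by move=> x; rewrite lee_fin; have := fC x; rewrite ler_norml -lerBlDr sub0r => /andP[].
rewrite ExD//; last exact: bdm_cst.
under [X in _ = X -> _]eq_Rintegral do rewrite mulrDl.
rewrite (RintegralD measurableT ifg iC) Ex_cst (RintegralZl C measurableT ig).
rewrite [X in _ = _ + C * X -> _](_ : _ = 1) ?mulr1; last by rewrite /Rintegral integral_normal_pdf.
exact: addIr.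
Qed.

Lemma standard_normal_cos s : \int[N01]_x cos (s * x) = expR (- (s ^+ 2 / 2)).
Proof.
rewrite normal_prob_Ex; last by apply: bdm_cos; apply: measurable_funM.
have := normal_cos 0 s; rewrite cos0 mul1r => <-.
by apply: eq_Rintegral => y _; rewrite addr0.
Qed.

Lemma standard_normal_sin s : \int[N01]_x sin (s * x) = 0.
Proof.
rewrite normal_prob_Ex; last by apply: bdm_sin; apply: measurable_funM.
have := normal_cos (- (pi / 2)) s; rewrite cosN cos_pihalf mul0r => h; rewrite -[RHS]h.
apply: eq_Rintegral => y _; congr (_ * _).
by rewrite cosBpihalf.
Qed.

End standard_normal.

Section image_law.
Context {R : realType} {d d' : measure_display} {T : measurableType d} {T' : measurableType d'}.

Lemma Ex_image (P : probability T R) (Q : probability T' R) (phi : T -> T') (f : T' -> R) :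
  measurable_fun setT phi -> (forall A, measurable A -> Q A = P (phi @^-1` A)) ->
  bdm f -> \int[Q]_x f x = \int[P]_w f (phi w).
Proof.
move=> mphi QE bf; have [mf [C fC]] := bf.
have bfp : bdm (fun w => f (phi w)).
  by split; [exact: (measurableT_comp mf)|exists C].
rewrite /Rintegral; congr fine.
transitivity (\int[pushforward P phi]_x (f x)%:E)%E.
  by apply: eq_measure_integral => A mA _; exact: QE.
rewrite (integral_pushforward mphi)//; first exact/measurable_EFinP.
exact: (bdm_int P bfp).
Qed.

Lemma image_probability (P : probability T R) (phi : T -> T') : measurable_fun setT phi ->
  exists Q : probability T' R, forall A, measurable A -> Q A = P (phi @^-1` A).
Proof.
move=> mphi.
pose phim : {mfun T >-> T'} := HB.pack phi (isMeasurableFun.Build _ _ _ _ _ mphi).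
by exists (distribution P phim).
Qed.

Lemma product_probability (P : probability T R) (Q : probability T' R) :
  exists PQ : probability (T * T')%type R,
   forall f : T * T' -> R, bdm f -> 
     \int[PQ]_z f z = \int[P]_x \int[Q]_y f (x, y).
Proof.
pose mu : {measure set (T * T') -> \bar R} := (P \x Q)%E.
have mu1 : mu setT = 1%E.
  by rewrite -setXTT [LHS]product_measure1E// [X in (X * _)%E]probability_setT [X in (_ * X)%E]probability_setT mule1.
pose PQ : probability (T * T')%type R := HB.pack (P \x Q)%E (Measure_isProbability.Build _ _ _ (P \x Q)%E mu1).
exists PQ => f bf; have iPQ := bdm_int PQ bf.
have -> : \int[PQ]_z f z = fine (\int[P]_x \int[Q]_y (f (x, y))%:E)%E.
  by rewrite (integral12_prod_meas1 iPQ).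
congr fine; apply: eq_integral => x _; rewrite Ex_fin//.
have [mf [C fC]] := bf; split; last by exists C.
by apply: (measurableT_comp mf); exact: pair1_measurable.
Qed.

End image_law.

Section gaussian_vectors.
Context {R : realType}.

(* [normal_prob] lives on the alias [measurableTypeR R] of [R]; it is transported
   to [R] so that products with tuples of reals can be formed. *)
Lemma standard_normal_exists : exists N : probability R R, forall s,
  \int[N]_x cos (s * x) = expR (- (s ^+ 2 / 2)) /\ \int[N]_x sin (s * x) = 0.
Proof.
have mid : measurable_fun setT (fun x : measurableTypeR R => x : R) by [].
have [N hN] := image_probability (@normal_prob R 0 1) mid.
exists N => s; have ms : measurable_fun setT (fun x : R => s * x) by exact: measurable_funM.
by rewrite (Ex_image mid hN (bdm_cos ms)) (Ex_image mid hN (bdm_sin ms)) standard_normal_cos standard_normal_sin.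
Qed.

Definition quad n (Sigma : 'I_n -> 'I_n -> R) (t : 'I_n -> R) : R :=
  \sum_(i < n) \sum_(j < n) t i * Sigma i j * t j.

Lemma measurable_dotv n (t : n.-tuple R) : measurable_fun setT (dotv t).
Proof.
rewrite /dotv; apply: measurable_sum => i; apply: measurable_funM => //.
exact: measurable_tnth.
Qed.

Lemma quad_recl n (Sigma : 'I_n.+1 -> 'I_n.+1 -> R) t : (forall i j, Sigma i j = Sigma j i) ->
  quad Sigma t = t ord0 ^+ 2 * Sigma ord0 ord0 +
    2 * t ord0 * (\sum_(j < n) Sigma ord0 (lift ord0 j) * t (lift ord0 j)) +
    quad (fun i j => Sigma (lift ord0 i) (lift ord0 j)) (fun i => t (lift ord0 i)).
Proof.
move=> sym; rewrite /quad big_ord_recl big_ord_recl.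
have -> : \sum_(i < n) \sum_(j < n.+1) t (lift ord0 i) * Sigma (lift ord0 i) j * t j =
   t ord0 * (\sum_(j < n) Sigma ord0 (lift ord0 j) * t (lift ord0 j)) + 
   \sum_(i < n) \sum_(j < n) t (lift ord0 i) * Sigma (lift ord0 i) (lift ord0 j) * t (lift ord0 j).
  rewrite mulr_sumr -big_split/=; apply: eq_bigr => i _; rewrite big_ord_recl; congr (_ + _).
  by rewrite sym; ring.
have -> : \sum_(i < n) t ord0 * Sigma ord0 (lift ord0 i) * t (lift ord0 i) =
   t ord0 * (\sum_(j < n) Sigma ord0 (lift ord0 j) * t (lift ord0 j)).
  by rewrite mulr_sumr; apply: eq_bigr => i _; rewrite mulrA.
ring.
Qed.

(** Cholesky step: the first coordinate is [s * z] with [z] standard normal, and the others are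
    those of an independent vector plus [c j * z]. The independent vector has covariance [Sigma'],
    the Schur complement. Degenerate [Sigma] are included. *)
Lemma gaussian_vector n (Sigma : 'I_n -> 'I_n -> R) :
  (forall i j, Sigma i j = Sigma j i) -> (forall t, 0 <= quad Sigma t) ->
  exists mu : probability (n.-tuple R) R, forall t : n.-tuple R,
    \int[mu]_x cos (dotv t x) = expR (- (quad Sigma (tnth t) / 2)) /\
    \int[mu]_x sin (dotv t x) = 0.
Proof.
elim: n Sigma => [|n ih] Sigma sym psd.
  pose P0 : probability (0.-tuple R) R := dirac [tuple].
  exists P0 => t; rewrite /quad big_ord0 mul0r oppr0 expR0; split.
    rewrite -[RHS](Ex_cst P0); apply: eq_Rintegral => x _.
    by rewrite /dotv big_ord0 cos0.
  rewrite -[RHS](Ex_cst P0); apply: eq_Rintegral => x _.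
  by rewrite /dotv big_ord0 sin0.
pose l (i : 'I_n) := lift ord0 i.
have s00 : 0 <= Sigma ord0 ord0.
  have := psd (fun i => (i == ord0)%:R); rewrite quad_recl// eqxx expr1n mul1r mulr1.
  rewrite big1 => [|j _]; last by rewrite mulr0.
  by rewrite mulr0 addr0 /quad big1 ?addr0// => i _; rewrite big1// => j _; rewrite !mul0r.
pose s := Num.sqrt (Sigma ord0 ord0); pose c j := Sigma ord0 (l j) / s.
have ss : s ^+ 2 = Sigma ord0 ord0 by rewrite sqr_sqrtr.
have sc j : s * c j = Sigma ord0 (l j).
  have [s0|s0] := eqVneq s 0; last by rewrite /c mulrC divfK.
  rewrite s0 mul0r; apply/esym/eqP; apply: contraT => nz.
  pose v := Sigma (l j) (l j); pose x := Sigma ord0 (l j).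
  (* If [Sigma ord0 ord0] vanishes, the form is affine in the first entry of its argument, with
     slope [2 * x]. For [x] nonzero it is unbounded below, and the chosen entry gives it the value
     [- 1]. *)
  have := psd (fun i => if i == ord0 then - (v + 1) / (2 * x) else (i == l j)%:R).
  rewrite quad_recl// eqxx -ss s0 expr0n/= mulr0 add0r.
  have -> : \sum_(k < n) Sigma ord0 (lift ord0 k) * (lift ord0 k == l j)%:R = x.
    rewrite (bigD1 j)//= eqxx mulr1 big1 ?addr0// => k kj.
    by rewrite (inj_eq lift_inj) (negbTE kj) mulr0.
  have -> : quad (fun i j0 => Sigma (lift ord0 i) (lift ord0 j0)) (fun i => (lift ord0 i == l j)%:R) = v.
    rewrite /quad (bigD1 j)//= [X in _ + X]big1 => [|k kj]; last first.
      by rewrite big1// => k' _; rewrite (inj_eq lift_inj) (negbTE kj) !mul0r.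
    rewrite addr0 (bigD1 j)//= big1 => [|k kj]; last first.
      by rewrite [lift ord0 k == _](inj_eq lift_inj) (negbTE kj) mulr0.
    by rewrite eqxx mul1r mulr1 addr0.
  have x0 : x != 0 by [].
  rewrite (_ : 2 * (- (v + 1) / (2 * x)) * x + v = - 1); last by field.
  by rewrite oppr_ge0 ler10.
pose Sigma' i j := Sigma (l i) (l j) - c i * c j.
pose lin (t : 'I_n.+1 -> R) := s * t ord0 + \sum_(j < n) c j * t (l j).
have QE t : quad Sigma t = lin t ^+ 2 + quad Sigma' (fun i => t (l i)).
  rewrite quad_recl// /lin sqrrD exprMn ss.
  have -> : quad Sigma' (fun i => t (l i)) =
      quad (fun i j => Sigma (l i) (l j)) (fun i => t (l i)) - (\sum_(j < n) c j * t (l j)) ^+ 2.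
    rewrite expr2 big_distrl/= /quad -sumrB; apply: eq_bigr => i _.
    rewrite big_distrr/= -sumrB; apply: eq_bigr => j _; rewrite /Sigma'; ring.
  have -> : \sum_(j < n) Sigma ord0 (lift ord0 j) * t (lift ord0 j) = s * \sum_(j < n) c j * t (l j).
    by rewrite mulr_sumr; apply: eq_bigr => j _; rewrite mulrA sc.
  rewrite -[_ *+ 2]mulr_natl; ring.
have sym' i j : Sigma' i j = Sigma' j i by rewrite /Sigma' sym mulrC.
have psd' t' : 0 <= quad Sigma' t'.
  (* The first entry is chosen to annihilate [lin], so that a value of the form of [Sigma'] is a
     value of the form of [Sigma]. If [s = 0], then [c] vanishes by [1 / 0 = 0] and [lin] is zero
     anyway. *)
  pose t (i : 'I_n.+1) := if unlift ord0 i is Some j then t' j else - (\sum_(j < n) c j * t' j) / s.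
  have tl j : t (l j) = t' j by rewrite /t /l liftK.
  have t0 : t ord0 = - (\sum_(j < n) c j * t' j) / s by rewrite /t unlift_none.
  have := psd t; rewrite QE (_ : lin t = 0).
    by rewrite expr0n/= add0r (_ : (fun i => t (l i)) = t')//; apply/funext => j.
  rewrite /lin; under eq_bigr do rewrite tl.
  rewrite t0.
  have [s0|s0] := eqVneq s 0.
    by rewrite s0 mul0r add0r big1// => j _; rewrite /c s0 invr0 mulr0 mul0r.
  by rewrite mulrC divfK// addNr.
have [mu' hmu'] := ih _ sym' psd'.
have [N hN] := standard_normal_exists.
have [PQ fubini] := product_probability N mu'.
pose phi (z : R * n.-tuple R) : n.+1.-tuple R :=
  [the n.+1.-tuple R of (s * z.1) :: [tuple tnth z.2 j + c j * z.1 | j < n]].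
have mphi : measurable_fun setT phi.
  apply: measurable_cons; first exact: measurable_funM.
  apply/measurable_fun_tnthP => j.
  rewrite (_ : _ \o _ = fun z : R * n.-tuple R => tnth z.2 j + c j * z.1).
    apply: measurable_funD; last exact: measurable_funM.
    by apply: (measurableT_comp (measurable_tnth j)).
  by apply/funext => z /=; rewrite tnth_mktuple.
have [mu hmu] := image_probability PQ mphi.
exists mu => t.
pose t' := [tuple tnth t (l j) | j < n]; pose k := lin (tnth t).
have phiS z i : tnth (phi z) (lift ord0 i) = tnth z.2 i + c i * z.1.
  transitivity (tnth [tuple tnth z.2 j + c j * z.1 | j < n] i); last by rewrite tnth_mktuple.
  by rewrite !(tnth_nth 0).
have dE z : dotv t (phi z) = k * z.1 + dotv t' z.2.
  rewrite /dotv big_ord_recl.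
  under eq_bigr => i _ do rewrite phiS mulrDr.
  rewrite [tnth (phi z) ord0](tnth_nth 0) [nth _ _ _]/=.
  rewrite big_split/= /k /lin mulrDl mulr_suml.
  have -> : \sum_(i < n) tnth t (lift ord0 i) * (c i * z.1) = \sum_(i < n) c i * tnth t (l i) * z.1.
    by apply: eq_bigr => i _; rewrite mulrCA mulrA.
  have -> : \sum_(i < n) tnth t (lift ord0 i) * tnth z.2 i = \sum_(i < n) tnth t' i * tnth z.2 i.
    by apply: eq_bigr => i _; rewrite tnth_mktuple.
  ring.
have [h1 h2] := hmu' t'.
have mkx : measurable_fun setT (fun x : R => k * x) by exact: measurable_funM.
have bc : bdm (fun x : R => cos (k * x)) by exact: bdm_cos.
have bs : bdm (fun x : R => sin (k * x)) by exact: bdm_sin.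
have md := measurable_dotv t'; have bdc := bdm_cos md; have bds := bdm_sin md.
have mdz : measurable_fun setT (fun z : R * n.-tuple R => k * z.1 + dotv t' z.2).
  apply: measurable_funD; first exact: measurable_funM.
  by apply: (measurableT_comp md).
have quadE : quad Sigma (tnth t) / 2 = k ^+ 2 / 2 + quad Sigma' (tnth t') / 2.
  rewrite QE mulrDl -/k; congr (_ + quad _ _ / _).
  by apply/funext => j; rewrite tnth_mktuple.
have mdt := measurable_dotv t.
rewrite (Ex_image mphi hmu (bdm_cos mdt)) (Ex_image mphi hmu (bdm_sin mdt)).
under eq_Rintegral do rewrite dE.
under [in X in _ /\ X]eq_Rintegral do rewrite dE.
rewrite (fubini _ (bdm_cos mdz)) (fubini _ (bdm_sin mdz))/=; split.
  transitivity (\int[N]_x (expR (- (quad Sigma' (tnth t') / 2)) * cos (k * x))).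
    apply: eq_Rintegral => x _; under eq_Rintegral do rewrite cosD.
    have b1 : bdm (fun y => cos (k * x) * cos (dotv t' y)) by apply: bdmM => //; exact: bdm_cst.
    have b2 : bdm (fun y => sin (k * x) * sin (dotv t' y)) by apply: bdmM => //; exact: bdm_cst.
    by rewrite (ExB _ b1 b2) !ExZ// h1 h2 mulr0 subr0 mulrC.
  by rewrite ExZ// (hN k).1 -expRD quadE -opprD addrC.
transitivity (\int[N]_x (expR (- (quad Sigma' (tnth t') / 2)) * sin (k * x))).
  apply: eq_Rintegral => x _; under eq_Rintegral do rewrite sinD.
  have b1 : bdm (fun y => sin (k * x) * cos (dotv t' y)) by apply: bdmM => //; exact: bdm_cst.
  have b2 : bdm (fun y => cos (k * x) * sin (dotv t' y)) by apply: bdmM => //; exact: bdm_cst.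
  by rewrite (ExD _ b1 b2) !ExZ// h1 h2 mulr0 addr0 mulrC.
by rewrite ExZ// (hN k).2 mulr0.
Qed.

Lemma normal0_exists n (Sigma : 'I_n -> 'I_n -> R) :
  (forall i j, Sigma i j = Sigma j i) -> (forall t, 0 <= quad Sigma t) ->
  exists mu : probability (n.-tuple R) R, is_normal0 mu Sigma.
Proof.
move=> sym psd; have [mu hmu] := gaussian_vector sym psd; exists mu => t.
have [h1 h2] := hmu t; split.
  by rewrite Ex_fin ?h1 ?mulNr//; apply: bdm_cos; exact: measurable_dotv.
by rewrite Ex_fin ?h2//; apply: bdm_sin; exact: measurable_dotv.
Qed.

End gaussian_vectors.

(** * Levy's continuity theorem *)

Section trigonometric_polynomials.
Context {R : realType} (n : nat).

Inductive trig : (n.-tuple R -> R) -> Prop :=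
| trig_cos t : trig (fun x => cos (dotv t x))
| trig_sin t : trig (fun x => sin (dotv t x))
| trig_add f g : trig f -> trig g -> trig (fun x => f x + g x)
| trig_scale c f : trig f -> trig (fun x => c * f x).

Lemma dotvD (s t x : n.-tuple R) :
  dotv s x + dotv t x = dotv [tuple tnth s i + tnth t i | i < n] x.
Proof.
by rewrite /dotv -big_split; apply: eq_bigr => i _; rewrite tnth_mktuple mulrDl.
Qed.

Lemma dotvB (s t x : n.-tuple R) :
  dotv s x - dotv t x = dotv [tuple tnth s i - tnth t i | i < n] x.
Proof.
by rewrite /dotv -sumrB; apply: eq_bigr => i _; rewrite tnth_mktuple mulrBl.
Qed.

Lemma trig_ext f g : trig f -> f =1 g -> trig g.
Proof. by move=> tf /funext <-. Qed.

Lemma trig_cst c : trig (fun=> c).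
Proof.
apply: trig_ext (trig_scale c (trig_cos [tuple 0 | i < n])) _ => x /=.
by rewrite /dotv big1 ?cos0 ?mulr1// => i _; rewrite tnth_mktuple mul0r.
Qed.

(** Product-to-sum formulas on the generators, then induction over each factor. *)
Lemma trig_mul f g : trig f -> trig g -> trig (fun x => f x * g x).
Proof.
have base_cos s g' : trig g' -> trig (fun x => cos (dotv s x) * g' x).
  elim=> [t|t|g1 g2 _ h1 _ h2|c g1 _ h1].
  - apply: trig_ext (trig_scale 2^-1 (trig_add (trig_cos [tuple tnth s i + tnth t i | i < n])
      (trig_cos [tuple tnth s i - tnth t i | i < n]))) _ => x /=.
    by rewrite -dotvD -dotvB cosB (cosD (dotv s x) (dotv t x)); field.
  - apply: trig_ext (trig_scale 2^-1 (trig_add (trig_sin [tuple tnth s i + tnth t i | i < n])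
      (trig_scale (- 1) (trig_sin [tuple tnth s i - tnth t i | i < n])))) _ => x /=.
    by rewrite -dotvD -dotvB sinB (sinD (dotv s x) (dotv t x)); field.
  - by apply: trig_ext (trig_add h1 h2) _ => x /=; rewrite mulrDr.
  - by apply: trig_ext (trig_scale c h1) _ => x /=; rewrite mulrCA.
have base_sin s g' : trig g' -> trig (fun x => sin (dotv s x) * g' x).
  elim=> [t|t|g1 g2 _ h1 _ h2|c g1 _ h1].
  - apply: trig_ext (trig_scale 2^-1 (trig_add (trig_sin [tuple tnth s i + tnth t i | i < n])
      (trig_sin [tuple tnth s i - tnth t i | i < n]))) _ => x /=.
    by rewrite -dotvD -dotvB sinB (sinD (dotv s x) (dotv t x)); field.
  - apply: trig_ext (trig_scale 2^-1 (trig_add (trig_cos [tuple tnth s i - tnth t i | i < n])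
      (trig_scale (- 1) (trig_cos [tuple tnth s i + tnth t i | i < n])))) _ => x /=.
    by rewrite -dotvD -dotvB cosB (cosD (dotv s x) (dotv t x)); field.
  - by apply: trig_ext (trig_add h1 h2) _ => x /=; rewrite mulrDr.
  - by apply: trig_ext (trig_scale c h1) _ => x /=; rewrite mulrCA.
move=> tf tg; elim: tf => [t|t|f1 f2 _ h1 _ h2|c f1 _ h1].
- exact: base_cos.
- exact: base_sin.
- by apply: trig_ext (trig_add h1 h2) _ => x /=; rewrite mulrDl.
- by apply: trig_ext (trig_scale c h1) _ => x /=; rewrite mulrA.
Qed.

Lemma trig_sum (I : Type) (s : seq I) (f : I -> n.-tuple R -> R) :
  (forall i, trig (f i)) -> trig (fun x => \sum_(i <- s) f i x).
Proof.
move=> tf; elim: s => [|i s ih].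
  by apply: trig_ext (trig_cst 0) _ => x; rewrite big_nil.
by apply: trig_ext (trig_add (tf i) ih) _ => x; rewrite big_cons.
Qed.

Lemma trig_prod (I : Type) (s : seq I) (f : I -> n.-tuple R -> R) :
  (forall i, trig (f i)) -> trig (fun x => \prod_(i <- s) f i x).
Proof.
move=> tf; elim: s => [|i s ih].
  by apply: trig_ext (trig_cst 1) _ => x; rewrite big_nil.
by apply: trig_ext (trig_mul (tf i) ih) _ => x; rewrite big_cons.
Qed.

Lemma trig_exp f k : trig f -> trig (fun x => f x ^+ k).
Proof.
move=> tf; elim: k => [|k ih]; first exact: trig_cst.
by apply: trig_ext (trig_mul tf ih) _ => x; rewrite exprS.
Qed.

Lemma trig_coord (c : R) i : trig (fun x => sin (c * tnth x i)).
Proof.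
apply: trig_ext (trig_sin [tuple if j == i then c else 0 | j < n]) _ => x.
congr sin; rewrite /dotv (bigD1 i)//= tnth_mktuple eqxx big1 ?addr0// => j ji.
by rewrite tnth_mktuple (negbTE ji) mul0r.
Qed.

End trigonometric_polynomials.

Section bernstein.
Context {R : realType}.
Implicit Types u : R.

Definition bern (N : nat) u (k : nat) : R := 'C(N, k)%:R * u ^+ k * (1 - u) ^+ (N - k).

Lemma bern_ge0 N u k : 0 <= u <= 1 -> 0 <= bern N u k.
Proof.
by move=> /andP[u0 u1]; rewrite mulr_ge0 ?exprn_ge0 ?subr_ge0// mulr_ge0 ?exprn_ge0.
Qed.

(** Pascal's rule, read as conditioning a binomial variable on one trial; the first two moments then
    follow by induction on [N]. *)
Lemma bernS N u (phi : nat -> R) :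
  \sum_(k < N.+2) bern N.+1 u k * phi k =
  u * (\sum_(k < N.+1) bern N u k * phi k.+1) + (1 - u) * (\sum_(k < N.+1) bern N u k * phi k).
Proof.
rewrite big_ord_recl.
have -> : \sum_(i < N.+1) bern N.+1 u (lift ord0 i) * phi (lift ord0 i) =
   \sum_(i < N.+1) (u * (bern N u i * phi i.+1)) +
   \sum_(i < N.+1) ('C(N, i.+1)%:R * u ^+ i.+1 * (1 - u) ^+ (N - i) * phi i.+1).
  rewrite -big_split; apply: eq_bigr => i _ /=.
  rewrite /bern /bump leq0n add1n binS natrD subSS exprS; ring.
have -> : \sum_(i < N.+1) ('C(N, i.+1)%:R * u ^+ i.+1 * (1 - u) ^+ (N - i) * phi i.+1) =
   \sum_(i < N) ('C(N, i.+1)%:R * u ^+ i.+1 * (1 - u) ^+ (N - i) * phi i.+1).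
  by rewrite big_ord_recr/= bin_small// !mul0r addr0.
rewrite [in X in _ = _ + _ * X]big_ord_recl.
rewrite !mulr_sumr [in RHS]mulrDr mulr_sumr.
rewrite [LHS]addrCA; congr (_ + (_ + _)).
  by rewrite /bern !bin0 !expr0 !subn0 exprS; ring.
apply: eq_bigr => i _ /=; rewrite /bern /bump leq0n add1n.
by rewrite -[in LHS](subnSK (ltn_ord i)) [(1 - u) ^+ _.+1]exprS; ring.
Qed.

Lemma bern_sum1 N u : \sum_(k < N.+1) bern N u k = 1.
Proof.
have h : forall N, \sum_(k < N.+1) bern N u k * 1 = 1.
  elim=> [|M ih]; last by rewrite (bernS M u (fun=> 1)) ih; ring.
  by rewrite big_ord_recl big_ord0 /bern bin0 !mulr1 addr0.
by rewrite -[RHS](h N); apply: eq_bigr => k _; rewrite mulr1.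
Qed.

Lemma bern_mean N u : \sum_(k < N.+1) bern N u k * k%:R = N%:R * u.
Proof.
elim: N => [|N ih]; first by rewrite big_ord_recl big_ord0 mulr0 addr0 mul0r.
rewrite (bernS N u (fun k => k%:R)) ih.
have -> : \sum_(k < N.+1) bern N u k * k.+1%:R = N%:R * u + 1.
  transitivity (\sum_(k < N.+1) bern N u k * k%:R + \sum_(k < N.+1) bern N u k); last by rewrite ih bern_sum1.
  by rewrite -big_split; apply: eq_bigr => k _ /=; rewrite -natr1 mulrDr mulr1.
by rewrite -natr1; ring.
Qed.

Lemma bern_second N u : \sum_(k < N.+1) bern N u k * k%:R ^+ 2 =
  (N%:R * u) ^+ 2 + N%:R * (u * (1 - u)).
Proof.
elim: N => [|N ih]; first by rewrite big_ord_recl big_ord0 expr0n/= !mulr0 addr0 !mul0r expr0n/= addr0.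
rewrite (bernS N u (fun k => k%:R ^+ 2)) ih.
have -> : \sum_(k < N.+1) bern N u k * k.+1%:R ^+ 2 =
    (N%:R * u) ^+ 2 + N%:R * (u * (1 - u)) + 2 * (N%:R * u) + 1.
  rewrite -ih -(bern_mean N u).
  transitivity (\sum_(k < N.+1) bern N u k * k%:R ^+ 2 + 2 * \sum_(k < N.+1) bern N u k * k%:R
      + \sum_(k < N.+1) bern N u k); last by rewrite bern_sum1.
  rewrite mulr_sumr -!big_split; apply: eq_bigr => k _ /=.
  by rewrite -natr1; ring.
by rewrite -natr1; ring.
Qed.

Lemma bern_var N u : (0 < N)%N -> 0 <= u <= 1 ->
  \sum_(k < N.+1) bern N u k * (k%:R / N%:R - u) ^+ 2 <= N%:R^-1.
Proof.
move=> N0 /andP[u0 u1].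
have nN : N%:R != 0 :> R by rewrite pnatr_eq0 -lt0n.
have -> : \sum_(k < N.+1) bern N u k * (k%:R / N%:R - u) ^+ 2 =
  N%:R^-1 ^+ 2 * (\sum_(k < N.+1) bern N u k * k%:R ^+ 2) +
  (- (2 * u * N%:R^-1)) * (\sum_(k < N.+1) bern N u k * k%:R) + u ^+ 2 * (\sum_(k < N.+1) bern N u k).
  rewrite !mulr_sumr -!big_split; apply: eq_bigr => k _ /=; ring.
rewrite bern_second bern_mean bern_sum1.
rewrite (_ : _ + _ = N%:R^-1 * (u * (1 - u))); last by field.
rewrite ler_piMr// mulr_ile1// ?subr_ge0// lerBlDr lerDl//.
Qed.

Variable n : nat.

Definition mbern N (u : 'I_n -> R) (k : {ffun 'I_n -> 'I_N.+1}) : R := \prod_i bern N (u i) (k i).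

Lemma mbern_ge0 N (u : 'I_n -> R) k : (forall i, 0 <= u i <= 1) -> 0 <= @mbern N u k.
Proof. by move=> u01; apply: prodr_ge0 => i _; exact: bern_ge0. Qed.

Lemma mbern_sum1 N (u : 'I_n -> R) : \sum_k @mbern N u k = 1.
Proof.
rewrite /mbern -(bigA_distr_bigA (fun i (j : 'I_N.+1) => bern N (u i) j)).
by apply: big1 => i _; exact: bern_sum1.
Qed.

(** With the test factor placed on coordinate [i] only, the sum becomes a product of one-dimensional
    sums, all equal to 1 except the [i]-th. *)
Lemma mbern_marginal N (u : 'I_n -> R) i (phi : nat -> R) :
  \sum_k @mbern N u k * phi (k i) = \sum_(j < N.+1) bern N (u i) j * phi j.
Proof.
transitivity (\sum_(k : {ffun 'I_n -> 'I_N.+1}) \prod_i' (bern N (u i') (k i') * (if i' == i then phi (k i') else 1))).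
  apply: eq_bigr => k _; rewrite big_split/= /mbern; congr (_ * _).
  by rewrite (bigD1 i)//= eqxx big1 ?mulr1// => j /negbTE ->.
rewrite -(bigA_distr_bigA (fun i' (j : 'I_N.+1) => bern N (u i') j * (if i' == i then phi j else 1))).
rewrite (bigD1 i)//= eqxx [X in _ * X]big1 ?mulr1// => j /negbTE ji.
rewrite ji -[RHS](bern_sum1 N (u j)); by apply: eq_bigr => k _; rewrite mulr1.
Qed.

End bernstein.

Section sine_parametrization.
Context {R : realType}.
(** [pi / 2] bounds the angles of the nodes and [1 / 2] those of points of the box, so [h] bounds
    half their sum and half their difference. Being below [pi / 2], it keeps the cosine away from
    zero. *)
Let h : R := (pi / 2 + 2^-1) / 2.
Let c := cos h.

Let pi2 : 1 <= pi / 2 :> R. Proof. exact: pihalf_ge1. Qed.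

Let h_bounds : 0 < h < pi / 2.
Proof. by rewrite /h; apply/andP; split; have := pi2; lra. Qed.

Lemma sine_modulus_gt0 : 0 < c.
Proof. by apply: cos_gt0_pihalf; have /andP[h0 hp] := h_bounds; rewrite hp andbT; lra. Qed.

Let cos_ge (x : R) : `|x| <= h -> c <= cos x.
Proof.
move=> xh; have /andP[h0 hp] := h_bounds.
have -> : cos x = cos `|x| by have [//|x0] := ger0P x; rewrite cosN.
have [xe|xe] := eqVneq `|x| h; first by rewrite xe.
have hin : h \in `[0, pi] by rewrite in_itv/= (ltW h0)/=; have := pi2; lra.
have xin : `|x| \in `[0, pi].
  by rewrite in_itv/= normr_ge0/= (le_trans xh)//; have := pi2; lra.
by apply: ltW; rewrite ltr_cos// lt_neqAle xe.
Qed.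

(** [sin y - sin z = 2 * cos a * sin b] with half sum [a] and half difference [b], both at most [h]
    in absolute value. There the cosine is at least [c], and [|sin b| >= c * |b|] by the mean value
    theorem. *)
Lemma sine_expands (y z : R) : `|y| <= pi / 2 -> `|z| <= 2^-1 ->
  c ^+ 2 * `|y - z| <= `|sin y - sin z|.
Proof.
move=> yp z1; pose a := (y + z) / 2; pose b := (y - z) / 2.
have ah : `|a| <= h.
  by rewrite /a /h normrM [`|2^-1|]ger0_norm// ler_pM2r// (le_trans (ler_normD _ _))// lerD.
have bh : `|b| <= h.
  by rewrite /b /h normrM [`|2^-1|]ger0_norm// ler_pM2r// (le_trans (ler_normB _ _))// lerD.
have half_angle (p q : R) : sin (p + q) - sin (p - q) = 2 * cos p * sin q.
  by rewrite sinB sinD; ring.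
have ye : a + b = y by rewrite /a /b; field.
have ze : a - b = z by rewrite /a /b; field.
clearbody a b.
have -> : sin y - sin z = 2 * cos a * sin b by rewrite -half_angle ye ze.
have [x xb sE] := MVT_from b 0 (@is_derive_sin R).
rewrite sin0 !subr0 in sE xb; rewrite sE !normrM [`|2|]ger0_norm//.
have c0 := ltW sine_modulus_gt0.
have ca : c <= `|cos a| by rewrite (le_trans (cos_ge ah))// ler_norm.
have cx : c <= `|cos x| by rewrite (le_trans _ (ler_norm _))// cos_ge// (le_trans xb).
rewrite (_ : y - z = 2 * b); last by rewrite -ye -ze; ring.
rewrite normrM [`|2|]ger0_norm// (_ : c ^+ 2 * (2 * `|b|) = 2 * (c * c * `|b|)); last by ring.
rewrite (_ : 2 * `|cos a| * (`|cos x| * `|b|) = 2 * (`|cos a| * `|cos x| * `|b|)); last by ring.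
by rewrite ler_pM2l// ler_wpM2r// ler_pM.
Qed.

Variable L : R.
Hypothesis L0 : 0 < L.

(** The factor [(2 * L)^-1] sends the box to angles in [[- 1/2, 1/2]], away from the turning points
    of the sine, while the angles of [node], a right inverse on [[0, 1]], may reach [pi / 2]. *)
Definition unit_coord (x : R) : R := (1 + sin ((2 * L)^-1 * x)) / 2.
Definition node (v : R) : R := 2 * L * asin (2 * v - 1).

Lemma unit_coord01 x : 0 <= unit_coord x <= 1.
Proof.
have := sin_geN1 ((2 * L)^-1 * x); have := sin_le1 ((2 * L)^-1 * x).
by rewrite /unit_coord => s1 s2; apply/andP; split; lra.
Qed.

Lemma node_close (x v : R) : `|x| <= L -> 0 <= v <= 1 ->
  c ^+ 2 * `|node v - x| <= 4 * L * `|v - unit_coord x|.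
Proof.
move=> xL /andP[v0 v1].
have L2 : 0 < 2 * L by rewrite mulr_gt0.
have v2 : -1 <= 2 * v - 1 <= 1 by apply/andP; split; lra.
have [yb sy] := asin_def v2; set y := asin _ in yb sy *.
pose z := (2 * L)^-1 * x.
have zb : `|z| <= 2^-1.
  by rewrite /z normrM gtr0_norm ?invr_gt0// mulrC ler_pdivrMr// mulrA mulVf ?mul1r.
have yb' : `|y| <= pi / 2 by rewrite ler_norml.
have -> : node v - x = 2 * L * (y - z).
  by rewrite /node -/y /z mulrBr mulrA mulfV ?gt_eqF// mul1r.
have -> : v - unit_coord x = (sin y - sin z) / 2 by rewrite /unit_coord -/z sy; field.
rewrite normrM (gtr0_norm L2) normrM [`|2^-1|]ger0_norm// mulrCA.
rewrite [leRHS](_ : _ = 2 * L * `|sin y - sin z|); last by field.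
by rewrite ler_pM2l// sine_expands.
Qed.

End sine_parametrization.

Section trigonometric_approximation.
Context {R : realType} (n : nat).
Implicit Types f : n.-tuple R -> R.

Definition in_box (L : R) (x : n.-tuple R) := forall i, `|tnth x i| <= L.

(** Only [x] has to lie in the box, since the nodes may leave it. Compactness of the box turns the
    local choices of [eta] into a single one. *)
Lemma uniform_on_box f (L e : R) : bounded_continuous f -> 0 < e ->
  exists2 eta : R, 0 < eta & forall x y, in_box L x ->
    (forall i, `|tnth y i - tnth x i| < eta) -> `|f y - f x| <= e.
Proof.
move=> [_ cf] e0.
pose K : set 'rV[R]_n := [set v | forall i, `[- L, L]%classic (v ord0 i)].
have cK : compact K by apply: (@rV_compact _ _ (fun=> `[- L, L]%classic)) => i; exact: segment_compact.
pose tov (v : 'rV[R]_n) : n.-tuple R := [tuple v ord0 i | i < n].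
pose Q (eta : R) (v : 'rV[R]_n) := forall y : n.-tuple R, (forall i, `|tnth y i - v ord0 i| < eta) -> `|f y - f (tov v)| <= e.
have /compact_near_coveringP/(_ R (0^'+) Q) cover := cK.
have : \forall eta \near 0^'+, K `<=` Q eta.
  apply: cover => v Kv; have e2 : 0 < e / 2 by rewrite divr_gt0.
  have [del del0 hdel] := cf (tov v) _ e2.
  pose rho := del / (2 * n.+1%:R).
  have rho0 : 0 < rho by rewrite divr_gt0// mulr_gt0.
  have small (z : n.-tuple R) : (forall i, `|tnth z i - v ord0 i| < 2 * rho) -> `|f (tov v) - f z| < e / 2.
    move=> hz; apply: hdel; apply: le_lt_trans (enorm_le_sum _) _.
    apply: (@le_lt_trans _ _ (n%:R * (2 * rho))).
      rewrite mulr_natl -[X in _ *+ X]card_ord -sumr_const; apply: ler_sum => i _.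
      by rewrite !tnth_mktuple distrC ltW.
    rewrite /rho (_ : n%:R * (2 * (del / (2 * n.+1%:R))) = n%:R * (del / n.+1%:R)); last by field; rewrite addrC natr1 pnatr_eq0.
    by rewrite mulrCA gtr_pMr// ltr_pdivrMr// mul1r ltr_nat.
  exists ([set v' : 'rV[R]_n | forall i, `|v' ord0 i - v ord0 i| < rho], [set eta : R | eta < rho]); last first.
    move=> [v' eta]/= [hv' heta] y hy.
    have h1 : `|f (tov v) - f (tov v')| < e / 2.
      apply: small => i; rewrite tnth_mktuple (lt_trans (hv' i))// ltr_pMl//.
      by rewrite ltr1n.
    have h2 : `|f (tov v) - f y| < e / 2.
      apply: small => i; rewrite (le_lt_trans (ler_distD (v' ord0 i) _ _))//.
      by rewrite mulr_natl mulr2n ltrD// (lt_trans (hy i)).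
    rewrite (le_trans (ler_distD (f (tov v)) _ _))// [leRHS](splitr e) lerD//.
      by rewrite distrC ltW.
    exact: ltW.
  split => /=; last exact: nbhs_right_lt.
  have := nbhsx_ballx v rho rho0; apply: filterS => v' [_ hb] i.
  by rewrite distrC; exact: hb ord0 i.
rewrite near_withinE => -[r /= r0 hr]; exists (r / 2); first exact: divr_gt0.
move=> x y xL xy; pose v : 'rV[R]_n := \row_i tnth x i.
have vx : tov v = x by apply: eq_from_tnth => i; rewrite tnth_mktuple mxE.
rewrite -vx; apply: (hr (r / 2) _ _ v).
- by rewrite /ball/= sub0r normrN gtr0_norm ?divr_gt0// ltr_pdivrMr// ltr_pMr// ltr1n.
- by rewrite divr_gt0.
- by move=> i /=; rewrite mxE in_itv/= -ler_norml.
- by move=> i; rewrite mxE.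
Qed.

End trigonometric_approximation.

Section trigonometric_approximation.
Context {R : realType} (n : nat).
Implicit Types f : n.-tuple R -> R.

(* Bernstein polynomials of f in the coordinates u_i = (1 + sin (x_i / 2L)) / 2, which parametrize the box. *)
Lemma trig_approximation f (M L e : R) : bounded_continuous f ->
  (forall x, `|f x| <= M) -> 0 < L -> 0 < e ->
  exists2 g, trig g & (forall x, `|g x| <= M) /\
    forall x, in_box L x -> `|g x - f x| <= e.
Proof.
move=> cf fM L0 e0.
have [c2 c20 hnode] : exists2 c2 : R, 0 < c2 & forall x v : R, `|x| <= L -> 0 <= v <= 1 ->
    c2 * `|node L v - x| <= 4 * L * `|v - unit_coord L x|.
  exists (cos ((pi / 2 + 2^-1) / 2) ^+ 2); first by rewrite exprn_gt0// sine_modulus_gt0.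
  by move=> x v xL v01; exact: node_close.
have M0 : 0 <= M by exact: le_trans (normr_ge0 _) (fM [tuple 0 | i < n]).
have [eta eta0 ueta] := uniform_on_box L cf (divr_gt0 e0 (ltr0n _ 2)).
(* By [hnode], a deviation below [del] in the unit coordinate puts the node within [eta] of the
   point. *)
pose del := c2 * eta / (4 * L).
have del0 : 0 < del by rewrite divr_gt0 ?mulr_gt0.
(* Chebyshev: nodes with some coordinate off by at least [del] have total weight at most
   [n / (N * del ^+ 2)], and each costs at most [2 * M]. This [N] makes the product at most
   [e / 2]. *)
pose N := (Num.truncn (4 * M * n%:R / (del ^+ 2 * e))).+1.
have N0 : 0 < N%:R :> R by rewrite ltr0n.
pose u (x : n.-tuple R) i := unit_coord L (tnth x i).
have u01 x i : 0 <= u x i <= 1 by exact: unit_coord01.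
pose xi (k : {ffun 'I_n -> 'I_N.+1}) : n.-tuple R := [tuple node L ((k i)%:R / N%:R) | i < n].
exists (fun x => \sum_k mbern (u x) k * f (xi k)).
  apply: trig_sum => k; apply: trig_ext (trig_scale (f (xi k)) (f := fun x => mbern (u x) k) _) _.
    apply: trig_prod => i.
    have tu : trig (fun x : n.-tuple R => u x i).
      apply: trig_ext (trig_scale 2^-1 (trig_add (trig_cst n 1) (trig_coord ((2 * L)^-1) i))) _ => x.
      by rewrite /u /unit_coord mulrC.
    apply: trig_mul; last first.
      apply: trig_exp; apply: trig_ext (trig_add (trig_cst n 1) (trig_scale (- 1) tu)) _ => x.
      by rewrite mulN1r.
    by apply: trig_mul; [exact: trig_cst|exact: trig_exp].
  by move=> x /=; rewrite mulrC.
have mb x k : 0 <= mbern (u x) k by exact: mbern_ge0.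
(* The sine maps the whole line into [[-1, 1]], so the weights are nonnegative with sum 1 at every
   [x], in the box or not: the bound [M] is global. *)
split=> x.
  rewrite (le_trans (ler_norm_sum _ _ _))//.
  rewrite -[leRHS]mul1r -(mbern_sum1 N (u x)) mulr_suml; apply: ler_sum => k _.
  by rewrite normrM ger0_norm// ler_wpM2l.
move=> xL.
rewrite -[f x]mul1r -(mbern_sum1 N (u x)) mulr_suml -sumrB.
rewrite (le_trans (ler_norm_sum _ _ _))//.
pose B (k : {ffun 'I_n -> 'I_N.+1}) : R := e / 2 + (2 * M / del ^+ 2) * \sum_i ((k i)%:R / N%:R - u x i) ^+ 2.
have sq0 (k : {ffun 'I_n -> 'I_N.+1}) i : 0 <= ((k i)%:R / N%:R - u x i) ^+ 2 by exact: sqr_ge0.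
have Md : 0 <= 2 * M / del ^+ 2 by rewrite divr_ge0 ?sqr_ge0 ?mulr_ge0.
apply: (@le_trans _ _ (\sum_k mbern (u x) k * B k)).
  apply: ler_sum => k _; rewrite -mulrBr normrM ger0_norm// ler_wpM2l//.
  have [/forallP far|] := boolP [forall i, `|(k i)%:R / N%:R - u x i| < del].
    apply: (@le_trans _ _ (e / 2)); last by rewrite lerDl mulr_ge0 ?sumr_ge0.
    apply: ueta => // i; rewrite tnth_mktuple -(ltr_pM2l c20).
    apply: le_lt_trans (hnode _ _ (xL i) _) _.
      by rewrite divr_ge0 ?ler0n//= ler_pdivrMr// mul1r ler_nat -ltnS.
    by rewrite -ltr_pdivlMl ?mulr_gt0// [ltRHS]mulrC; exact: far.
  rewrite negb_forall => /existsP[i]; rewrite -leNgt => far.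
  rewrite (le_trans (ler_normB _ _))// (@le_trans _ _ (2 * M))//.
    by rewrite mulr_natl mulr2n lerD.
  rewrite /B -[leLHS]add0r lerD ?divr_ge0 ?(ltW e0)//.
  rewrite mulrAC -mulrA ler_peMr ?mulr_ge0//.
  rewrite ler_pdivlMr ?exprn_gt0// mul1r (bigD1 i)//=.
  rewrite (@le_trans _ _ (((k i)%:R / N%:R - u x i) ^+ 2))//.
    by rewrite -[leRHS]real_normK ?num_real// ler_pXn2r ?nnegrE// ltW.
  by rewrite lerDl sumr_ge0.
rewrite /B; under eq_bigr do rewrite mulrDr [X in _ + X]mulrCA mulr_sumr.
rewrite big_split/= -mulr_suml mbern_sum1 mul1r -mulr_sumr exchange_big/=.
rewrite [leRHS](splitr e) lerD2l.
apply: (@le_trans _ _ ((2 * M / del ^+ 2) * (n%:R / N%:R))).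
  rewrite ler_wpM2l// (_ : n%:R / N%:R = \sum_(i < n) N%:R^-1); last by rewrite sumr_const card_ord mulr_natl.
  apply: ler_sum => i _.
  by rewrite (mbern_marginal N (u x) i (fun k => (k%:R / N%:R - u x i) ^+ 2)) bern_var.
have := ltW (truncnS_gt (4 * M * n%:R / (del ^+ 2 * e))); rewrite -/N.
have d20 : 0 < del ^+ 2 by exact: exprn_gt0.
rewrite ler_pdivrMr ?(mulr_gt0 d20)// => hN.
rewrite mulrA ler_pdivrMr// mulrAC ler_pdivrMr ?exprn_gt0//.
rewrite [leRHS](_ : _ = 2^-1 * (N%:R * (del ^+ 2 * e))); last by ring.
by apply: le_trans (_ : 2^-1 * (4 * M * n%:R) <= _); [rewrite le_eqVlt; apply/orP; left; apply/eqP; field|rewrite ler_wpM2l].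
Qed.

End trigonometric_approximation.

Section bounded_tuple_functions.
Context {R : realType} (n : nat).
Implicit Types f g : n.-tuple R -> R.

Lemma trig_bdm g : trig g -> bdm g.
Proof.
elim=> [t|t|g1 g2 _ h1 _ h2|c g1 _ h1].
- exact: bdm_cos (measurable_dotv t).
- exact: bdm_sin (measurable_dotv t).
- exact: bdmD.
- by apply: bdmM => //; exact: bdm_cst.
Qed.

(** Continuity refers to the Euclidean norm and measurability to the product sigma-algebra of
    tuples. Trigonometric polynomials approximating on growing boxes converge pointwise and link the
    two. *)
Lemma bdm_bounded_continuous f : bounded_continuous f -> bdm f.
Proof.
move=> cf; have [[M fM] _] := cf; split; last by exists M.
have /choice[g hg] : forall N : nat, exists g, trig g /\
    forall x, in_box N.+1%:R x -> `|g x - f x| <= N.+1%:R^-1.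
  move=> N; have N0 : 0 < N.+1%:R^-1 :> R by rewrite invr_gt0.
  by have [g tg [_ hg]] := trig_approximation cf fM (ltr0Sn R N) N0; exists g.
apply: (@measurable_fun_cvg _ _ _ setT g); first by move=> N; exact: (trig_bdm (hg N).1).1.
move=> x _; apply/cvgrPdist_le => e e0.
pose L := \sum_i `|tnth x i|.
near=> N; rewrite distrC; apply: le_trans ((hg N).2 x _) _.
  move=> i; apply: (@le_trans _ _ L).
    by rewrite /L (bigD1 i)//= lerDl sumr_ge0.
  by rewrite (@le_trans _ _ N%:R) ?ler_nat//; near: N; exact: nbhs_infty_ger.
by rewrite ltW//; near: N; exact: (near_infty_natSinv_lt (PosNum e0)).
Unshelve. all: by end_near. Qed.

Definition outside (L : R) (x : n.-tuple R) : bool := ~~ [forall i, `|tnth x i| <= L].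

Lemma measurable_outside L : measurable [set x | outside L x].
Proof.
rewrite (_ : [set _ | _] = ~` [set x | [forall i, `|tnth x i| <= L]]).
  apply: measurableC; apply: measurable_bool_set; apply: measurable_forall => i.
  apply: measurable_fun_ler => //.
  by apply: measurableT_comp => //; exact: measurable_tnth.
by apply/seteqP; split => x /=; rewrite /outside => /negP.
Qed.

Lemma bdm_outside L : bdm (fun x : n.-tuple R => if outside L x then 1 else 0 : R).
Proof. exact: bdm_if (measurable_outside L). Qed.

Lemma outside_mono (L L' : R) x : L <= L' -> outside L' x -> outside L x.
Proof.
move=> LL'; apply: contra => /forallP h; apply/forallP => i.
exact: le_trans (h i) LL'.
Qed.

Lemma outside_le_sum_sqr (L : R) x : 0 < L ->
  (if outside L x then 1 else 0) <= (L ^+ 2)^-1 * \sum_(i < n) tnth x i ^+ 2.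
Proof.
move=> L0; have L20 : 0 < L ^+ 2 by exact: exprn_gt0.
have s0 (i : 'I_n) : 0 <= tnth x i ^+ 2 by exact: sqr_ge0.
case: ifP => [|_]; last by rewrite mulr_ge0 ?sumr_ge0// invr_ge0 ltW.
rewrite /outside negb_forall => /existsP[i]; rewrite -ltNge => xi.
rewrite ler_pdivlMl// mulr1 (bigD1 i)//= (@le_trans _ _ (tnth x i ^+ 2)) ?lerDl ?sumr_ge0//.
by rewrite -[leRHS]real_normK ?num_real// ler_pXn2r ?nnegrE// ltW.
Qed.

Lemma tight_law (mu : probability (n.-tuple R) R) (e : R) : 0 < e ->
  exists N : nat, forall L : R, N%:R <= L -> \int[mu]_x (if outside L x then 1 else 0) <= e.
Proof.
move=> e0; pose F (N : nat) : set (n.-tuple R) := [set x | outside N%:R x].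
have F0 : \bigcap_N F N = set0.
  apply/seteqP; split => // x Fx; pose L := \sum_i `|tnth x i|.
  have := Fx (Num.truncn L).+1 I; rewrite /F/= /outside negb_forall => /existsP[i].
  rewrite -ltNge => xi; have := truncnS_gt L; apply/negP; rewrite -leNgt.
  by rewrite (le_trans (ltW xi))// /L (bigD1 i)//= lerDl sumr_ge0.
have mF N : measurable (F N) by exact: measurable_outside.
have := @nonincreasing_cvg_mu _ _ _ mu F.
rewrite F0 measure0 => h.
have {h}/fine_cvgP[_ /cvgrPdist_le/(_ _ e0)[N _ hN]] : mu \o F @ \oo --> 0%:E.
  apply: h => //.
  - exact: le_lt_trans (probability_le1 mu (mF 0)) (ltry _).
  - move=> i j ij; apply/subsetPset => x; apply: outside_mono; by rewrite ler_nat.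
exists N => L NL.
have := hN N (leqnn _) => /=; rewrite sub0r normrN => hF.
apply: le_trans (Ex_le mu (bdm_outside L) (bdm_outside N%:R) _) _.
  by move=> x; case: ifPn => [/(outside_mono NL) ->//|_]; case: ifP.
by rewrite (Ex_if mu (measurable_outside _)) (le_trans (ler_norm _)).
Qed.

End bounded_tuple_functions.

Section approximation.
Context {R : realType} {d : measure_display} {T : measurableType d}.
Variables (P : probability T R) (n : nat).

Lemma bdm_comp (f : n.-tuple R -> R) (V : T -> n.-tuple R) :
  measurable_fun setT V -> bdm f -> bdm (fun w => f (V w)).
Proof.
move=> mV [mf [C fC]]; split; last by exists C.
exact: measurableT_comp.
Qed.

Lemma approximation_error (f g : n.-tuple R -> R) (V : T -> n.-tuple R) (M L e : R) :
  measurable_fun setT V -> bdm f -> bdm g -> 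
  (forall x, `|f x| <= M) -> (forall x, `|g x| <= M) ->
  0 <= e -> (forall x, in_box L x -> `|g x - f x| <= e) ->
  `|\int[P]_w f (V w) - \int[P]_w g (V w)| <=
    e + 2 * M * \int[P]_w (if outside L (V w) then 1 else 0).
Proof.
move=> mV bf bg fM gM e0 fg.
have b1 := bdm_comp mV bf; have b2 := bdm_comp mV bg.
have b3 := bdm_comp mV (bdm_outside n L).
have b4 := bdmM (bdm_cst (2 * M)) b3.
rewrite -(Ex_cst P e) -(ExZ P _ b3) -(ExD P (bdm_cst e) b4).
apply: (Ex_dist_le P b1 b2 (bdmD (bdm_cst e) b4)) => w.
rewrite /outside; have [/forallP h|_] := boolP [forall i, `|tnth (V w) i| <= L].
  by rewrite /= mulr0 addr0 distrC fg.
rewrite /= mulr1 -[leLHS]add0r lerD// (le_trans (ler_normB _ _))//.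
by rewrite mulr_natl mulr2n lerD.
Qed.

End approximation.

Section levy.
Context {R : realType} {d : measure_display} {T : measurableType d}.
Variables (P : probability T R) (n : nat).

(** Tightness of the laws of [V N] comes from Chebyshev and the uniform bound [K], that of [mu] from
    continuity from above. By linearity the convergence passes from sines and cosines to all of
    [trig]. *)
Theorem levy_continuity (V : nat -> T -> n.-tuple R) (mu : probability (n.-tuple R) R) (K : R) :
  (forall N i, bdm (fun w => tnth (V N w) i)) ->
  (forall N i, \int[P]_w (tnth (V N w) i) ^+ 2 <= K) ->
  (forall t, (fun N => \int[P]_w cos (dotv t (V N w))) @ \oo --> \int[mu]_x cos (dotv t x)) ->
  (forall t, (fun N => \int[P]_w sin (dotv t (V N w))) @ \oo --> \int[mu]_x sin (dotv t x)) ->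
  cvg_dist P V mu.
Proof.
move=> bV KV hc hs f cf; have bf := bdm_bounded_continuous cf.
have mV N : measurable_fun setT (V N).
  by apply/measurable_fun_tnthP => i; exact: (bV N i).1.
have htrig g : trig g -> (fun N => \int[P]_w g (V N w)) @ \oo --> \int[mu]_x g x.
  elim=> [t|t|g1 g2 t1 h1 t2 h2|c g1 t1 h1]; [exact: hc|exact: hs| |].
    have b1 := trig_bdm t1; have b2 := trig_bdm t2.
    rewrite ExD//; rewrite (_ : (fun _ => _) = fun N => \int[P]_w g1 (V N w) + \int[P]_w g2 (V N w)).
      exact: cvgD.
    by apply/funext => N; rewrite (ExD P (bdm_comp (mV N) b1) (bdm_comp (mV N) b2)).
  have b1 := trig_bdm t1.
  rewrite ExZ//; rewrite (_ : (fun _ => _) = fun N => c * \int[P]_w g1 (V N w)).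
    by apply: cvgM => //; exact: cvg_cst.
  by apply/funext => N; rewrite (ExZ P c (bdm_comp (mV N) b1)).
rewrite (Ex_fin mu bf) (_ : (fun _ => _) = fun N => (\int[P]_w f (V N w))%:E); last first.
  by apply/funext => N; rewrite (Ex_fin P (bdm_comp (mV N) bf)).
apply: cvg_EFin; first by apply: nearW.
rewrite (_ : _ \o _ = fun N => \int[P]_w f (V N w))//.
apply/cvgrPdist_le => e e0; have [[M0 fM0] _] := cf.
pose M : R := `|M0| + 1; have M_gt0 : 0 < M by rewrite ltr_wpDl.
have fM x : `|f x| <= M by rewrite (le_trans (fM0 x))// (le_trans (ler_norm _))// lerDl.
(* Chosen so that [2 * M * e1 = e / 8]: either approximation then costs at most [e / 8] in the box
   and [e / 8] outside, and [e / 2] remains for the convergence. *)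
pose e1 := e / (16 * M); have e10 : 0 < e1 by rewrite divr_gt0// mulr_gt0.
have [N1 hN1] := tight_law mu e10.
(* The three summands serve the tightness of [mu], the inequality [L <= L ^+ 2], and Chebyshev's
   bound for [V N]. *)
pose L := N1%:R + 1 + n%:R * `|K| / e1.
have K0 : 0 <= n%:R * `|K| / e1 by rewrite divr_ge0 ?(ltW e10)// mulr_ge0.
have L1 : 1 <= L by rewrite /L addrAC addrC lerDl addr_ge0.
have LN1 : N1%:R <= L by rewrite /L -addrA lerDl addr_ge0.
have LK : n%:R * `|K| / e1 <= L ^+ 2.
  by rewrite (@le_trans _ _ L) ?ler_eXnr// /L lerDr addr_ge0.
have tightV N : \int[P]_w (if outside L (V N w) then 1 else 0) <= e1.
  have bs i := bdmX 2 (bV N i).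
  have bS : bdm (fun w => \sum_(i < n) tnth (V N w) i ^+ 2) by apply: bdm_sum => i _; exact: bs.
  apply: (@le_trans _ _ ((L ^+ 2)^-1 * \int[P]_w (\sum_(i < n) tnth (V N w) i ^+ 2))).
    rewrite -(ExZ P _ bS); apply: Ex_le; [exact: bdm_comp (mV N) (bdm_outside n L)|exact: bdmM (bdm_cst _) bS|].
    by move=> w; apply: outside_le_sum_sqr; exact: lt_le_trans L1.
  have L20 : 0 < L ^+ 2 by rewrite exprn_gt0// (lt_le_trans _ L1).
  rewrite ler_pdivrMl// mulrC (@le_trans _ _ (n%:R * `|K|))//; last by rewrite mulrC -ler_pdivrMr.
  rewrite (@Ex_sum _ _ _ P _ _ (fun i w => tnth (V N w) i ^+ 2))//.
  rewrite mulr_natl -[X in _ *+ X]card_ord -sumr_const; apply: ler_sum => i _.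
  exact: le_trans (KV N i) (ler_norm _).
have e80 : 0 < e / 8 by exact: divr_gt0.
have L0 : 0 < L by exact: lt_le_trans L1.
have [g tg [gM fg]] := trig_approximation cf fM L0 e80.
have bg := trig_bdm tg.
have e2 : 2 * M * e1 = e / 8 by rewrite /e1; field; rewrite gt_eqF.
have errV N : `|\int[P]_w f (V N w) - \int[P]_w g (V N w)| <= e / 4.
  apply: le_trans (approximation_error P (mV N) bf bg fM gM (ltW e80) fg) _.
  rewrite (_ : e / 4 = e / 8 + 2 * M * e1); last by rewrite e2; field.
  by rewrite lerD2l ler_pM2l ?mulr_gt0.
have err : `|\int[mu]_x f x - \int[mu]_x g x| <= e / 4.
  apply: le_trans (approximation_error mu (@measurable_id _ _ setT) bf bg fM gM (ltW e80) fg) _.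
  rewrite (_ : e / 4 = e / 8 + 2 * M * e1); last by rewrite e2; field.
  by rewrite lerD2l ler_pM2l ?mulr_gt0// hN1.
have e20 : 0 < e / 2 by exact: divr_gt0.
have /cvgrPdist_le/(_ _ e20) := htrig g tg; apply: filterS => N hN.
rewrite (le_trans (ler_distD (\int[mu]_x g x) _ _))//.
rewrite (_ : e = e / 4 + (e / 2 + e / 4)); last by field.
rewrite lerD// (le_trans (ler_distD (\int[P]_w g (V N w)) _ _))// lerD// distrC.
exact: errV.
Qed.

End levy.

(** * Approximation rates *)

Section summability.
Context {R : realType}.
Implicit Types F G : nat -> R.

(** An upper bound only, with no sign condition: termwise comparison then holds as it stands, and
    for nonnegative terms this is summability. *)
Definition bounded_sums F := exists B, forall n, \sum_(k < n) F k <= B.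

Lemma bounded_sumsD F G : bounded_sums F -> bounded_sums G -> bounded_sums (fun k => F k + G k).
Proof.
by move=> [B hB] [C hC]; exists (B + C) => n; rewrite big_split lerD.
Qed.

Lemma bounded_sumsZ c F : 0 <= c -> bounded_sums F -> bounded_sums (fun k => c * F k).
Proof. by move=> c0 [B hB]; exists (c * B) => n; rewrite -mulr_sumr ler_wpM2l. Qed.

Lemma bounded_sums_le F G : (forall k, F k <= G k) -> bounded_sums G -> bounded_sums F.
Proof. by move=> FG [B hB]; exists B => n; apply: le_trans (hB n); exact: ler_sum. Qed.

Lemma bounded_sums_sum (I : Type) (s : seq I) (F : I -> nat -> R) :
  (forall i, bounded_sums (F i)) -> bounded_sums (fun k => \sum_(i <- s) F i k).
Proof.
move=> h; elim: s => [|i s ih].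
  by exists 0 => n; rewrite big1// => k _; rewrite big_nil.
by apply: bounded_sums_le (bounded_sumsD (h i) ih) => k; rewrite big_cons.
Qed.

Lemma bounded_sums_below N F : (forall k, (N <= k)%N -> F k <= 0) -> bounded_sums F.
Proof.
move=> h; exists (\sum_(k < N) `|F k|) => n.
have [nN|Nn] := leqP n N.
  rewrite (big_ord_widen N F nN) big_mkcond; apply: ler_sum => k _.
  by case: ifP => _; rewrite ?ler_norm.
rewrite (big_ord_widen n (fun k => `|F k|) (ltnW Nn)) [leRHS]big_mkcond; apply: ler_sum => k _ /=.
by case: ltnP => [_|/h //]; rewrite ler_norm.
Qed.

Lemma bounded_sums_shift i F : (forall k, 0 <= F k) ->
  bounded_sums F -> bounded_sums (fun k => if (i <= k)%N then F (k - i)%N else 0).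
Proof.
move=> F0 [B hB]; exists B => n; apply: le_trans (hB n).
have [ni|/ltnW iN] := leqP n i.
  rewrite big1 ?sumr_ge0// => k _.
  by rewrite leqNgt (leq_trans (ltn_ord k) ni).
rewrite -(subnKC iN) big_split_ord/= big1 ?add0r => [|k _]; last by rewrite leqNgt ltn_ord.
under eq_bigr do rewrite leq_addr addKn.
rewrite (big_ord_widen (i + (n - i)) F (leq_addl i _)) big_mkcond; apply: ler_sum => k _.
by case: ifP.
Qed.

Lemma bounded_sums_cvg F : (forall k, 0 <= F k) -> bounded_sums F -> cvgn (series F).
Proof.
move=> F0 [B hB]; apply: nondecreasing_is_cvgn.
  by apply: nondecreasing_series => k _ _.
by exists B => _ [n _ <-]; rewrite /series/= big_mkord.
Qed.

Lemma bounded_sums_sqr F : (forall k, 0 <= F k) -> bounded_sums (fun k => k%:R ^+ 2 * F k) ->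
  bounded_sums F.
Proof.
move=> F0 h.
(* The weight [k ^ 2] vanishes at [k = 0], so the term [F 0] is supplied separately. *)
have h0 : bounded_sums (fun k => if k == 0%N then F 0 else 0).
  by apply: (@bounded_sums_below 1) => k; case: eqP => // ->.
apply: bounded_sums_le (bounded_sumsD h h0) => -[|k]/=; first by rewrite expr0n mul0r add0r.
by rewrite addr0 ler_peMl// exprn_ege1// ler1n.
Qed.

Lemma bounded_sums_sqr_cvg0 F : (forall k, 0 <= F k) -> bounded_sums (fun k => k%:R ^+ 2 * F k) ->
  k%:R ^+ 2 * F k @[k --> \oo] --> (0 : R).
Proof.
move=> F0 h; apply: cvg_series_cvg_0; apply: bounded_sums_cvg => // k.
by rewrite mulr_ge0 ?sqr_ge0.
Qed.

Lemma bounded_sums_ereal N F : (forall k, 0 <= F k) ->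
  (\sum_(N <= k <oo) (F k)%:E < +oo)%E -> bounded_sums (fun k => if (N <= k)%N then F k else 0).
Proof.
move=> F0 h.
have s0 : (0 <= \sum_(N <= k <oo) (F k)%:E)%E by apply: nneseries_ge0 => k _ _; rewrite lee_fin.
exists (fine (\sum_(N <= k <oo) (F k)%:E)%E) => n.
rewrite -lee_fin fineK ?ge0_fin_numE//.
apply: le_trans (nneseries_lim_ge n _); last by move=> k _ _; rewrite lee_fin.
rewrite sumEFin lee_fin -(big_mkord xpredT (fun k => if (N <= k)%N then F k else 0)) -big_mkcond/=.
by rewrite (big_nat_widenl N 0 n).
Qed.

Lemma sqrt_sum_le (I : Type) (s : seq I) (F : I -> R) : (forall i, 0 <= F i) ->
  Num.sqrt (\sum_(i <- s) F i) <= \sum_(i <- s) Num.sqrt (F i).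
Proof.
move=> F0; elim: s => [|i s ih]; first by rewrite !big_nil sqrtr0.
rewrite !big_cons; apply: le_trans (_ : Num.sqrt (F i) + Num.sqrt (\sum_(j <- s) F j) <= _); last by rewrite lerD2l.
have S0 : 0 <= \sum_(j <- s) F j by exact: sumr_ge0.
rewrite -[leRHS]ger0_norm ?addr_ge0 ?sqrtr_ge0// -sqrtr_sqr ler_sqrt ?sqr_ge0//.
by rewrite sqrrD !sqr_sqrtr// lerD2r lerDl mulrn_wge0// mulr_ge0 ?sqrtr_ge0.
Qed.

Lemma bounded_sums_geometric : bounded_sums (fun k => 2^-1 ^+ k).
Proof.
exists 2 => n; have -> : \sum_(k < n) 2^-1 ^+ k = 2 - 2 * 2^-1 ^+ n :> R.
  elim: n => [|n ih]; first by rewrite big_ord0 expr0 mulr1 subrr.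
  by rewrite big_ord_recr/= ih exprS; field.
by rewrite lerBlDr lerDl mulr_ge0 ?exprn_ge0.
Qed.

End summability.

Section approximation_rate.
Context {R : realType}.
Variables (m : nat) (a : nat -> R) (phi : R -> R).
Hypotheses (m0 : (0 < m)%N) (a0 : forall k, 0 <= a k).
Hypothesis phi0 : phi 0 = 0.
Hypothesis phi_cvg0 : phi e @[e --> 0^'+] --> 0.

Let s k : R := \sum_(i < m) a (k - i)%N.
Let small k : R := 2^-1 ^+ k / k.+1%:R ^+ 2.

(** For [k < m.-1] the window is too short for all the increments, and the trivial rate 1 is used.
    The slack [2 * small k] covers [s k = 0], where the distance threshold must still be positive;
    it remains summable with weight [k ^ 2]. *)
Definition approx_rate k : R :=
  if (m.-1 <= k)%N then phi (2 * Num.sqrt (s k)) + 2 * Num.sqrt (s k) + 2 * small k else 1.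

Let s0 k : 0 <= s k. Proof. exact: sumr_ge0. Qed.
Let small_gt0 k : 0 < small k. Proof. by rewrite divr_gt0 ?exprn_gt0. Qed.

(** For [s k > 0] take [e = 2 * sqrt (s k)] and [er = s k / m]: the errors sum to at most [2 * s k],
    so the quotient is at most [2 * sqrt (s k)]. For [s k = 0] the limit of [phi] at 0 supplies [e]
    with [phi e <= small k], and [er] is tuned to make the quotient at most [small k]. *)
Lemma approx_rate_attained k : (m.-1 <= k)%N -> exists e er : R,
  [/\ 0 < e, 0 < er & phi e + 2 * (\sum_(i < m.-1) (a (k - i.+1)%N + er)) / e <= approx_rate k].
Proof.
move=> mk; rewrite /approx_rate mk.
have sm : \sum_(i < m.-1) a (k - i.+1)%N <= s k.
  by rewrite /s -(prednK m0) big_ord_recl lerDr.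
have [sk|sk] := eqVneq (s k) 0.
  have [e e0 pe] : exists2 e : R, 0 < e & phi e <= small k.
    have /cvgr_le/(_ _ (small_gt0 k)) := phi_cvg0.
    rewrite near_withinE => -[r /= r0 hr]; exists (r / 2); first exact: divr_gt0.
    apply: hr; last exact: divr_gt0.
    by rewrite /ball/= sub0r normrN gtr0_norm ?divr_gt0// ltr_pdivrMr// ltr_pMr// ltr1n.
  pose er := small k * e / (2 * m%:R).
  have m0' : 0 < m%:R :> R by rewrite ltr0n.
  have er0 : 0 < er by rewrite divr_gt0 ?mulr_gt0.
  exists e, er; split => //.
  rewrite sk sqrtr0 mulr0 phi0 !add0r [leRHS]mulr_natl mulr2n lerD//.
  rewrite ler_pdivrMr// big_split/= (_ : \sum_(i < m.-1) a (k - i.+1)%N = 0); last first.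
    by apply: le_anti; rewrite sumr_ge0// andbT -[leRHS]sk sm.
  rewrite add0r sumr_const card_ord -mulr_natl.
  apply: (@le_trans _ _ (2 * (m%:R * er))).
    by rewrite ler_pM2l// ler_pM2r// ler_nat leq_pred.
  by rewrite /er le_eqVlt; apply/orP; left; apply/eqP; field; rewrite gt_eqF.
have sk0 : 0 < s k by rewrite lt_neqAle eq_sym sk s0.
have m0' : 0 < m%:R :> R by rewrite ltr0n.
have q0 : 0 < Num.sqrt (s k) by rewrite sqrtr_gt0.
exists (2 * Num.sqrt (s k)), (s k / m%:R); split; [exact: mulr_gt0|exact: divr_gt0|].
rewrite -!addrA lerD2l -[leLHS]addr0 lerD//; last by rewrite mulr_ge0// ltW.
rewrite ler_pdivrMr ?mulr_gt0// (_ : 2 * Num.sqrt (s k) * _ = 2 * (2 * Num.sqrt (s k) ^+ 2)); last by ring.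
rewrite sqr_sqrtr// ler_pM2l// big_split/= mulr_natl mulr2n lerD//.
rewrite sumr_const card_ord -[_ *+ m.-1]mulr_natl mulrA ler_pdivrMr// mulrC.
by rewrite ler_wpM2l// ler_nat leq_pred.
Qed.

Lemma approx_rate_summable :
  bounded_sums (fun k => k%:R ^+ 2 * Num.sqrt (a k)) ->
  bounded_sums (fun k => if (m.-1 <= k)%N then k%:R ^+ 2 * phi (2 * Num.sqrt (s k)) else 0) ->
  bounded_sums (fun k => k%:R ^+ 2 * approx_rate k).
Proof.
move=> ha hphi; have q0 k : 0 <= Num.sqrt (a k) by exact: sqrtr_ge0.
(* Origin of [G]: the root of the sum is at most the sum of the roots, and
   [k ^ 2 <= 2 * (k - i) ^ 2 + 2 * i ^ 2] with [i < m]. *)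
pose G k := 2 * (k%:R ^+ 2 * Num.sqrt (a k)) + 2 * m%:R ^+ 2 * Num.sqrt (a k) : R.
have G0 k : 0 <= G k by rewrite addr_ge0 ?mulr_ge0 ?sqr_ge0.
have hG : bounded_sums G.
  apply: bounded_sumsD; first exact: bounded_sumsZ.
  by apply: bounded_sumsZ; [rewrite mulr_ge0 ?sqr_ge0|exact: bounded_sums_sqr].
pose H i k := if (i <= k)%N then G (k - i)%N else 0.
have hH : bounded_sums (fun k => \sum_(i < m) H i k).
  by apply: bounded_sums_sum => i; exact: bounded_sums_shift.
have h0 : bounded_sums (fun k => if (m.-1 <= k)%N then 0 else k%:R ^+ 2 : R).
  by apply: (@bounded_sums_below _ m.-1) => k ->.
apply: bounded_sums_le (bounded_sumsD (bounded_sumsD hphi (bounded_sumsZ (ler0n _ 2) hH))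
  (bounded_sumsD (bounded_sumsZ (ler0n _ 2) (@bounded_sums_geometric R)) h0)) => k /=.
have H0 : 0 <= \sum_(i < m) H i k by apply: sumr_ge0 => i _; rewrite /H; case: ifP.
have g0 : 0 <= 2^-1 ^+ k :> R by rewrite exprn_ge0.
rewrite /approx_rate; case: ifP => mk; last first.
  by rewrite mulr1 add0r addrA lerDr addr_ge0// mulr_ge0.
rewrite addr0 !mulrDr; apply: lerD; last first.
  rewrite mulrCA ler_pM2l// /small mulrCA ler_piMr// ler_pdivrMr ?exprn_gt0// mul1r.
  by rewrite ler_pXn2r ?nnegrE// ler_nat.
rewrite lerD2l mulrCA ler_pM2l//.
apply: (@le_trans _ _ (\sum_(i < m) k%:R ^+ 2 * Num.sqrt (a (k - i)%N))).
  by rewrite -mulr_sumr ler_wpM2l ?sqr_ge0// sqrt_sum_le.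
apply: ler_sum => i _; have ik : (i <= k)%N.
  by rewrite (leq_trans _ mk)// -ltnS prednK.
rewrite /H ik /G mulrA -mulrDl ler_wpM2r// -mulrDr.
rewrite -{1}(subnK ik) natrD.
have im : i%:R ^+ 2 <= m%:R ^+ 2 :> R by rewrite ler_pXn2r ?nnegrE// ler_nat ltnW.
apply: (@le_trans _ _ (2 * ((k - i)%N%:R ^+ 2 + i%:R ^+ 2))); last by rewrite ler_pM2l// lerD2l.
rewrite -subr_ge0 (_ : _ - _ = ((k - i)%N%:R - i%:R) ^+ 2) ?sqr_ge0//; ring.
Qed.

End approximation_rate.

(** * The multivariate limit theorem *)

Section bilinear.
Context {R : realType} (n : nat).
Implicit Types (u v : 'I_n -> R) (c : 'I_n -> 'I_n -> R).

Definition bil c u v : R := \sum_i \sum_j u i * v j * c i j.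

Lemma bilDD c u v : bil c (fun k => u k + v k) (fun k => u k + v k) =
  bil c u u + bil c v v + (bil c u v + bil c v u).
Proof.
rewrite /bil -!big_split/=; apply: eq_bigr => i _; rewrite -!big_split/=.
by apply: eq_bigr => j _; ring.
Qed.

Lemma bil_delta c a b : bil c (fun k => (k == a)%:R) (fun k => (k == b)%:R) = c a b.
Proof.
rewrite /bil (bigD1 a)//= [X in _ + X]big1 => [|i ia]; last first.
  by rewrite big1// => j _; rewrite (negbTE ia) !mul0r.
rewrite addr0 (bigD1 b)//= [X in _ + X]big1 => [|j jb]; last by rewrite (negbTE jb) mulr0 mul0r.
by rewrite !eqxx !mul1r addr0.
Qed.

Lemma bil_sym c u : bil (fun i j => c i j + c j i) u u = 2 * bil c u u.
Proof.
rewrite mulr_natl mulr2n {3}/bil exchange_big/= /bil -big_split; apply: eq_bigr => i _.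
by rewrite -big_split; apply: eq_bigr => j _ /=; ring.
Qed.

End bilinear.

Lemma cvg_seq_sum {R : realType} (I : Type) (s : seq I) (F : I -> nat -> R) (l : I -> R) :
  (forall i, F i @ \oo --> l i) -> (fun N => \sum_(i <- s) F i N) @ \oo --> \sum_(i <- s) l i.
Proof.
move=> h; elim: s => [|i s ih].
  by rewrite big_nil (_ : (fun _ => _) = cst 0); [exact: cvg_cst|apply/funext => N; rewrite big_nil].
rewrite big_cons (_ : (fun _ => _) = fun N => F i N + \sum_(j <- s) F j N); first exact: cvgD.
by apply/funext => N; rewrite big_cons.
Qed.

Section vector_clt.
Context {R : realType} {dS : measure_display} {S : measurableType dS}.
Context {d : measure_display} {T : measurableType d}.
Variables (P : probability T R) (Z : int -> T -> S) (beta : nat -> R).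
Hypothesis mZ : forall t, measurable_fun setT (Z t).
Hypothesis stZ : stationary P Z.
Hypothesis betaE : forall k, beta_coef P Z k = (beta k)%:E.
Variables (n : nat) (h : 'I_n -> nat -> T -> R) (p : 'I_n -> R) (q : 'I_n -> 'I_n -> nat -> R).
Hypothesis bh : forall i t, bdm (h i t).
Hypothesis h01 : forall i t w, 0 <= h i t w <= 1.
Hypothesis Eh : forall i t, \int[P]_w h i t w = p i.
Hypothesis Ehh : forall i j t k, \int[P]_w (h i t w * h j (t + k)%N w) = q i j k.
Hypothesis q0 : forall i j, q i j 0 = (i == j)%:R * p i.
Variable al : nat -> R.
Hypothesis al_sum : bounded_sums (fun k => k%:R ^+ 2 * al k).
Hypothesis beta_sum : bounded_sums (fun k => k%:R ^+ 2 * beta k).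
Hypothesis approx : forall l i, exists y : nat -> T -> R,
  [/\ forall t, window_fun Z (t.+1%:Z - l%:Z) (t.+1%:Z + l%:Z) (y t), forall t w, `|y t w| <= 1 &
      forall t, \int[P]_w `|h i t w - y t w| <= al l].

Let p01 i : 0 <= p i <= 1.
Proof.
rewrite -(Eh i 0) Ex_ge0 => [|w]; last by case/andP: (h01 i 0 w).
by rewrite Ex_le_cst// => w; case/andP: (h01 i 0 w).
Qed.

Definition cov_at k i j := q i j k - p i * p j.
Definition lincomb (u : 'I_n -> R) t w := \sum_i u i * (h i t w - p i).

Let bhp i t : bdm (fun w => h i t w - p i).
Proof. by apply: bdmB => //; exact: bdm_cst. Qed.

Let bterm (u : 'I_n -> R) i t : bdm (fun w => u i * (h i t w - p i)).
Proof. by apply: bdmM => //; exact: bdm_cst. Qed.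

Let bY u t : bdm (lincomb u t).
Proof. by apply: bdm_sum => i _. Qed.

Let EY u t : \int[P]_w lincomb u t w = 0.
Proof.
rewrite (@Ex_sum _ _ _ P _ _ (fun i w => u i * (h i t w - p i)))//.
by apply: big1 => i _; rewrite ExZ// (ExB P (bh i t) (bdm_cst _)) Ex_cst Eh subrr mulr0.
Qed.

Let EYY u t k : \int[P]_w (lincomb u t w * lincomb u (t + k) w) = bil (cov_at k) u u.
Proof.
have b2 i j : bdm (fun w => u i * (h i t w - p i) * (u j * (h j (t + k)%N w - p j))) by exact: bdmM.
have bS i : bdm (fun w => \sum_j u i * (h i t w - p i) * (u j * (h j (t + k)%N w - p j))).
  by apply: bdm_sum => j _.
transitivity (\int[P]_w (\sum_i \sum_j u i * (h i t w - p i) * (u j * (h j (t + k)%N w - p j)))).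
  apply: eq_Rintegral => w _; rewrite /lincomb mulr_suml; apply: eq_bigr => i _.
  by rewrite mulr_sumr.
rewrite (@Ex_sum _ _ _ P _ _ (fun i w => \sum_j u i * (h i t w - p i) * (u j * (h j (t + k)%N w - p j))))//.
apply: eq_bigr => i _.
rewrite (@Ex_sum _ _ _ P _ _ (fun j w => u i * (h i t w - p i) * (u j * (h j (t + k)%N w - p j))))//.
apply: eq_bigr => j _.
have bij : bdm (fun w => h i t w * h j (t + k)%N w) by exact: bdmM.
have b3 : bdm (fun w => p j * h i t w + p i * h j (t + k)%N w).
  by apply: bdmD; apply: bdmM => //; exact: bdm_cst.
have b4 : bdm (fun w => p j * h i t w + p i * h j (t + k)%N w - p i * p j).
  by apply: bdmB => //; exact: bdm_cst.
transitivity (\int[P]_w (u i * u j * (h i t w * h j (t + k)%N w -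
    (p j * h i t w + p i * h j (t + k)%N w - p i * p j)))).
  by apply: eq_Rintegral => w _; ring.
rewrite (ExZ P _ (bdmB bij b4)) (ExB P bij b4) (ExB P b3 (bdm_cst _)) Ex_cst.
rewrite (ExD P (bdmM (bdm_cst _) (bh i t)) (bdmM (bdm_cst _) (bh j _))) !ExZ// Ehh !Eh.
by rewrite /cov_at; ring.
Qed.

Lemma scalar_clt u : [/\ cvgn (series (fun k => `|bil (cov_at k.+1) u u|)),
  0 <= lrv (fun k => bil (cov_at k) u u),
  exists K, forall N, \sum_(k < N) `|bil (cov_at k) u u| <= K,
  (fun N => \int[P]_w cos ((Num.sqrt N%:R)^-1 * \sum_(t < N) lincomb u t w)) @ \oo -->
    expR (- (lrv (fun k => bil (cov_at k) u u) / 2)) &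
  (fun N => \int[P]_w sin ((Num.sqrt N%:R)^-1 * \sum_(t < N) lincomb u t w)) @ \oo --> (0 : R)].
Proof.
pose U := \sum_i `|u i|.
have U0 : 0 <= U by exact: sumr_ge0.
have U20 : 0 <= 2 * U by rewrite mulr_ge0.
have le_comb (x : 'I_n -> R) (c : R) : (forall i, `|x i| <= c) -> `|\sum_i u i * x i| <= U * c.
  move=> hx; rewrite (le_trans (ler_norm_sum _ _ _))// /U mulr_suml; apply: ler_sum => i _.
  by rewrite normrM ler_wpM2l.
have YC t w : `|lincomb u t w| <= 2 * U.
  rewrite mulrC; apply: le_comb => i; rewrite ler_norml.
  by have /andP[? ?] := h01 i t w; have /andP[? ?] := p01 i; apply/andP; split; lra.
have /choice[yy hyy] : forall li : nat * 'I_n, exists y : nat -> T -> R,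
  [/\ forall t, window_fun Z (t.+1%:Z - li.1%:Z) (t.+1%:Z + li.1%:Z) (y t), forall t w, `|y t w| <= 1 &
      forall t, \int[P]_w `|h li.2 t w - y t w| <= al li.1] by move=> [l i]; exact: approx.
pose y l t w := \sum_i u i * (yy (l, i) t w - p i).
have byy l i t : bdm (yy (l, i) t).
  have [wy y1 _] := hyy (l, i); split; last by exists 1 => w; exact: y1.
  by apply: window_fun_measurable (wy t).
have byp l i t : bdm (fun w => yy (l, i) t w - p i) by apply: bdmB => //; exact: bdm_cst.
have by_ l t : bdm (y l t).
  by apply: bdm_sum => i _; apply: bdmM => //; exact: bdm_cst.
have yC l t w : `|y l t w| <= 2 * U.
  rewrite mulrC; apply: le_comb => i; rewrite (le_trans (ler_normB _ _))//.
  have [_ /(_ t w) y1 _] := hyy (l, i); have /andP[p0 p1] := p01 i.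
  by rewrite (_ : 2 = 1 + 1) ?lerD// ger0_norm.
have Yy l t : \int[P]_w `|lincomb u t w - y l t w| <= U * al l.
  have bd i : bdm (fun w => `|h i t w - yy (l, i) t w|) by apply: bdm_norm; exact: bdmB.
  have bd' i : bdm (fun w => `|u i| * `|h i t w - yy (l, i) t w|) by apply: bdmM => //; exact: bdm_cst.
  apply: (@le_trans _ _ (\int[P]_w (\sum_i `|u i| * `|h i t w - yy (l, i) t w|))).
    apply: Ex_le; [by apply: bdm_norm; exact: bdmB|by apply: bdm_sum => i _|move=> w].
    rewrite /lincomb /y -sumrB (le_trans (ler_norm_sum _ _ _))//; apply: ler_sum => i _.
    by rewrite -mulrBr normrM (_ : h i t w - p i - _ = h i t w - yy (l, i) t w)//; ring.
  rewrite (@Ex_sum _ _ _ P _ _ (fun i w => `|u i| * `|h i t w - yy (l, i) t w|))//.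
  rewrite /U mulr_suml; apply: ler_sum => i _; rewrite ExZ// ler_wpM2l//.
  by have [_ _ ->] := hyy (l, i).
have be0 k : 0 <= beta k by exact: beta_ge0 betaE k.
(* [h i t] belongs to time [t + 1], whereas the scalar theorem centres the window of its index [t]
   at [t]. *)
pose W (a b : int) : set (T -> R) := window_fun Z (a + 1) (b + 1).
have W0 a b : W a b (fun=> 0) by exact: window_fun_cst.
have WD a b (f g : T -> R) : W a b f -> W a b g -> W a b (fun w => f w + g w) by exact: window_funD.
have Wcos a b c (f : T -> R) : W a b f -> W a b (fun w => cos (c * f w)).
  by apply: (window_fun_comp (h := fun x => cos (c * x))); exact: (bdm_cos (measurable_funM _ _)).1.
have Wsin a b c (f : T -> R) : W a b f -> W a b (fun w => sin (c * f w)).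
  by apply: (window_fun_comp (h := fun x => sin (c * x))); exact: (bdm_sin (measurable_funM _ _)).1.
have Wmono a b a' b' (f : T -> R) : a' <= a -> b <= b' -> W a b f -> W a' b' f.
  by move=> aa bb; apply: window_fun_mono; rewrite lerD2r.
have Wy (l t : nat) : W (t%:Z - l%:Z) (t%:Z + l%:Z) (y l t).
  rewrite /y /W (_ : t%:Z - l%:Z + 1 = t.+1%:Z - l%:Z); last by lia.
  rewrite (_ : t%:Z + l%:Z + 1 = t.+1%:Z + l%:Z); last by lia.
  elim: (index_enum _) => [|i s ih].
    rewrite (_ : (fun _ => _) = fun=> 0); first exact: window_fun_cst.
    by apply/funext => w; rewrite big_nil.
  rewrite (_ : (fun _ => _) = fun w => u i * (yy (l, i) t w - p i) + \sum_(j <- s) u j * (yy (l, j) t w - p j)); last first.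
    by apply/funext => w; rewrite big_cons.
  apply: window_funD => //.
  apply: (window_fun_comp (h := fun x => u i * (x - p i))).
    by apply: measurable_funM => //; exact: measurable_funB.
  by have [wy _ _] := hyy (l, i); exact: wy.
have Wmix a b c e (k : nat) (f g : T -> R) (A B : R) : W a b f -> W c e g -> b + k%:Z <= c ->
    (forall w, `|f w| <= A) -> (forall w, `|g w| <= B) ->
    `|\int[P]_w (f w * g w) - \int[P]_w f w * \int[P]_w g w| <= A * B * beta k.
  move=> Wf Wg bc fA gB; apply: (mixing_bounded mZ stZ betaE Wf Wg) => //.
  by rewrite addrAC lerD2r.
have [Ual0 sU] : (forall k, 0 <= U * al k) /\ bounded_sums (fun k => k%:R ^+ 2 * (U * al k)).
  split=> [k|]; last by apply: bounded_sums_le (bounded_sumsZ U0 al_sum) => k; rewrite mulrCA.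
  by apply: le_trans (Yy k 0); exact: Ex_ge0.
have cal := bounded_sums_cvg Ual0 (bounded_sums_sqr Ual0 sU).
have cbe := bounded_sums_cvg be0 (bounded_sums_sqr be0 beta_sum).
have al2 := bounded_sums_sqr_cvg0 Ual0 sU.
have be2 := bounded_sums_sqr_cvg0 be0 beta_sum.
have cov := EYY u.
split.
- exact: (cov_abs_summable U20 (bY u) YC (EY u) cov by_ yC Yy be0 Wy Wmix cal cbe).
- exact: (lrv_ge0 U20 (bY u) YC (EY u) cov by_ yC Yy be0 Wy Wmix cal cbe).
- by eexists; exact: (sum_norm_gam_le U20 (bY u) YC (EY u) cov by_ yC Yy be0 Wy Wmix cal cbe).
- exact: (cos_clt U20 (bY u) YC (EY u) cov by_ yC Yy be0 W0 WD Wcos Wsin Wmono Wy Wmix cal cbe al2 be2).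
- exact: (sin_clt U20 (bY u) YC (EY u) cov by_ yC Yy be0 W0 WD Wcos Wsin Wmono Wy Wmix cal cbe al2 be2).
Qed.

Definition cov_term i j k := q i j k + q j i k - 2 * p i * p j.

Lemma cov_termE i j k : cov_term i j k = cov_at k i j + cov_at k j i.
Proof. by rewrite /cov_term /cov_at; ring. Qed.

(* Polarization of the quadratic forms of scalar_clt. *)
Lemma cov_term_summable i j : cvgn (series (fun k => `|cov_term i j k.+1|)).
Proof.
pose e (a k : 'I_n) : R := (k == a)%:R.
have cvg_bounded u : bounded_sums (fun k => `|bil (cov_at k.+1) u u|).
  have [_ _ [K hK] _ _] := scalar_clt u; exists K => N.
  by apply: le_trans (hK N.+1); rewrite big_ord_recl lerDr.
apply: bounded_sums_cvg => //.
apply: bounded_sums_le (bounded_sumsD (cvg_bounded (fun k => e i k + e j k))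
  (bounded_sumsD (cvg_bounded (e i)) (cvg_bounded (e j)))) => k.
rewrite (_ : cov_term i j k.+1 = bil (cov_at k.+1) (fun k => e i k + e j k) (fun k => e i k + e j k)
   - (bil (cov_at k.+1) (e i) (e i) + bil (cov_at k.+1) (e j) (e j))).
  by rewrite (le_trans (ler_normB _ _))// lerD2l ler_normD.
by rewrite bilDD !bil_delta cov_termE; ring.
Qed.

Definition lr_cov i j := p i * ((i == j)%:R - p j) + limn (fun N => \sum_(1 <= k < N) cov_term i j k).

Lemma cov_term_cvg i j :
  series (fun k => cov_term i j k.+1) @ \oo --> limn (fun N => \sum_(1 <= k < N) cov_term i j k).
Proof.
have cs : cvgn (series (fun k => cov_term i j k.+1)) by apply: normed_cvg; exact: cov_term_summable.
have sE : (fun N => \sum_(1 <= k < N.+1) cov_term i j k) = series (fun k => cov_term i j k.+1).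
  by apply/funext => N; rewrite big_add1.
have ct : (fun N => \sum_(1 <= k < N) cov_term i j k) @ \oo --> limn (series (fun k => cov_term i j k.+1)).
  by rewrite -(cvg_shiftS (fun N => \sum_(1 <= k < N) cov_term i j k)) sE.
by rewrite (cvg_lim _ ct).
Qed.

Lemma lr_cov_sym i j : lr_cov i j = lr_cov j i.
Proof.
rewrite /lr_cov; congr (_ + limn _); last first.
  by apply/funext => N; apply: eq_bigr => k _; rewrite !cov_termE addrC.
by rewrite !mulrBr mulrC [p i * p j]mulrC; case: (eqVneq i j) => [->|ij]; rewrite ?eqxx ?mul1r ?mulr1// mulr0 mul0r.
Qed.

(** By [bil_sym], twice the form of [cov_at k] is the form of [cov_term]; the lag-zero identity [q0]
    provides the Kronecker delta. *)
Lemma lrv_quad u : lrv (fun k => bil (cov_at k) u u) = quad lr_cov u.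
Proof.
have [cg _ _ _ _] := scalar_clt u.
have hl : series (fun k => bil (cov_at k.+1) u u) @ \oo --> limn (series (fun k => bil (cov_at k.+1) u u)).
  by apply: normed_cvg.
pose L i j := limn (fun N => \sum_(1 <= k < N) cov_term i j k).
have hL : (fun N => 2 * series (fun k => bil (cov_at k.+1) u u) N) @ \oo --> bil L u u.
  rewrite (_ : (fun _ => _) = fun N => bil (fun i j => series (fun k => cov_term i j k.+1) N) u u).
    rewrite /bil; apply: cvg_seq_sum => i; apply: cvg_seq_sum => j.
    by apply: cvgM; [exact: cvg_cst|exact: cov_term_cvg].
  apply/funext => N; rewrite /series/= mulr_sumr.
  under eq_bigr => k _ do rewrite -bil_sym.
  rewrite /bil exchange_big/=; apply: eq_bigr => i _; rewrite exchange_big/=; apply: eq_bigr => j _.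
  by rewrite mulr_sumr; apply: eq_bigr => k _; rewrite cov_termE.
have h2 : (fun N => 2 * series (fun k => bil (cov_at k.+1) u u) N) @ \oo -->
    2 * limn (series (fun k => bil (cov_at k.+1) u u)).
  by apply: cvgM => //; exact: cvg_cst.
rewrite /lrv (cvg_unique _ h2 hL)// /bil /quad -big_split; apply: eq_bigr => i _.
rewrite -big_split; apply: eq_bigr => j _ /=.
rewrite /lr_cov -/(L i j) /cov_at q0; ring.
Qed.

Theorem vector_clt : exists mu : probability (n.-tuple R) R,
  is_normal0 mu lr_cov /\
  cvg_dist P (fun N w => [tuple Num.sqrt N%:R * (N%:R^-1 * \sum_(t < N) h i t w - p i) | i < n]) mu.
Proof.
have [mu hmu] : exists mu : probability (n.-tuple R) R, is_normal0 mu lr_cov.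
  apply: normal0_exists; first exact: lr_cov_sym.
  (* Each value of the quadratic form of [lr_cov] is a long-run variance, hence nonnegative. *)
  by move=> u; rewrite -lrv_quad; have [] := scalar_clt u.
exists mu; split=> //.
pose e (a k : 'I_n) : R := (k == a)%:R.
pose V N w i := (Num.sqrt N%:R)^-1 * \sum_(t < N) lincomb (e i) t w.
have lin_e i t w : lincomb (e i) t w = h i t w - p i.
  rewrite /lincomb (bigD1 i)//= /e eqxx mul1r big1 ?addr0// => j ji.
  by rewrite (negbTE ji) mul0r.
have -> : (fun N w => [tuple Num.sqrt N%:R * (N%:R^-1 * \sum_(t < N) h i t w - p i) | i < n]) =
    fun N w => [tuple V N w i | i < n].
  apply/funext => N; apply/funext => w; apply: eq_from_tnth => i; rewrite !tnth_mktuple /V.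
  under [in RHS]eq_bigr do rewrite lin_e.
  (* At [N = 0] both sides vanish, by [sqrt 0 = 0] and the empty sum. *)
  case: N => [|N]; first by rewrite sqrtr0 mul0r big_ord0 mulr0.
  have s0 : Num.sqrt N.+1%:R != 0 :> R by rewrite gt_eqF// sqrtr_gt0 ltr0n.
  rewrite sumrB sumr_const card_ord -[p i *+ _]mulr_natl.
  rewrite -[X in X^-1 * \sum_(t < _) _](@sqr_sqrtr _ N.+1%:R)// -[X in X * p i](@sqr_sqrtr _ N.+1%:R)//.
  by field.
have bV N i : bdm (fun w => V N w i).
  by apply: bdmM; [exact: bdm_cst|apply: bdm_sum => t _].
have dotE (t : n.-tuple R) N w : dotv t [tuple V N w i | i < n] =
    (Num.sqrt N%:R)^-1 * \sum_(s < N) lincomb (tnth t) s w.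
  rewrite /dotv /V.
  under eq_bigr => i _ do rewrite tnth_mktuple mulrCA mulr_sumr.
  rewrite -mulr_sumr exchange_big/= mulr_sumr -mulr_sumr; congr (_ * _).
  by apply: eq_bigr => s _; apply: eq_bigr => i _; rewrite lin_e.
have [K hK] : exists K, forall i N, \sum_(k < N) `|bil (cov_at k) (e i) (e i)| <= K.
  have /choice[K hK] : forall i, exists K, forall N, \sum_(k < N) `|bil (cov_at k) (e i) (e i)| <= K.
    by move=> i; have [] := scalar_clt (e i).
  exists (\sum_i `|K i|) => i N; apply: le_trans (hK i N) _.
  by rewrite (le_trans (ler_norm _))// (bigD1 i)//= lerDl sumr_ge0.
(* By [second_moment_subset], [2 * K] bounds the second moments of all normalized coordinates. *)
apply: (@levy_continuity _ _ _ P n _ mu (2 * K)).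
- move=> N i; rewrite (_ : (fun _ => _) = fun w => V N w i)//.
  by apply/funext => w; rewrite tnth_mktuple.
- move=> N i; under eq_Rintegral do rewrite tnth_mktuple.
  have K0 : 0 <= K by have := hK i 0; rewrite big_ord0.
  case: N => [|N].
    under eq_Rintegral do rewrite /V big_ord0 mulr0 expr0n.
    by rewrite Ex_cst mulr_ge0.
  have bS : bdm (fun w => (\sum_(t < N.+1) lincomb (e i) t w) ^+ 2) by apply: bdmX; apply: bdm_sum => t _.
  under eq_Rintegral do rewrite /V exprMn exprVn (@sqr_sqrtr _ N.+1%:R)//.
  rewrite (ExZ P _ bS) ler_pdivrMl ?ltr0n//.
  have := second_moment_subset (bY (e i)) (EYY (e i)) (hK i) N.+1 xpredT.
  by rewrite sumr_const card_ord mulrC.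
- move=> t; have [_ _ _ hc _] := scalar_clt (tnth t).
  have -> : \int[mu]_x cos (dotv t x) = expR (- (lrv (fun k => bil (cov_at k) (tnth t) (tnth t)) / 2)).
    by rewrite /Rintegral (hmu t).1/= lrv_quad mulNr.
  rewrite (_ : (fun _ => _) = fun N => \int[P]_w cos ((Num.sqrt N%:R)^-1 * \sum_(s < N) lincomb (tnth t) s w))//.
  by apply/funext => N; apply: eq_Rintegral => w _; rewrite dotE.
- move=> t; have [_ _ _ _ hs] := scalar_clt (tnth t).
  have -> : \int[mu]_x sin (dotv t x) = 0.
    by rewrite /Rintegral (hmu t).2.
  rewrite (_ : (fun _ => _) = fun N => \int[P]_w sin ((Num.sqrt N%:R)^-1 * \sum_(s < N) lincomb (tnth t) s w))//.
  by apply/funext => N; apply: eq_Rintegral => w _; rewrite dotE.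
Qed.

End vector_clt.

(** * Ordinal patterns of the process and the proof of the limit theorem *)

Section ordinal_patterns.
Context {R : realType} (m : nat).
Implicit Types (x : 'I_m -> R) (s : {perm 'I_m}).

(** A value is the number of smaller values, so the comparisons [s k < s j] determine [s];
    uniqueness of the pattern follows. *)
Lemma perm_rank s j : val (s j) = (\sum_k (s k < s j)%N)%N.
Proof.
transitivity (\sum_(i < m) (i < s j)%N)%N; last exact: (reindex_inj (@perm_inj _ s)).
by rewrite -big_mkcond/= -(big_ord_widen m (fun=> 1%N) (ltnW (ltn_ord (s j)))) sum1_card card_ord.
Qed.

Lemma is_OP_unique x s s' : is_OP x s -> is_OP x s' -> s = s'.
Proof.
move=> /forallP h /forallP h'; apply/permP => j; apply: val_inj; rewrite (perm_rank s j) (perm_rank s' j).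
apply: eq_bigr => k _.
by have /forallP/(_ j)/eqP -> := h k; have /forallP/(_ j)/eqP -> := h' k.
Qed.

(** Patterns see only differences, which allows partial sums starting from 0 in place of the values
    of the process. *)
Lemma is_OP_shift x (c : R) s : is_OP (fun j => x j - c) s = is_OP x s.
Proof.
rewrite /is_OP; apply: eq_forallb => j; apply: eq_forallb => k.
by rewrite ltrD2r (inj_eq (addIr _)).
Qed.

Lemma piL_inj : injective (@piL m).
Proof.
move=> i j; rewrite /piL => /eqP; rewrite nth_uniq.
- by move/eqP/val_inj.
- by rewrite size_sort -cardE card_Sn ltn_ord.
- by rewrite size_sort -cardE card_Sn ltn_ord.
- by rewrite sort_uniq enum_uniq.
Qed.

Lemma cumsum_increments (y : m.-1.-tuple R) (x : nat -> R) (j : 'I_m) :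
  (forall i : 'I_m.-1, tnth y i = x i.+1 - x i) -> cumsum y j = x j - x 0%N.
Proof.
move=> yx; rewrite /cumsum; under eq_bigr do rewrite yx.
have jm : (j <= m.-1)%N by have := ltn_ord j; lia.
rewrite -(big_ord_widen m.-1 (fun i => x i.+1 - x i) jm).
by rewrite -(big_mkord xpredT (fun i => x i.+1 - x i)) telescope_sumr.
Qed.

End ordinal_patterns.

Theorem theorem2p3 (R : realType) (d : measure_display) (T : measurableType d)
  (P : probability T R) (m : nat) (X : int -> T -> R)
  (dZ : measure_display) (S : measurableType dZ) (Z : int -> T -> S)
  (a beta : nat -> R) (phi : R -> R) :
  let Delta : int -> T -> R := fun t w => X t w - X (t - 1) w in
  let Dvec : int -> T -> m.-1.-tuple R :=
    fun t w => [tuple Delta (t + (val i)%:Z + 1) w | i < m.-1] in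
  let Xvec : int -> T -> 'I_m -> R := fun t w j => X (t + (val j)%:Z) w in
  let p : 'I_(m`!) -> R := fun i => fine (P [set w | is_OP (Xvec 0 w) (piL i)]) in
  let pij : 'I_(m`!) -> 'I_(m`!) -> nat -> R := fun i j k =>
    fine (P [set w | is_OP (Xvec 0 w) (piL i) && is_OP (Xvec k%:Z w) (piL j)]) in
  let cterm : 'I_(m`!) -> 'I_(m`!) -> nat -> R := fun i j k =>
    pij i j k + pij j i k - 2 * p i * p j in
  let Sigma : 'I_(m`!) -> 'I_(m`!) -> R := fun i j =>
    p i * ((i == j)%:R - p j) + limn (fun n => \sum_(1 <= k < n) cterm i j k) in
  let phat : nat -> T -> (m`!).-tuple R := fun n w =>
    [tuple (n%:R)^-1 * \sum_(1 <= t < n.+1) tnth (hOP (Dvec t%:Z w)) i | i < m`!] in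
  let Vn : nat -> T -> (m`!).-tuple R := fun n w =>
    [tuple Num.sqrt (n%:R) * (tnth (phat n w) i - p i) | i < m`!] in
  (2 <= m)%N ->
  (forall t, measurable_fun setT (X t)) ->
  stationary P Delta ->
  (forall j k : 'I_m, j != k -> P [set w | X (val j)%:Z w = X (val k)%:Z w] = 0%E) ->
  one_approx P Delta Z a ->
  (forall k, beta_coef P Z k = (beta k)%:E) ->
  (\sum_(0 <= k <oo) (((k%:R) ^+ 2 * (Num.sqrt (a k) + beta k))%:E) < +oo)%E ->
  one_continuous_witness P (Dvec 0) phi ->
  (\sum_(m.-1 <= k <oo)
     (((k%:R) ^+ 2 * phi (2 * Num.sqrt (\sum_(i < m) a (k - i)%N)))%:E) < +oo)%E ->
  (forall i j, cvg (series (fun k => `|cterm i j k.+1|) @ \oo)) /\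
  exists mu : probability ((m`!).-tuple R) R,
    is_normal0 mu Sigma /\ cvg_dist P Vn mu.
Proof.
move=> Delta Dvec Xvec p pij cterm Sigma phat Vn m2 mX _ _ [[stZ [mZ [f [mf DE]]]] app] betaE
  sum_ab hphi sum_phi.
have mfPT : measurable_fun setT (f : g_sigma_algebraType (cylinders setT) -> R).
  by move=> _ B mB; rewrite setTI; exact: mf.
have DvecE t w : Dvec t w = increments f m (path Z t w).
  by apply: eq_from_tnth => i; rewrite !tnth_mktuple shift_path -addrA; exact: DE.
have approx k : exists g : T -> R,
    (forall B : set R, measurable B -> sigZ Z (window (- k%:Z) k%:Z) (g @^-1` B)) /\
    (\int[P]_w `|f (path Z 0 w) - g w|%:E <= (a k)%:E)%E.
  have [g [[mg _] fg]] := app k; exists g; split=> //.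
  by rewrite (eq_integral (fun w => `|Delta 0 w - g w|%:E))// => w _; rewrite DE.
have a0 k : 0 <= a k.
  by have [g [_ fg]] := approx k; rewrite -lee_fin; apply: le_trans fg; exact: integral_ge0.
have be0 k : 0 <= beta k by exact: beta_ge0 betaE k.
have hphi' : one_continuous_witness P (fun w => increments f m (path Z 0 w)) phi.
  by rewrite (_ : (fun _ => _) = Dvec 0)//; apply/funext => w.
have [phi_gt0 [phi0 [phi_cvg _]]] := hphi.
have m0 : (0 < m)%N by exact: ltnW.
have sq0 k : 0 <= Num.sqrt (a k) by exact: sqrtr_ge0.
have bab : bounded_sums (fun k => k%:R ^+ 2 * (Num.sqrt (a k) + beta k)).
  by apply: (bounded_sums_ereal (N := 0) _ sum_ab) => k; rewrite mulr_ge0 ?sqr_ge0 ?addr_ge0.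
have ba : bounded_sums (fun k => k%:R ^+ 2 * Num.sqrt (a k)).
  by apply: bounded_sums_le bab => k; rewrite ler_wpM2l ?sqr_ge0// lerDl.
have bb : bounded_sums (fun k => k%:R ^+ 2 * beta k).
  by apply: bounded_sums_le bab => k; rewrite ler_wpM2l ?sqr_ge0// lerDr.
have phi_ge0 e : 0 <= e -> 0 <= phi e.
  by rewrite le_eqVlt => /predU1P[<-|/phi_gt0/ltW //]; rewrite phi0.
have bphi : bounded_sums (fun k => if (m.-1 <= k)%N then
    k%:R ^+ 2 * phi (2 * Num.sqrt (\sum_(i < m) a (k - i)%N)) else 0).
  apply: (bounded_sums_ereal _ sum_phi) => k.
  by rewrite mulr_ge0 ?sqr_ge0// phi_ge0// mulr_ge0 ?sqrtr_ge0.
have bal := approx_rate_summable m0 a0 ba bphi.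
pose h i t w : R := tnth (hOP (increments f m (path Z t.+1%:Z w))) i.
pose H i (t : int) w : R := if is_OP (Xvec t w) (piL i) then 1 else 0.
(* The partial sums of the increments are the values of the process minus [X t], and the pattern
   ignores this shift. *)
have HE i t w : tnth (hOP (increments f m (path Z t w))) i = H i t w.
  rewrite tnth_mktuple /H -DvecE; congr (if _ then _ else _).
  rewrite -(is_OP_shift (Xvec t w) (X t w)); congr is_OP; apply/funext => j.
  rewrite (cumsum_increments (x := fun j => X (t + j%:Z) w)) ?addr0// => i'.
  rewrite tnth_mktuple /Delta (_ : t + (val i')%:Z + 1 = t + i'.+1%:Z); last by rewrite -addrA -PoszD addn1.
  by congr (_ - X _ _); rewrite -addn1 PoszD addrA addrK.
have mOP i t : measurable [set w | is_OP (Xvec t w) (piL i)].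
  by apply: measurable_bool_set; apply: measurable_is_OP => j; exact: mX.
have bF i : bdm (fun z : g_sigma_algebraType (cylinders (S := S) setT) => tnth (hOP (increments f m z)) i).
  exact: bdm_hOP (measurable_increments mfPT).
have H01 i t w : 0 <= H i t w <= 1 by rewrite /H; case: ifP; rewrite lexx ler01.
have bH i t : bdm (H i t) by exact: bdm_if.
have bh i t : bdm (h i t).
  by rewrite (_ : h i t = H i t.+1%:Z)//; apply/funext => w; exact: HE.
have Eh i t : \int[P]_w h i t w = p i.
  have -> : \int[P]_w h i t w = \int[P]_w tnth (hOP (increments f m (path Z 0 w))) i.
    apply: (path_Rintegral mZ stZ t.+1%:Z (bF i).1) => z.
    by rewrite tnth_mktuple; case: ifP.
  rewrite /p -(Ex_if P (mOP i 0)); apply: eq_Rintegral => w _; exact: HE.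
have Ehh i j t k : \int[P]_w (h i t w * h j (t + k)%N w) = pij i j k.
  (* A product of indicators at two times is one function of the path, so stationarity of the path
     moves it from time [t + 1] to time 0. *)
  pose G (z : int -> S) : R := tnth (hOP (increments f m z)) i * tnth (hOP (increments f m (shift k%:Z z))) j.
  have hG s w : G (path Z s w) = H i s w * H j (s + k%:Z) w by rewrite /G shift_path !HE.
  have mG : measurable_fun setT (G : g_sigma_algebraType (cylinders (S := S) setT) -> R).
    apply: measurable_funM; first exact: (bF i).1.
    apply: (measurableT_comp (bF j).1) => _ A cA; rewrite setTI.
    exact: (shift_cylinders (I := setT)) cA.
  have -> : \int[P]_w (h i t w * h j (t + k)%N w) = \int[P]_w G (path Z 0 w).
    have -> : \int[P]_w (h i t w * h j (t + k)%N w) = \int[P]_w G (path Z t.+1%:Z w).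
      by apply: eq_Rintegral => w _; rewrite hG /h !HE; congr (_ * H j _ w); lia.
    apply: (path_Rintegral mZ stZ t.+1%:Z mG) => z.
    by rewrite /G mulr_ge0// tnth_mktuple; case: ifP.
  have mI : measurable [set w | is_OP (Xvec 0 w) (piL i) && is_OP (Xvec k%:Z w) (piL j)].
    rewrite (_ : [set _ | _] = [set w | is_OP (Xvec 0 w) (piL i)] `&` [set w | is_OP (Xvec k%:Z w) (piL j)]).
      exact: measurableI.
    by apply/seteqP; split => w /=; [move/andP|move=> ?; exact/andP].
  rewrite /pij -(Ex_if P mI); apply: eq_Rintegral => w _.
  by rewrite hG /H add0r; case: (is_OP _ (piL i)); case: (is_OP _ (piL j)); rewrite ?mulr1 ?mulr0.
(* At lag zero two different patterns exclude each other, which yields the Kronecker delta of the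
   covariance. *)
have pij0 i j : pij i j 0 = (i == j)%:R * p i.
  rewrite /pij /p; case: eqVneq => [->|ij].
    by rewrite mul1r; congr (fine (P _)); apply/seteqP; split => w /=; rewrite andbb.
  rewrite mul0r (_ : [set _ | _] = set0) ?measure0//.
  apply/seteqP; split => w //= /andP[h1 h2].
  by have := is_OP_unique h1 h2 => /piL_inj/eqP; rewrite (negbTE ij).
have happrox l i : exists y : nat -> T -> R,
  [/\ forall t, window_fun Z (t.+1%:Z - l%:Z) (t.+1%:Z + l%:Z) (y t), forall t w, `|y t w| <= 1 &
      forall t, \int[P]_w `|h i t w - y t w| <= approx_rate m a phi l].
  have [ml|lm] := leqP m.-1 l.
    have [e [er [e0 er0 rate]]] := approx_rate_attained m0 a0 phi0 phi_cvg ml.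
    have [y [wy y1 hy]] := kernel_window_approx mZ stZ mfPT approx hphi' i ml e0 er0.
    exists (fun t => y t.+1%:Z); split => // t.
    exact: le_trans (hy _) rate.
  (* Below [m.-1] the rate is 1, and the zero function already attains it because indicators are at
     most 1. *)
  exists (fun _ _ => 0); split => [t|t w|t]; [exact: window_fun_cst|by rewrite normr0|].
  rewrite /approx_rate leqNgt lm/=; apply: Ex_le_cst => [|w].
    by apply: bdm_norm; apply: bdmB => //; exact: bdm_cst.
  by rewrite subr0 /h HE; have /andP[? ?] := H01 i t.+1%:Z w; rewrite ger0_norm.
have h01 i t w : 0 <= h i t w <= 1 by rewrite /h HE.
split=> [i j|]; first exact: (cov_term_summable mZ stZ betaE bh h01 Eh Ehh bal bb happrox).
have [mu [hmu hcvg]] := vector_clt mZ stZ betaE bh h01 Eh Ehh pij0 bal bb happrox.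
exists mu; split; first exact: hmu.
rewrite (_ : Vn = fun N w => [tuple Num.sqrt N%:R * (N%:R^-1 * \sum_(t < N) h i t w - p i) | i < m`!])//.
apply/funext => N; apply/funext => w; apply: eq_from_tnth => i; rewrite !tnth_mktuple.
congr (_ * (_ * _ - _)); rewrite big_add1 big_mkord; apply: eq_bigr => t _.
by rewrite DvecE.
Qed.
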